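(* Let $(\mathcal G,\mathsf P,\mathsf A)$ have fixed complexity $d\in\mathbb N_{>0}$. Let $0<\epsilon<\beta<1$ and $N_\star=\min\{N\in\mathbb N : C(\epsilon,N)\ge\beta\}$. Let $N_1\in\mathbb N$ and $N_{\max}\in\mathbb N$, and consider the random sequences $\{N_t\}_{t=1}^\infty$ and $\{\theta_t\}_{t=1}^\infty$ generated by the repetitive scenario design algorithm (described in the context) with data $\epsilon,\beta,N_1,N_{\max}$. Assume that $N_\star\le N_{\max}$. Then the following holds with probability one: (i) $\theta_t\to d$ as $t\to\infty$, and (ii) there is $t_0\in\mathbb N_{>0}$ such that for all $t\in\mathbb N_{\ge t_0}$, $N_t\in[N_\star-1,N_\star+1]$.
   Context: $\mathbb N$ is the set of nonnegative integers, $[N]=\{1,\dots,N\}$. **Scenario problem.** $\mathsf X$ is a set, $J:\mathsf X\to\mathbb R$ a function, $\mathcal G$ a set of functions $g:\mathsf X\to\mathbb R$, and $\mathsf P$ a probability measure on $\mathcal G$ (all events and random variables below are assumed measurable). For $N\in\mathbb N$ and $(g_1,\dots,g_N)\in\mathcal G^N$, $\mathsf A(g_1,\dots,g_N)$ denotes the solution of the scenario problem $$\min_{x\in\mathsf X} J(x)\quad\text{s.t.}\quad g_i(x)\le 0\ \ \forall i\in[N],$$ which is assumed to exist and to be unique. The risk of $x\in\mathsf X$ is $V(x)=\mathsf P[\{g\in\mathcal G: g(x)>0\}]$. For $\epsilon\in[0,1]$ and $N\in\mathbb N$, $$C(\epsilon,N)=\mathsf P^N\big(\{(g_1,\dots,g_N)\in\mathcal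 G^N : V(\mathsf A(g_1,\dots,g_N))\le\epsilon\}\big).$$ **Fixed complexity.** For $d\in\mathbb N_{>0}$, $(\mathcal G,\mathsf P,\mathsf A)$ has fixed complexity $d$ if for all $N\in\mathbb N_{\ge d}$, the following holds with probability one on $(g_1,\dots,g_N)\in\mathcal G^N$ (with respect to $\mathsf P^N$): there is a unique sub-tuple $(g_{i_1},\dots,g_{i_d})$ with $1\le i_1<\dots<i_d\le N$ such that $\mathsf A(g_1,\dots,g_N)=\mathsf A(g_{i_1},\dots,g_{i_d})$. **Parametric family.** Let $\Theta=\mathbb R_{>0}$ and let $B(a,b)=\int_0^1 v^{a-1}(1-v)^{b-1}\,dv$ be the Beta function. For $\theta\in\Theta$, $v\in[0,1]$, $N\in\mathbb N$, $$f_\theta(v,N)=\begin{cases}1 & \text{if } v=0\text{ or }N=0,\\ \dfrac{v^{\theta-1}(1-v)^{N-\theta}}{B(\theta,N-\theta+1)} & \text{if } v\ne0,\ N\neq 0\text{ and }N>\theta,\\ N v^{N-1} & \text{otherwise.}\end{cases}$$ **Maximum likelihood estimator.** For a finite indexed data set $\mathcal D=\{(v_j,N_j)\}_{j=1}^M\subseteq[0,1]\times\mathbb N$ (repetitions allowed, $M\ge1$), $\ell(\theta;\mathcal D)=\frac1M\sum_{j=1}^M\log(f_\theta(v_j,N_j))$ with $\log 0=-\infty$, and $\theta_\star(\mathcal D)$ denotes a maximizer of $\ell(\cdot;\mathcal D)$ over $\Theta$, i.e. $\theta_\star(\mathcal D)=\arg\max_{\theta\in\Theta}\ell(\theta;\mathcal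 D)$. **Sample size estimate.** $\bar n(\theta;\epsilon,\beta)=\min\{N\in\mathbb N : \int_0^\epsilon f_\theta(v,N)\,dv\ge\beta\}$. **Repetitive scenario design algorithm.** Input: $\epsilon,\beta\in[0,1]$, $N_1\in\mathbb N$, $N_{\max}\in\mathbb N$. Start with the empty data set $\mathcal D_0$. For $t=1,2,\dots$: draw $N_t$ fresh i.i.d. samples $g_1,\dots,g_{N_t}\sim\mathsf P$ (independent of all previous draws); let $x_t=\mathsf A(g_1,\dots,g_{N_t})$; let $\mathcal D_t$ be $\mathcal D_{t-1}$ with the data point $(V(x_t),N_t)$ appended, so that $\mathcal D_t=\{(V(x_s),N_s)\}_{s=1}^t$; let $\theta_t=\theta_\star(\mathcal D_t)$; let $N_{t+1}=\min\{\bar n(\theta_t;\epsilon,\beta),N_{\max}\}$. *)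

(* Defs.v *)
From HB Require Import structures.
From mathcomp Require Import all_boot all_order all_algebra.
From mathcomp Require Import all_classical all_reals all_analysis.

Set Implicit Arguments.
Unset Strict Implicit.
Unset Printing Implicit Defensive.

Import Order.TTheory GRing.Theory Num.Theory.
Import numFieldNormedType.Exports.

Local Open Scope classical_set_scope.
Local Open Scope ring_scope.

(* The default [0%N] is only reached on the empty set. *)
Definition nat_min (P : set nat) : nat :=
  xget 0%N [set n | P n /\ forall m, P m -> (n <= m)%N].

Section power_probability.
Context d (T : measurableType d) (R : realType) (P : probability T R).

Definition tcons n (x : T * n.-tuple T) : n.+1.-tuple T := [tuple of x.1 :: x.2].

Lemma measurable_tcons n : measurable_fun [set: T * n.-tuple T] (@tcons n).
Proof. exact: (measurable_cons measurable_fst measurable_snd). Qed.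

HB.instance Definition _ n :=
  isMeasurableFun.Build _ _ _ _ (@tcons n) (@measurable_tcons n).

Definition prod_prob d' (T' : measurableType d') (Q : probability T' R) :=
  (P \x Q)%E.

Section prod_prob.
Context d' (T' : measurableType d') (Q : probability T' R).

HB.instance Definition _ := Measure.on (prod_prob Q).

Let prod_prob_setT : prod_prob Q [set: T * T'] = 1%E.
Proof.
rewrite -setXTT /prod_prob product_measure1E//.
by rewrite [X in (X * _)%E](probability_setT P) [X in (_ * X)%E](probability_setT Q) mule1.
Qed.

HB.instance Definition _ :=
  Measure_isProbability.Build _ _ _ (prod_prob Q) prod_prob_setT.

End prod_prob.

Fixpoint power_prob n : probability (n.-tuple T) R :=
  if n is m.+1 then distribution (prod_prob (power_prob m)) (@tcons m)
  else dirac [tuple].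

End power_probability.

Section scenario.
Context d (G : measurableType d) (R : realType) (X : Type).
Variables (J : X -> R) (ev : G -> X -> R) (P : probability G R).

Definition feasible (s : seq G) (x : X) : Prop :=
  forall g, g \in s -> ev g x <= 0.

Definition scenario_solution (s : seq G) (x : X) : Prop :=
  feasible s x /\ forall y, feasible s y -> J x <= J y.

Definition risk (x : X) : R := fine (P [set g | 0 < ev g x]).

Variable A : seq G -> X.

Definition confidence (eps : R) (N : nat) : \bar R :=
  power_prob P N [set s : N.-tuple G | risk (A s) <= eps].

Definition increasing_indices k N (i : k.-tuple 'I_N) : bool :=
  sorted ltn [seq val j | j <- i].

Definition subtuple k N (s : N.-tuple G) (i : k.-tuple 'I_N) : k.-tuple G :=
  [tuple tnth s (tnth i j) | j < k].

(* Sub-tuples are counted by their indices: for an atomic [P], sub-tuples with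
   different indices may have the same entries. *)
Definition fixed_complexity (k : nat) : Prop :=
  forall N, (k <= N)%N ->
    {ae power_prob P N, forall s : N.-tuple G,
      exists! i : k.-tuple 'I_N,
        increasing_indices i /\ A s = A (subtuple s i)}.

(* Measurability of the events behind [risk], [confidence] and
   [fixed_complexity k]. *)
Definition scenario_measurable (k : nat) : Prop :=
  [/\ forall x, measurable [set g | 0 < ev g x],
      forall N, measurable_fun [set: N.-tuple G] (fun s => risk (A s)) &
      forall N (i : k.-tuple 'I_N), increasing_indices i ->
        measurable [set s : N.-tuple G | A s = A (subtuple s i)] ].

End scenario.

Section parametric_family.
Context (R : realType).

(* [0 `^ x] is [0] for every [x != 0], including [x < 0]; this only affects the
   integrand at the endpoints. *)
Definition Beta (a b : R) : R :=
  \int[lebesgue_measure]_(v in `[0, 1]) (v `^ (a - 1) * (1 - v) `^ (b - 1)).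

Definition dens (theta v : R) (N : nat) : R :=
  if (v == 0) || (N == 0)%N then 1
  else if theta < N%:R then
    v `^ (theta - 1) * (1 - v) `^ (N%:R - theta) / Beta theta (N%:R - theta + 1)
  else N%:R * v ^+ N.-1.

(* [lne 0 = -oo] *)
Definition loglik (theta : R) (D : seq (R * nat)) : \bar R :=
  (((size D)%:R^-1)%:E * \sum_(p <- D) lne (dens theta p.1 p.2)%:E)%E.

Definition is_mle (D : seq (R * nat)) (theta : R) : Prop :=
  0 < theta /\
  forall theta', 0 < theta' -> (loglik theta' D <= loglik theta D)%E.

Definition valid_data (D : seq (R * nat)) : Prop :=
  forall p, p \in D -> 0 <= p.1 <= 1.

(* The maximizer need not be unique, so [thetas] is an arbitrary measurable
   selection; it depends on nothing but the data. *)
Definition mle_selection (thetas : seq (R * nat) -> R) : Prop :=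
  (forall D, D <> [::] -> valid_data D -> is_mle D (thetas D)) /\
  (forall M, measurable_fun [set D : M.-tuple (R * nat) | valid_data D]
     (fun D : M.-tuple (R * nat) => thetas D)).

Definition nbar (theta eps beta : R) : nat :=
  nat_min [set N | (beta%:E <=
    \int[lebesgue_measure]_(v in `[0%R, eps]) (dens theta v N)%:E)%E].

End parametric_family.

Section algorithm.
Context d (G : measurableType d) (R : realType) (X : Type).
Variables (ev : G -> X -> R) (P : probability G R) (A : seq G -> X).
Variables (thetas : seq (R * nat) -> R) (eps beta : R) (N1 Nmax : nat).

Definition next_size (D : seq (R * nat)) : nat :=
  if D is [::] then N1 else minn (nbar (thetas D) eps beta) Nmax.

(* One run of the algorithm, as a function of the realized scenarios: iteration
   [t >= 1] draws the first [N_t] entries of row [t] of [xi]; row [0] is not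
   used. *)
Variable xi : nat -> nat -> G.

Fixpoint dataset (t : nat) : seq (R * nat) :=
  if t is s.+1 then
    let D := dataset s in
    let n := next_size D in
    rcons D (risk ev P (A (mkseq (xi t) n)), n)
  else [::].

(* Meaningful for [t >= 1]. *)
Definition sample_size (t : nat) : nat := next_size (dataset t.-1).

Definition theta_seq (t : nat) : R := thetas (dataset t).

End algorithm.

Section iid.
Context d d' (W : measurableType d) (G : measurableType d') (R : realType).
Variables (Pr : probability W R) (P : probability G R).

Definition mutually_independent (I : eqType) (xi : I -> W -> G) : Prop :=
  forall (s : seq I) (B : I -> set G), uniq s -> (forall i, measurable (B i)) ->
    Pr (\big[setI/setT]_(i <- s) (xi i @^-1` B i)) =
    (\prod_(i <- s) Pr (xi i @^-1` B i))%E.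

Definition iid (I : eqType) (xi : I -> W -> G) : Prop :=
  [/\ forall i, measurable_fun [set: W] (xi i),
      forall i B, measurable B -> Pr (xi i @^-1` B) = P B &
      mutually_independent xi].

End iid.

(* Main.v *)
Require Import Defs.
From HB Require Import structures.
From mathcomp Require Import all_boot all_order all_algebra.
From mathcomp Require Import all_classical all_reals all_analysis.
From mathcomp Require Import measurable_realfun lebesgue_integral_under.
From mathcomp Require Import zify ring lra.

(** The proof rests on three facts: the law of the risk is a member of the
    parametric family, the family is log-concave in its parameter, and a
    supermartingale controls the likelihood of the data although the sizes are
    chosen adaptively.

    Law of the risk. Let [V_N] be the risk of the solution for [N] scenarios. A
    sub-tuple of size [d] keeps its solution in a sample of size [d + k] exactly
    when the other [k] scenarios are satisfied there, which has conditional
    probability [(1 - V_d) ^ k]. Exactly one sub-tuple does so almost surely,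
    hence the law of [V_(d + k)] is that of [V_d] with the density
    [C(d + k, d) (1 - v) ^ k] ([risk_prob]). Its total mass is one for all [k],
    which gives the moments of [1 - V_d]; so [V_d] has the law [Beta(d, 1)] and
    [V_N] the law [Beta(d, N - d + 1)] ([risk_beta_law]). For [N < d] the risk
    is one almost surely ([small_sample_risk]). In particular [Nstar] is the
    estimate [nbar] at the parameter [d] ([Nstar_nbar]).

    Likelihood at recurrent sizes. Fix a size [n >= d], a parameter [x <= n]
    other than [d] and multiply, over the iterations of size [n], the square
    roots of the likelihood ratios of [x] against [d]. Given the past, the
    factor has mean at most a constant less than one, namely the Hellinger
    affinity of two distinct densities ([beta_hellinger]). Each visit to [n]
    thus costs the product a fixed proportion of its mean, so that the values
    at the visits have a finite total expectation; the product tends to zero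
    almost surely where [n] is visited infinitely often
    ([recurrent_prodZ_cvg0]). Almost surely this holds for all [n >= d] and the
    parameters [x = d - 1 / (m + 2)], and for all [n > d] and the parameters [x
    = d + 1 / (m + 1)].

    One run. The log-density is concave in the parameter up to the size and
    constant beyond it. So the likelihood ratio against [d] at a parameter
    further from [d] than [x], on the same side, is bounded by a multiple of
    the ratio at [x] ([llr_below], [llr_above]): countably many parameters
    control all of them. There are finitely many sizes, and those visited
    finitely often contribute a bounded amount, so one recurrent size at which
    the ratio diverges excludes the maximizers beyond [x] eventually.
    Recurrent sizes are found in two stages. The sizes cannot remain less than
    [d], since then the maximizer is at least the last size and the estimate is
    greater than the maximizer ([nbar_gt]); this yields
    [theta_t > d - delta] eventually. By [nbar_gt] and [nbar_near] all sizes
    are then greater than [d] eventually, where parameters greater than [d]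
    can be distinguished from [d], and this yields [theta_t < d + delta]
    eventually. Finally, the estimate for a parameter close to [d] is [Nstar]
    or [Nstar + 1], by continuity in the parameter and strict monotonicity in
    the size of the distribution functions ([nbar_near]). *)

Set Implicit Arguments.
Unset Strict Implicit.
Unset Printing Implicit Defensive.

Import Order.TTheory GRing.Theory Num.Theory.
Import numFieldNormedType.Exports.

Local Open Scope classical_set_scope.
Local Open Scope ring_scope.

(** * Laws of tuples of i.i.d. scenarios *)

Section tuple_laws.
Context (R : realType) d (G : measurableType d) (P : probability G R).

Section one_list.
Context dW (W : measurableType dW) (I : eqType) (xi : I -> W -> G).
Hypothesis mxi : forall i, measurable_fun [set: W] (xi i).

Lemma measurable_map_tuple n (l : n.-tuple I) :
  measurable_fun [set: W] (fun w => map_tuple (xi^~ w) l).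
Proof.
apply/measurable_fun_tnthP => i.
rewrite (_ : _ \o _ = xi (tnth l i)); first exact: mxi.
by apply/funext => w /=; rewrite tnth_map.
Qed.

(** The induction on the list needs finite measures [m] beyond probabilities:
    the induction hypothesis, on the tail of the list, is used for the
    restriction of [m] to an event that concerns the first scenario. *)
Lemma tuple_law n (l : n.-tuple I) (m : {measure set W -> \bar R})
    (c : {nonneg R}) :
  uniq l ->
  (forall B : I -> set G, (forall i, measurable (B i)) ->
    m (\big[setI/setT]_(i <- l) (xi i @^-1` B i)) =
      (c%:num%:E * \prod_(i <- l) P (B i))%E) ->
  forall B : set (n.-tuple G), measurable B ->
    m ((fun w => map_tuple (xi^~ w) l) @^-1` B) =
      (c%:num%:E * power_prob P n B)%E.
Proof.
elim: n l m c => [|n IH] l m c.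
  move=> _ /(_ (fun=> setT) (fun=> measurableT)).
  rewrite tuple0 !big_nil mule1 => mT B mB.
  rewrite /= /dirac/= indicE.
  case: (boolP ([tuple] \in B)) => [/[!inE] B0|/negP B0].
    rewrite mule1 -mT; congr (m _); apply/seteqP; split => //= w _ /=.
    by rewrite [X in B X](_ : _ = [tuple])//; apply: val_inj.
  rewrite mule0 (_ : _ @^-1` _ = set0) ?measure0//.
  apply/seteqP; split => //= w Bw.
  by apply: B0; rewrite inE; congr B : Bw; apply: val_inj.
case/tupleP: l => i0 l /= /andP[i0l ul] H B mB.
pose f w := (xi i0 w, map_tuple (xi^~ w) l).
have mf : measurable_fun [set: W] f.
  by apply: measurable_fun_pair => //; exact: measurable_map_tuple.
rewrite /= /distribution /pushforward/=.
have fE : (fun w => map_tuple (xi^~ w) [tuple of i0 :: l]) = @tcons _ G n \o f.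
  by apply/funext => w; apply/val_inj.
rewrite fE comp_preimage.
have mB' : measurable (@tcons _ G n @^-1` B).
  by rewrite -[X in measurable X]setTI; exact: measurable_tcons.
move: (_ @^-1` B) mB' => {}B {}mB.
have E := @product_measure_unique _ _ _ _ R (mscale c P)
  (power_prob P n) (pushforward m f).
rewrite -[LHS]/(pushforward m f B) -E//; last first.
  move=> A B0 mA mB0.
  have mxA : measurable (xi i0 @^-1` A).
    by rewrite -[X in measurable X]setTI; exact: mxi.
  have PAE : P A = (fine (P A))%:E by rewrite fineK ?fin_num_measure.
  have PA0 : 0 <= fine (P A) by rewrite fine_ge0.
  transitivity (mrestr m mxA ((fun w => map_tuple (xi^~ w) l) @^-1` B0)).
    by rewrite /= /pushforward /mrestr setIC.
  have cPA0 : 0 <= c%:num * fine (P A) by exact: mulr_ge0.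
  rewrite (IH l (mrestr m mxA) (NngNum cPA0) ul) => //=.
    by rewrite EFinM -PAE /mscale.
  move=> B1 mB1.
  pose B2 i := if i == i0 then A else B1 i.
  have /H : forall i, measurable (B2 i) by rewrite /B2 => i; case: ifP.
  have B2E i : i \in val l -> B2 i = B1 i.
    by rewrite /B2; case: eqP => // -> il; move: i0l; rewrite il.
  rewrite !big_cons {1 3}/B2 eqxx EFinM -PAE -muleA.
  rewrite (eq_big_seq (fun i => P (B1 i))); last by move=> i /B2E ->.
  rewrite (eq_big_seq (fun i => xi i @^-1` B1 i)); last by move=> i /B2E ->.
  by rewrite /mrestr setIC.
transitivity (mscale c (prod_prob P (power_prob P n)) B) => //.
apply: product_measure_unique => // A B0 mA mB0.
rewrite -[LHS]/(c%:num%:E * (P \x power_prob P n) (A `*` B0))%E.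
by rewrite product_measure1E// muleA.
Qed.

End one_list.

Section two_lists.
Context dW (W : measurableType dW) (Pr : probability W R).
Context (I : eqType) (xi : I -> W -> G).
Hypothesis xi_iid : iid Pr P xi.

Let mxi i : measurable_fun [set: W] (xi i). Proof. by have [] := xi_iid. Qed.

Let mrect (l : seq I) (B : I -> set G) : (forall i, measurable (B i)) ->
  measurable (\big[setI/[set: W]]_(i <- l) xi i @^-1` B i).
Proof.
by move=> mB; apply: bigsetI_measurable => i _; rewrite -[X in measurable X]setTI; exact: mxi.
Qed.

Lemma iid_rectangle (l : seq I) (B : I -> set G) : uniq l ->
  (forall i, measurable (B i)) ->
  Pr (\big[setI/[set: W]]_(i <- l) xi i @^-1` B i) = (\prod_(i <- l) P (B i))%E.
Proof.
move=> ul mB; have [_ lawxi indep] := xi_iid.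
by rewrite indep//; apply: eq_bigr => i _; rewrite lawxi.
Qed.

Lemma prode_nng (l : seq I) (B : I -> set G) : (forall i, measurable (B i)) ->
  exists c : {nonneg R}, (\prod_(i <- l) P (B i))%E = c%:num%:E.
Proof.
move=> mB; elim: l => [|i l [c IH]]; first by exists 1%:nng; rewrite big_nil.
have p0 : 0 <= fine (P (B i)) * c%:num by rewrite mulr_ge0// fine_ge0.
by exists (NngNum p0); rewrite big_cons IH /= EFinM fineK// fin_num_measure.
Qed.

Lemma iid_tuple_law n (l : n.-tuple I) (B : set (n.-tuple G)) : uniq l ->
  measurable B ->
  Pr ((fun w => map_tuple (xi^~ w) l) @^-1` B) = power_prob P n B.
Proof.
move=> ul mB; rewrite (tuple_law (m := Pr) (c := 1%:nng) mxi)//= ?mul1e//.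
by move=> C mC; rewrite mul1e iid_rectangle.
Qed.

(** [tuple_law] twice: for the restriction of [Pr] to the event about the first
    tuple, and, in its premise, for the restriction to a rectangle about the
    second one. *)
Lemma iid_two_tuples_rectangle n1 n2 (l1 : n1.-tuple I) (l2 : n2.-tuple I)
    (B1 : set (n1.-tuple G)) (B2 : set (n2.-tuple G)) :
  uniq (l1 ++ l2) -> measurable B1 -> measurable B2 ->
  Pr ((fun w => map_tuple (xi^~ w) l1) @^-1` B1 `&`
      (fun w => map_tuple (xi^~ w) l2) @^-1` B2) =
    (power_prob P n1 B1 * power_prob P n2 B2)%E.
Proof.
move=> ul mB1 mB2; have := ul; rewrite cat_uniq => /and3P[u1 dl u2].
have mT1 : measurable ((fun w => map_tuple (xi^~ w) l1) @^-1` B1).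
  by rewrite -[X in measurable X]setTI; exact: measurable_map_tuple.
have c0 : 0 <= fine (power_prob P n1 B1) by rewrite fine_ge0.
rewrite -[P1 in (P1 * _)%E]fineK ?fin_num_measure//.
rewrite -(tuple_law (m := mrestr Pr mT1) (c := NngNum c0) mxi u2)//=.
  by rewrite /mrestr setIC.
move=> C mC; rewrite fineK ?fin_num_measure// /mrestr setIC.
have mC' := mrect l2 mC.
have [c cE] := prode_nng l2 mC.
rewrite cE muleC -(tuple_law (m := mrestr Pr mC') (c := c) mxi u1)//= => D mD.
pose E i := if i \in l1 then D i else C i.
have mE i : measurable (E i) by rewrite /E; case: ifP.
have E1 i : i \in val l1 -> E i = D i by rewrite /E => ->.
have E2 i : i \in val l2 -> E i = C i.
  rewrite /E => il2; case: ifPn => // il1.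
  by move/hasPn: dl => /(_ _ il2); rewrite /= il1.
have := iid_rectangle ul mE; rewrite !big_cat/= => EE.
rewrite /mrestr.
rewrite -(eq_big_seq _ (F1 := fun i => xi i @^-1` E i)); last first.
  by move=> i /E1 ->.
rewrite -[X in _ `&` X](eq_big_seq _ (F1 := fun i => xi i @^-1` E i)); last first.
  by move=> i /E2 ->.
rewrite EE -cE muleC; congr (_ * _)%E; apply: eq_big_seq => i.
  by move/E2 ->.
by move/E1 ->.
Qed.

Lemma iid_two_tuples n1 n2 (l1 : n1.-tuple I) (l2 : n2.-tuple I)
    (C : set (n1.-tuple G * n2.-tuple G)) : uniq (l1 ++ l2) -> measurable C ->
  Pr ((fun w => (map_tuple (xi^~ w) l1, map_tuple (xi^~ w) l2)) @^-1` C) =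
    (power_prob P n1 \x power_prob P n2)%E C.
Proof.
move=> ul mC.
pose f w := (map_tuple (xi^~ w) l1, map_tuple (xi^~ w) l2).
have mf : measurable_fun [set: W] f.
  by apply: measurable_fun_pair; exact: measurable_map_tuple.
have E := @product_measure_unique _ _ _ _ R (power_prob P n1)
  (power_prob P n2) (pushforward Pr f).
rewrite -[LHS]/(pushforward Pr f C) -E// => B1 B2 mB1 mB2.
by rewrite -(iid_two_tuples_rectangle ul).
Qed.

Lemma iid_two_tuples_integral n1 n2 (l1 : n1.-tuple I) (l2 : n2.-tuple I)
    (h : n1.-tuple G * n2.-tuple G -> \bar R) : uniq (l1 ++ l2) ->
  measurable_fun [set: n1.-tuple G * n2.-tuple G] h -> (forall x, 0 <= h x)%E ->
  (\int[Pr]_w h (map_tuple (xi^~ w) l1, map_tuple (xi^~ w) l2) =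
   \int[power_prob P n1]_p \int[power_prob P n2]_r h (p, r))%E.
Proof.
move=> ul mh h0.
pose f w := (map_tuple (xi^~ w) l1, map_tuple (xi^~ w) l2).
have mf : measurable_fun [set: W] f.
  by apply: measurable_fun_pair; exact: measurable_map_tuple.
rewrite -[RHS](@fubini_tonelli1 _ _ _ _ R (power_prob P n1) (power_prob P n2) h)//.
rewrite (eq_measure_integral (pushforward Pr f)); last first.
  by move=> C mC _; apply/esym; exact: (iid_two_tuples ul mC).
by rewrite ge0_integral_pushforward.
Qed.

End two_lists.

Lemma measurable_rectangle n (B : 'I_n -> set G) :
  (forall i, measurable (B i)) ->
  measurable [set s : n.-tuple G | forall i, B i (tnth s i)].
Proof.
move=> mB; rewrite (_ : mkset _ = \bigcap_i ((@tnth n G)^~ i @^-1` B i)).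
  apply: fin_bigcap_measurable => [|i _]; first exact: finite_finset.
  by rewrite -[X in measurable X]setTI; exact: measurable_tnth.
by apply/seteqP; split => [s Bs i _|s Bs i]; [exact: (Bs i)|exact: (Bs i I)].
Qed.

Lemma power_prob_rectangle n (B : 'I_n -> set G) :
  (forall i, measurable (B i)) ->
  power_prob P n [set s | forall i, B i (tnth s i)] =
    (\prod_(i < n) P (B i))%E.
Proof.
elim: n B => [|n IH] B mB.
  rewrite big_ord0 (_ : mkset _ = setT) ?probability_setT//.
  by apply/seteqP; split => // s _ [].
rewrite big_ord_recl /= /distribution /pushforward -IH//.
transitivity ((P \x power_prob P n)%E
    (B ord0 `*` [set s : n.-tuple G | forall i, B (lift ord0 i) (tnth s i)])).
  congr ((P \x power_prob P n)%E _); apply/seteqP.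
  split => [[g s]/= Bs|[g s]/= [Bg Bs] i].
    split; first by have := Bs ord0; rewrite tnth0.
    by move=> i; have := Bs (lift ord0 i); rewrite tnthS.
  by case: (unliftP ord0 i) => [j ->|->]; [rewrite tnthS|rewrite tnth0].
by apply: product_measure1E => //; apply: (measurable_rectangle (B := fun i => B (lift ord0 i))).
Qed.

(** Gives access to the laws of sub-tuples of one sample: they are tuples of
    entries of an i.i.d. family, so that in particular a sample is
    exchangeable. *)
Lemma power_prob_iid n :
  iid (power_prob P n) P (fun (i : 'I_n) (s : n.-tuple G) => tnth s i).
Proof.
have rect (s : seq 'I_n) (B : 'I_n -> set G) : uniq s ->
    (forall i, measurable (B i)) ->
    power_prob P n (\big[setI/setT]_(i <- s) ((@tnth n G)^~ i @^-1` B i)) =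
    (\prod_(i <- s) P (B i))%E.
  move=> us mB; pose B' i := if i \in s then B i else setT.
  have mB' i : measurable (B' i) by rewrite /B'; case: ifP.
  rewrite [RHS]big_uniq// [RHS]big_mkcond/= -bigcap_seq.
  rewrite [RHS](eq_bigr (fun i => P (B' i))) => [|i _]; last first.
    by rewrite /B'; case: (i \in s) => //; rewrite probability_setT.
  rewrite -power_prob_rectangle//.
  rewrite [X in power_prob P n X](_ : _ = [set t | forall i, B' i (tnth t i)])//.
  apply/seteqP; split => t/= Bt i; rewrite /B'.
    by case: ifP => // si; exact: Bt.
  by move=> /= si; have := Bt i; rewrite /B' si.
have law (i : 'I_n) (B : set G) : measurable B ->
    power_prob P n ((@tnth n G)^~ i @^-1` B) = P B.
  by move=> mB; have := rect [:: i] (fun=> B); rewrite !big_seq1; exact.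
split => //; first exact: measurable_tnth.
move=> s B us mB; rewrite rect//; apply: eq_bigr => i _.
by rewrite law.
Qed.

End tuple_laws.

(** * Scenario solutions under fixed complexity *)

Section scenario_law.
Context (R : realType) (X : Type) (J : X -> R).
Context (dG : measure_display) (G : measurableType dG) (ev : G -> X -> R).
Context (P : probability G R) (A : seq G -> X).
Hypothesis A_sol : forall s : seq G, unique (scenario_solution J ev s) (A s).
Context (d : nat) (d_gt0 : (0 < d)%N).
Hypothesis A_meas : scenario_measurable ev P A d.

Local Notation V s := (risk ev P (A s)).

(** A minimizer under fewer constraints that satisfies the other constraints is
    a minimizer under all of them; uniqueness identifies it. *)
Lemma solution_subset (s s' : seq G) : {subset s <= s'} ->
  A s' = A s <-> feasible ev s' (A s).
Proof.
move=> ss'; split => [<-|fs']; first by have [[]] := A_sol s'.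
have [_ uA] := A_sol s'; apply: uA; split => // y fy.
have [[_ minA] _] := A_sol s; apply: minA => g gs.
by apply: fy; exact: ss'.
Qed.

Lemma solution_between (s1 s2 s3 : seq G) :
  {subset s1 <= s2} -> {subset s2 <= s3} -> feasible ev s3 (A s1) ->
  A s3 = A s2.
Proof.
move=> s12 s23 f3.
have -> : A s3 = A s1 by apply/solution_subset => // g /s12; exact: s23.
apply/esym/solution_subset => // g gs2; apply: f3; exact: s23.
Qed.

Lemma measurable_violation x : measurable [set g | 0 < ev g x].
Proof. by have [] := A_meas. Qed.

Lemma riskE x : P [set g | 0 < ev g x] = (risk ev P x)%:E.
Proof. by rewrite fineK// fin_num_measure//; exact: measurable_violation. Qed.

Lemma risk_ge0 x : 0 <= risk ev P x. Proof. exact: fine_ge0. Qed.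

Lemma risk_le1 x : risk ev P x <= 1.
Proof.
by rewrite -lee_fin -riskE probability_le1//; exact: measurable_violation.
Qed.

Lemma satisfactionC x : [set g | ev g x <= 0] = ~` [set g | 0 < ev g x].
Proof. by apply/seteqP; split => g /=; rewrite leNgt => /negP. Qed.

Lemma measurable_satisfaction x : measurable [set g | ev g x <= 0].
Proof. by rewrite satisfactionC; exact/measurableC/measurable_violation. Qed.

Lemma satisfactionE x : P [set g | ev g x <= 0] = (1 - risk ev P x)%:E.
Proof.
rewrite satisfactionC probability_setC; last exact: measurable_violation.
by rewrite riskE.
Qed.

Lemma feasible_rectangle k x : [set s : k.-tuple G | feasible ev s x] =
  [set s | forall i, [set g | ev g x <= 0] (tnth s i)].
Proof.
apply/seteqP; split => s /= fs; first by move=> i; apply: fs; exact: mem_tnth.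
by move=> g /tnthP[i ->]; exact: fs.
Qed.

Lemma measurable_feasible k x :
  measurable [set s : k.-tuple G | feasible ev s x].
Proof.
rewrite feasible_rectangle.
by apply: (measurable_rectangle (B := fun=> _)) => _; exact: measurable_satisfaction.
Qed.

Lemma feasible_prob k x :
  power_prob P k [set s : k.-tuple G | feasible ev s x] =
    ((1 - risk ev P x) ^+ k)%:E.
Proof.
rewrite feasible_rectangle (power_prob_rectangle P (B := fun=> _)) => [|_]; last first.
  exact: measurable_satisfaction.
rewrite (eq_bigr (fun=> (1 - risk ev P x)%:E)) => [|i _]; last first.
  by rewrite satisfactionE.
rewrite big_const_ord.
by elim: k => [//|k IH]; rewrite iterS IH -EFinM -exprS.
Qed.

Lemma measurable_risk N : measurable_fun [set: N.-tuple G] (fun s => V s).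
Proof. by have [_ ] := A_meas; exact. Qed.

Lemma measurable_risk_set N (B : set R) : measurable B ->
  measurable [set s : N.-tuple G | B (V s)].
Proof.
move=> mB; have := @measurable_risk N measurableT B mB.
by rewrite setTI.
Qed.

Lemma subtupleE k N (i : k.-tuple 'I_N) (s : N.-tuple G) :
  subtuple s i = map_tuple (fun j => tnth s j) i.
Proof. by apply: eq_from_tnth => j; rewrite tnth_mktuple tnth_map. Qed.

Lemma subtuple_sub k N (i : k.-tuple 'I_N) (s : N.-tuple G) :
  {subset subtuple s i <= s}.
Proof. by rewrite subtupleE => g /= /mapP[j _ ->]; exact: mem_tnth. Qed.

Lemma mem_subtuple k N (i : k.-tuple 'I_N) (s : N.-tuple G) l :
  l \in i -> tnth s l \in subtuple s i.
Proof. by move=> li; rewrite subtupleE; apply/mapP; exists l. Qed.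

Section split.
Variables (n1 n2 : nat).

Definition left_indices : n1.-tuple 'I_(n1 + n2) :=
  [tuple lshift n2 i | i < n1].
Definition right_indices : n2.-tuple 'I_(n1 + n2) :=
  [tuple rshift n1 i | i < n2].

Lemma increasing_left_indices : increasing_indices left_indices.
Proof.
rewrite /increasing_indices /= -map_comp.
rewrite (eq_map (g := val))// val_enum_ord; exact: iota_ltn_sorted.
Qed.

Lemma subtuple_left (p : n1.-tuple G) (r : n2.-tuple G) :
  subtuple (cat_tuple p r) left_indices = p.
Proof.
by apply: eq_from_tnth => i; rewrite !tnth_mktuple tnth_lshift.
Qed.

Lemma cat_subtuple (s : (n1 + n2).-tuple G) :
  cat_tuple (subtuple s left_indices) (subtuple s right_indices) = s.
Proof.
apply: eq_from_tnth => i; case: (split_ordP i) => j ->.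
  by rewrite tnth_lshift !tnth_mktuple.
by rewrite tnth_rshift !tnth_mktuple.
Qed.

Lemma uniq_left_right : uniq (left_indices ++ right_indices).
Proof.
have u1 : uniq left_indices by rewrite map_inj_uniq ?enum_uniq//; exact: lshift_inj.
have u2 : uniq right_indices by rewrite map_inj_uniq ?enum_uniq//; exact: rshift_inj.
rewrite cat_uniq u1 u2 andbT/=.
apply/hasPn => _ /mapP[j _ ->]; apply/negP => /mapP[i _] /eqP.
by rewrite eq_rlshift.
Qed.

Lemma measurable_cat_tuple :
  measurable_fun [set: n1.-tuple G * n2.-tuple G]
    (fun pr => cat_tuple pr.1 pr.2).
Proof.
apply/measurable_fun_tnthP => i; case: (split_ordP i) => j ->.
  rewrite (_ : _ \o _ = (@tnth _ G)^~ j \o fst); last first.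
    by apply/funext => -[p r] /=; rewrite tnth_lshift.
  by apply: measurableT_comp => //; exact: measurable_tnth.
rewrite (_ : _ \o _ = (@tnth _ G)^~ j \o snd); last first.
  by apply/funext => -[p r] /=; rewrite tnth_rshift.
by apply: measurableT_comp => //; exact: measurable_tnth.
Qed.

End split.

(** Puts the scenarios outside a sub-tuple in a tuple, which is independent of
    the sub-tuple. *)
Lemma complement_indices k m (i : k.-tuple 'I_(k + m)) : uniq i ->
  exists j : m.-tuple 'I_(k + m), uniq (i ++ j) /\ forall l, l \in i ++ j.
Proof.
move=> ui; pose r := [seq l <- enum 'I_(k + m) | l \notin i].
have sr : size r == m.
  rewrite size_filter -(eqn_add2l k); apply/eqP.
  have := count_predC (mem i) (enum 'I_(k + m)).
  rewrite [RHS]size_enum_ord => E; rewrite -[RHS]E; congr (_ + _)%N.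
  rewrite -size_filter; apply/esym.
  rewrite -[RHS](size_tuple i); apply/perm_size/uniq_perm => //.
    by rewrite filter_uniq// enum_uniq.
  by move=> l; rewrite mem_filter mem_enum andbT.
exists (Tuple sr); split => /=.
  rewrite cat_uniq ui filter_uniq ?enum_uniq// andbT/=.
  by apply/hasPn => l; rewrite mem_filter => /andP[].
by move=> l; rewrite mem_cat mem_filter mem_enum andbT; exact: orbN.
Qed.

Lemma feasible_cat (s1 s2 : seq G) x :
  feasible ev (s1 ++ s2) x <-> feasible ev s1 x /\ feasible ev s2 x.
Proof.
split=> [f|[f1 f2] g]; last by rewrite mem_cat => /orP[/f1|/f2].
by split => g gs; apply: f; rewrite mem_cat gs ?orbT.
Qed.

Lemma solution_feasible s : feasible ev s (A s).
Proof. by have [[]] := A_sol s. Qed.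

Lemma increasing_uniq k N (i : k.-tuple 'I_N) : increasing_indices i -> uniq i.
Proof.
move=> si; rewrite -(map_inj_uniq val_inj).
exact: (sorted_uniq ltn_trans ltnn).
Qed.

Definition extension_set k (B : set R) : set (d.-tuple G * k.-tuple G) :=
  [set pr : d.-tuple G * k.-tuple G | B (V pr.1) /\ feasible ev pr.2 (A pr.1)].

(** As [ev] need not be jointly measurable, the set is expressed through the
    event that the first [d] scenarios already yield the solution of the whole
    sample. *)
Lemma measurable_extension_set k (B : set R) : measurable B ->
  measurable (@extension_set k B).
Proof.
move=> mB.
have [_ _ mE] := A_meas.
have := mE (d + k)%N (left_indices d k) (increasing_left_indices d k) => {}mE.
rewrite (_ : extension_set B = fst @^-1` [set p : d.-tuple G | B (V p)] `&`
   (fun pr : d.-tuple G * k.-tuple G => cat_tuple pr.1 pr.2) @^-1`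
     [set s : (d + k).-tuple G | A s = A (subtuple s (left_indices d k))]).
  apply: measurableI; rewrite -[X in measurable X]setTI.
    by apply: measurable_fst => //; exact: measurable_risk_set.
  exact: measurable_cat_tuple.
apply/seteqP; split => -[p r].
  move=> [BV fr]; split => //; rewrite /preimage/mkset subtuple_left.
  apply/solution_subset => [g gp|]; first by rewrite mem_cat gp.
  by rewrite feasible_cat; split => //; exact: solution_feasible.
move=> [BV]; rewrite /preimage/mkset.
rewrite subtuple_left => /solution_subset; rewrite feasible_cat => -[].
  by move=> g gp; rewrite mem_cat gp.
by move=> ? ?; split.
Qed.

(** Given a sub-sample, the remaining scenarios keep its solution exactly when
    each of them is satisfied there; they are independent of the sub-sample, so
    this has conditional probability [(1 - V) ^+ k]. *)
Lemma subtuple_solution_prob k (i : d.-tuple 'I_(d + k)) (B : set R) :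
  increasing_indices i -> measurable B ->
  power_prob P (d + k)
    ([set s : (d + k).-tuple G | B (V s)] `&`
       [set s : (d + k).-tuple G | A s = A (subtuple s i)]) =
  (\int[power_prob P d]_p (\1_B (V p) * (1 - V p) ^+ k)%:E)%E.
Proof.
move=> /increasing_uniq ui mB.
have [j [uij ij]] := complement_indices ui.
have mC := @measurable_extension_set k B mB.
pose xi (l : 'I_(d + k)) (s : (d + k).-tuple G) := tnth s l.
have -> : [set s : (d + k).-tuple G | B (V s)] `&`
       [set s : (d + k).-tuple G | A s = A (subtuple s i)] =
    (fun s => (subtuple s i, subtuple s j)) @^-1` (extension_set B).
  apply/seteqP; split => s.
    move=> [/= BV Asi]; rewrite /preimage/mkset/extension_set/= -Asi.
    split => // g gj.
    by apply: solution_feasible; exact: subtuple_sub gj.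
  move=> [/= BV fj]; suff As : A s = A (subtuple s i) by split => //=; rewrite As.
  apply/solution_subset; first exact: subtuple_sub.
  move=> g /tnthP[l ->]; have := ij l; rewrite mem_cat => /orP[li|lj].
    by apply: solution_feasible; exact: mem_subtuple.
  by apply: fj; exact: mem_subtuple.
rewrite (_ : (fun s => _) =
    (fun s => (map_tuple (xi^~ s) i, map_tuple (xi^~ s) j))); last first.
  by apply/funext => s; rewrite !subtupleE.
rewrite (iid_two_tuples (power_prob_iid P (d + k)) uij mC).
rewrite /product_measure1; apply: eq_integral => p _ /=.
rewrite indicE; case: (boolP (V p \in B)) => [|nVB].
  rewrite inE => VB; rewrite mul1r -feasible_prob; congr (power_prob P k _).
  apply/seteqP; split => r /=; rewrite /xsection/= /extension_set inE /=.
    by case.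
  by move=> ?; split.
rewrite mul0r (_ : xsection _ _ = set0) ?measure0//.
apply/seteqP; split => r //=; rewrite /xsection/= /extension_set inE /= => -[VB _].
by rewrite (mem_set VB) in nVB.
Qed.

Hypothesis A_complexity : fixed_complexity P A d.

Lemma measurable_subtuple_solution N (i : d.-tuple 'I_N) :
  increasing_indices i ->
  measurable [set s : N.-tuple G | A s = A (subtuple s i)].
Proof. by have [_ _ +] := A_meas; exact. Qed.

(** Almost surely exactly one increasing [i] yields the solution, and all of
    them do so with the same probability. *)
Lemma risk_prob k (B : set R) : measurable B ->
  power_prob P (d + k) [set s : (d + k).-tuple G | B (V s)] =
  ('C(d + k, d)%:R%:E *
   \int[power_prob P d]_p (\1_B (V p) * (1 - V p) ^+ k)%:E)%E.
Proof.
move=> mB; set D := [set s : (d + k).-tuple G | B (V s)].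
have mD : measurable D by exact: measurable_risk_set.
pose I := [seq i <- enum {: d.-tuple 'I_(d + k)} | increasing_indices i].
pose E (i : d.-tuple 'I_(d + k)) := if increasing_indices i
  then [set s : (d + k).-tuple G | A s = A (subtuple s i)] else set0.
have mE i : measurable (E i).
  rewrite /E; case: ifP => // si; exact: measurable_subtuple_solution.
transitivity (\int[power_prob P (d + k)]_s (\sum_(i <- I) (\1_(D `&` E i) s)%:E))%E.
  rewrite -[in LHS](setIT D) -integral_indic//.
  apply: ge0_ae_eq_integral => //.
  - exact/measurable_EFinP/measurable_indic.
  - apply: emeasurable_sum => i; apply/measurable_EFinP/measurable_indic.
    exact: measurableI.
  - by move=> s _; apply: sume_ge0 => i _; rewrite lee_fin.
  have := A_complexity (leq_addr k d).
  apply: filterS => s [i [[si Asi] ui]] _.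
  have iI : i \in I by rewrite mem_filter si mem_enum.
  rewrite (bigD1_seq i iI)/=; last by rewrite filter_uniq// enum_uniq.
  rewrite big1_seq => [|i' /andP[i'i]].
    have sE : s \in E i by rewrite /E si inE.
    by rewrite adde0 !indicE in_setI sE andbT.
  rewrite mem_filter => /andP[si' _]; congr EFin.
  rewrite indicE in_setI [s \in E i']memNset ?andbF// /E si' /= => Asi'.
  by move/eqP: i'i; apply; apply/esym/ui.
rewrite ge0_integral_sum//; last first.
  move=> i; apply/measurable_EFinP/measurable_indic.
  exact: measurableI.
rewrite (eq_big_seq (fun=> \int[power_prob P d]_p
    (\1_B (V p) * (1 - V p) ^+ k)%:E)%E) => [|i]; last first.
  rewrite mem_filter => /andP[si _].
  rewrite integral_indic//; last exact: measurableI.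
  by rewrite setIT /E si; exact: subtuple_solution_prob.
have <- : size I = 'C(d + k, d).
  rewrite -card_ltn_sorted_tuples cardE; apply/perm_size/uniq_perm.
  - by rewrite filter_uniq// enum_uniq.
  - exact: enum_uniq.
  - by move=> i; rewrite mem_filter !mem_enum andbT inE.
elim: (I) => [|i I' IH]; first by rewrite big_nil mul0e.
rewrite big_cons IH /= -addn1 natrD EFinD ge0_muleDl ?lee_fin// mul1e addeC.
by [].
Qed.

(** If the scenarios completing the sample to size [d.+1] were all satisfied at
    the current solution with positive probability, then removing either of two
    of them would give two distinct sub-tuples of size [d] with the same
    solution. Hence [(1 - V) ^+ k] vanishes almost surely. *)
Lemma small_sample_risk n : (n < d)%N ->
  power_prob P n [set s : n.-tuple G | V s != 1] = 0%E.
Proof.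
move=> nd; pose k := (d.+1 - n)%N.
have nk : (n + k)%N = d.+1 by rewrite /k subnKC// ltnW// ltnS ltnW.
have k0 : (0 < k)%N by lia.
have k1 : (1 < k)%N by lia.
have dnk : (d <= n + k)%N by rewrite nk.
have [Z [mZ Z0 subZ]] := A_complexity dnk.
pose drop (j : 'I_(n + k)) := [seq l <- enum 'I_(n + k) | l != j].
have size_drop j : size (drop j) == d.
  rewrite size_filter -(eqn_add2l 1).
  have := count_predC (pred1 j) (enum 'I_(n + k)).
  rewrite size_enum_ord count_uniq_mem ?enum_uniq// mem_enum inE => E.
  by rewrite -[(1 + d)%N]nk -[X in _ == X]E.
pose drop_tuple j := Tuple (size_drop j).
have mem_drop j l : (l \in drop_tuple j) = (l != j).
  by rewrite mem_filter mem_enum andbT.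
have incr_drop j : increasing_indices (drop_tuple j).
  rewrite /increasing_indices /= /drop -[sorted _ _]/(sorted ltn _) sorted_map.
  apply: sorted_filter => [l1 l2 l3|]; first exact: ltn_trans.
  by rewrite -sorted_map val_enum_ord iota_ltn_sorted.
pose j0 := rshift n (Ordinal k0); pose j1 := rshift n (Ordinal k1).
have j01 : drop_tuple j0 != drop_tuple j1.
  apply/negP => /eqP j01; have := mem_drop j1 j1.
  by rewrite -j01 mem_drop eqxx eq_rshift.
pose merge (pr : n.-tuple G * k.-tuple G) := cat_tuple pr.1 pr.2.
(* All the solutions involved coincide with [A p], as the scenarios in [r]
   are satisfied there. *)
have bad (p : n.-tuple G) (r : k.-tuple G) :
    feasible ev r (A p) -> Z (merge (p, r)).
  move=> fr; apply: subZ => /= -[i [_ ui]].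
  have same j : j \in right_indices n k ->
      A (merge (p, r)) = A (subtuple (merge (p, r)) (drop_tuple j)).
    move=> jr; apply: (solution_between (s1 := p)).
    - move=> g /tnthP[l ->]; rewrite -(tnth_lshift p r).
      apply: mem_subtuple; rewrite mem_drop.
      by move: jr => /mapP[l' _ ->]; rewrite eq_lrshift.
    - exact: subtuple_sub.
    - by rewrite feasible_cat; split => //; exact: solution_feasible.
  have mem_right l : rshift n l \in right_indices n k.
    by apply/mapP; exists l => //; rewrite mem_enum.
  move/eqP: j01; apply.
  rewrite -(ui (drop_tuple j0)); last by split; [exact: incr_drop|exact/same/mem_right].
  by apply: ui; split; [exact: incr_drop|exact/same/mem_right].
pose C := merge @^-1` Z.
have mC : measurable C.
  by rewrite -[X in measurable X]setTI; exact: measurable_cat_tuple.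
have : (power_prob P n \x power_prob P k)%E C = 0%E.
  rewrite -(iid_two_tuples (power_prob_iid P (n + k)) (uniq_left_right n k) mC).
  rewrite -[RHS]Z0; congr (power_prob P (n + k) _).
  apply/seteqP; split => s; rewrite /C /preimage /mkset /merge /=.
    by rewrite -!subtupleE cat_subtuple.
  by rewrite -!subtupleE cat_subtuple.
rewrite /product_measure1 => C0.
have mf := measurable_fun_xsection (power_prob P k) mC.
have [N [mN N0 subN]] : ae_eq (power_prob P n) setT
    (power_prob P k \o xsection C) (cst 0%E).
  apply/ae_eq_integral_abs => //; rewrite -[RHS]C0.
  by apply: eq_integral => p _; rewrite gee0_abs.
apply: (subset_measure0 _ mN _ N0).
  apply: (measurable_risk_set (B := [set x | x != 1])).
  rewrite (_ : mkset _ = ~` [set 1]); first exact: measurableC.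
  by apply/seteqP; split => x /= /eqP.
apply: subset_trans subN => p /= /eqP V1 /(_ I) /eqP.
rewrite -measure_le0 => C0'; apply: V1.
have : (((1 - V p) ^+ k)%:E <= 0)%E.
  apply: le_trans C0'; rewrite -feasible_prob; apply: le_measure.
  - by rewrite inE; exact: measurable_feasible.
  - by rewrite inE; exact: measurable_xsection.
  - by move=> r /= fr; rewrite /xsection /= inE; exact: bad.
rewrite lee_fin => V0; have : (1 - V p) ^+ k == 0.
  by rewrite eq_le V0 exprn_ge0// subr_ge0 risk_le1.
by rewrite expf_eq0 => /andP[_]; rewrite subr_eq0 => /eqP.
Qed.

End scenario_law.

(** * The moment problem on the unit interval *)

Section step_polynomials.
Context (R : realType).
Implicit Types (h q y b : R).

Lemma bernoulli_ge h n : 0 <= h -> 1 + n%:R * h <= (1 + h) ^+ n.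
Proof.
move=> h0; elim: n => [|n IH]; first by rewrite mul0r addr0.
rewrite exprS -natr1; apply: le_trans (ler_wpM2l _ IH); last by lra.
have : 0 <= n%:R :> R by []. nra.
Qed.

Lemma bernoulli_le y n : 0 <= y <= 1 -> 1 - n%:R * y <= (1 - y) ^+ n.
Proof.
move=> y01; elim: n => [|n IH]; first by rewrite mul0r subr0.
rewrite exprS -natr1; apply: le_trans (ler_wpM2l _ IH); last by lra.
have : 0 <= n%:R :> R by []. nra.
Qed.

(** Bernoulli for [1 + y], and [(1 - y) * (1 + y) <= 1]. *)
Lemma onem_expr_le y n : 0 <= y <= 1 -> (1 - y) ^+ n * (1 + n%:R * y) <= 1.
Proof.
move=> y01; apply: (@le_trans _ _ ((1 - y) ^+ n * (1 + y) ^+ n)).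
  by rewrite ler_wpM2l ?exprn_ge0 ?bernoulli_ge//; lra.
by rewrite -exprMn exprn_ile1//; nra.
Qed.

Lemma cvg_natmul_expr q : 0 <= q < 1 -> n%:R * q ^+ n @[n --> \oo] --> (0 : R).
Proof.
move=> /andP[q0 q1]; pose r := (1 + q) / 2.
have r01 : 0 < r < 1 by rewrite /r; lra.
have h0 : 0 < r - q by rewrite /r; lra.
have binom_ge n : q ^+ n + n%:R * (r - q) * q ^+ n <= r ^+ n.
  elim: n => [|n IH]; first by rewrite !mul0r addr0.
  rewrite !exprS -natr1; apply: le_trans (ler_wpM2l _ IH); last by lra.
  have qn : 0 <= q ^+ n by exact: exprn_ge0.
  have nn : 0 <= n%:R :> R by [].
  have -> : r = q + (r - q) by ring.
  set h := r - q in h0 *; rewrite (_ : q + h - q = h); last by ring.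
  have h1 : 0 <= h * (1 - q) by apply: mulr_ge0; lra.
  have h2 : 0 <= n%:R * h * h by apply: mulr_ge0; [apply: mulr_ge0; lra|lra].
  by have := mulr_ge0 h1 qn; have := mulr_ge0 h2 qn; lra.
apply: (@squeeze_cvgr _ _ _ _ (cst 0) ((r - q)^-1 *: GRing.exp r)).
- apply: nearW => n; rewrite mulr_ge0 ?exprn_ge0//=.
  rewrite -[leRHS]/((r - q)^-1 * r ^+ n) ler_pdivlMl//.
  apply: le_trans (binom_ge n).
  by rewrite mulrA [_ * n%:R]mulrC lerDr exprn_ge0.
- exact: cvg_cst.
- rewrite -(scaler0 _ (r - q)^-1); apply: cvgZl_tmp; apply: cvg_expr.
  by rewrite ger0_norm; lra.
Qed.

Definition step_exponent b n : nat := (Num.truncn (n%:R / b ^+ n)).+1.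

(** The polynomials of the elementary proof of the Stone-Weierstrass theorem:
    on the unit interval they approach the indicator of [y < b]. *)
Definition step_poly b n : {poly R} := (1 - 'X^n) ^+ step_exponent b n.

Lemma step_polyE b n y : (step_poly b n).[y] = (1 - y ^+ n) ^+ step_exponent b n.
Proof. by rewrite /step_poly horner_exp !hornerE. Qed.

Lemma step_poly_itv b n y : 0 <= y <= 1 -> 0 <= (step_poly b n).[y] <= 1.
Proof.
move=> /andP[y0 y1]; rewrite step_polyE.
have y1n : y ^+ n <= 1 by exact: exprn_ile1.
have y0n : 0 <= y ^+ n by exact: exprn_ge0.
by rewrite exprn_ge0 ?exprn_ile1//; lra.
Qed.

(** The exponent grows like [n / b ^+ n], so that [step_exponent b n * y ^+ n]
    tends to zero for [y < b] and to infinity from [y = b] on. *)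
Lemma cvg_step_poly b y : 0 < b <= 1 -> 0 <= y <= 1 ->
  (step_poly b n).[y] @[n --> \oo] --> ((y < b)%R%:R : R).
Proof.
move=> /andP[b0 b1] /andP[y0 y1].
have bn n : 0 < b ^+ n by exact: exprn_gt0.
have yn n : 0 <= y ^+ n <= 1 by rewrite exprn_ge0// exprn_ile1.
have mle n : (step_exponent b n)%:R <= n%:R / b ^+ n + 1.
  by rewrite -natr1 lerD2r truncn_le divr_ge0// ltW.
have mge n : n%:R / b ^+ n <= (step_exponent b n)%:R.
  by rewrite ltW// truncnS_gt.
have pitv n : 0 <= (step_poly b n).[y] <= 1 by apply: step_poly_itv; rewrite y0.
case: ltP => yb.
  have q01 : 0 <= y / b < 1 by rewrite divr_ge0 ?(ltW b0)//= ltr_pdivrMr// mul1r.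
  apply: (@squeeze_cvgr _ _ _ _
    (fun n => 1 - (n%:R * (y / b) ^+ n + y ^+ n)) (cst 1)).
  - apply: nearW => n; have /andP[_ ->] := pitv n.
    rewrite andbT step_polyE; apply: le_trans (bernoulli_le _ (yn n)).
    rewrite lerD2l lerN2; apply: le_trans (ler_wpM2r _ (mle n)) _.
      by have /andP[] := yn n.
    by rewrite mulrDl mul1r lerD2r expr_div_n mulrAC mulrA.
  - rewrite -[X in _ --> X]subr0 -[X in _ - X]addr0.
    apply: cvgB; first exact: cvg_cst.
    apply: cvgD; first exact: cvg_natmul_expr.
    by apply: cvg_expr; rewrite ger0_norm//; lra.
  - exact: cvg_cst.
apply: (@squeeze_cvgr _ _ _ _ (cst 0) (@harmonic R)).
- apply: nearW => n; have /andP[-> _]/= := pitv n.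
  rewrite step_polyE /harmonic -[_^-1]mul1r ler_pdivlMr//.
  apply: le_trans (onem_expr_le (step_exponent b n) (yn n)).
  rewrite ler_wpM2l//; first by apply: exprn_ge0; have := yn n; lra.
  rewrite -natr1 addrC lerD2l; apply: le_trans (ler_wpM2r _ (mge n)).
    rewrite mulrAC -mulrA -expr_div_n ler_peMr//.
    by apply: exprn_ege1; rewrite ler_pdivlMr// mul1r.
  by have /andP[] := yn n.
- exact: cvg_cst.
- exact: cvg_harmonic.
Qed.

End step_polynomials.

Section moments.
Context (R : realType).

Lemma bounded01_integrable (mu : probability (measurableTypeR R) R) (f : R -> R) :
  measurable_fun setT f -> (forall x, x \in `[0, 1] -> 0 <= f x <= 1) ->
  mu.-integrable `[0, 1] (EFin \o f).
Proof.
move=> mf f01; apply: measurable_bounded_integrable => //.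
- by rewrite (le_lt_trans (probability_le1 _ _))// ltry.
- exact: measurable_funTS.
- exists 1; split => // M M1 x /= x01; have /andP[f0 f1] := f01 x x01.
  by rewrite ger0_norm// (le_trans f1)// ltW.
Qed.

(** Indicators of half-lines are bounded pointwise limits of polynomials on the
    unit interval, by [cvg_step_poly], and the half-lines generate the Borel
    sets. *)
Lemma moments_determine (mu nu : probability (measurableTypeR R) R) :
  mu `[0, 1]%classic = 1%E -> nu `[0, 1]%classic = 1%E ->
  (forall k, \int[mu]_(x in `[0%R, 1%R]) ((1 - x) ^+ k)%:E =
             \int[nu]_(x in `[0%R, 1%R]) ((1 - x) ^+ k)%:E)%E ->
  forall B, measurable B -> mu B = nu B.
Proof.
move=> mu1 nu1 moments.
have mpow k : measurable_fun [set: R] (fun x : R => (1 - x) ^+ k).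
  by apply: measurable_funX; exact: measurable_funB.
have ipow (m : probability (measurableTypeR R) R) k :
    m.-integrable `[0, 1] (EFin \o (fun x : R => (1 - x) ^+ k)).
  apply: bounded01_integrable => // x; rewrite in_itv/= => x01.
  by rewrite exprn_ge0 ?exprn_ile1//; lra.
have polys (m : probability (measurableTypeR R) R) (p : {poly R}) :
    (\int[m]_(x in `[0%R, 1%R]) (p.[1 - x])%:E =
    \sum_(i < size p) (p`_i)%:E * \int[m]_(x in `[0%R, 1%R]) ((1 - x) ^+ i)%:E)%E.
  under eq_integral do rewrite horner_coef -sumEFin.
  rewrite (@integral_sum _ _ _ m)//.
    apply: eq_bigr => i _; rewrite -integralZl//; exact: ipow.
  move=> i; rewrite (_ : (fun x => _) =
      (fun x => (p`_i)%:E * (EFin \o (fun x : R => (1 - x) ^+ i)%R) x)%E).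
    by apply: integrableZl => //; exact: ipow.
  by apply/funext => x; rewrite -EFinM.
have mstep (p : {poly R}) : measurable_fun [set: R] (fun x => p.[1 - x]).
  apply: (@measurableT_comp _ _ _ _ _ _ (horner p)).
    apply: continuous_measurable_fun; exact: continuous_horner.
  exact: measurable_funB.
have in01 (m : probability (measurableTypeR R) R) B : m `[0, 1]%classic = 1%E ->
    measurable B -> m B = m (B `&` `[0, 1]%classic).
  move=> m1 mB.
  transitivity (m (B `\` `[0%R, 1%R]%classic) + m (B `&` `[0%R, 1%R]%classic))%E.
    exact: measureDI.
  rewrite [X in (X + _)%E](_ : _ = 0%E) ?add0e//.
  apply: (@subset_measure0 _ _ _ m _ (~` `[0, 1]%classic)) => //.
  - exact: measurableD.
  - exact: measurableC.
  - transitivity (1 - m `[0%R, 1%R]%classic)%E; first exact: probability_setC.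
    by rewrite m1 subee.
have halfline a : mu `]a, +oo[%classic = nu `]a, +oo[%classic.
  rewrite (in01 mu)// (in01 nu)//.
  have [a0|a0] := ltP a 0.
    rewrite (_ : _ `&` _ = `[0, 1]%classic) ?mu1 ?nu1//.
    apply/seteqP; split => x /=; rewrite !in_itv/= ?andbT; first by case.
    by move=> x01; split => //; lra.
  have [a1|a1] := leP 1 a.
    rewrite (_ : _ `&` _ = set0) ?measure0//.
    by apply/seteqP; split => x //=; rewrite !in_itv/= => -[]; lra.
  have b01 : 0 < 1 - a <= 1 by lra.
  have lim (m : probability (measurableTypeR R) R) :
      (\int[m]_(x in `[0%R, 1%R]) ((step_poly (1 - a) n).[1 - x])%:E)%E
        @[n --> \oo] --> m (`]a, +oo[ `&` `[0, 1])%classic.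
    rewrite -integral_indic//.
    apply: (@dominated_cvg _ _ _ m _ _ _ _ (cst 1%E)) => //.
    - by move=> n; apply/measurable_EFinP; apply: measurable_funTS; exact: mstep.
    - move=> x; rewrite /= in_itv/= => x01; apply: cvg_EFin; first exact: nearW.
      rewrite indicE (_ : (x \in _) = (1 - x < 1 - a)).
        by apply: cvg_step_poly => //; lra.
      by rewrite mem_setE in_itv/= andbT; lra.
    - have := @bounded01_integrable m (cst 1); apply => // x _.
      by rewrite ler01 lexx.
    - move=> n x /=; rewrite in_itv/= => x01.
      have /andP[p0 p1] : 0 <= (step_poly (1 - a) n).[1 - x] <= 1.
        by apply: step_poly_itv; lra.
      by rewrite lee_fin ger0_norm.
  have E : (fun n => \int[mu]_(x in `[0%R, 1%R]) ((step_poly (1 - a) n).[1 - x])%:E)%E =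
     (fun n => \int[nu]_(x in `[0%R, 1%R]) ((step_poly (1 - a) n).[1 - x])%:E)%E.
    apply/funext => n; rewrite !polys; apply: eq_bigr => i _.
    by rewrite moments.
  by apply: (cvg_unique _ (lim mu)) => //; rewrite E; exact: lim.
apply: (@measure_unique _ R (measurableTypeR R) (@RGenOInfty.G R) (fun n => `](- n%:R), +oo[%classic) _ _ _ _ mu nu).
- exact: RGenOInfty.measurableE.
- move=> _ _ [a ->] [b ->]; exists (Num.max a b).
  by apply/seteqP; split => x /=; rewrite !in_itv/= !andbT gt_max => /andP.
- by move=> n; exists (- n%:R).
- apply/seteqP; split => // x _; exists (Num.truncn `|x|).+1 => //=.
  rewrite in_itv/= andbT ltrNl; apply: le_lt_trans (truncnS_gt `|x|).
  by rewrite -normrN ler_norm.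
- by move=> _ [a ->]; exact: halfline.
- by move=> n; rewrite (le_lt_trans (probability_le1 _ _)) ?ltry.
Qed.

End moments.

(** * The Beta law of the risk *)

Section beta_law.
Context (R : realType).
Local Notation mu := (@lebesgue_measure R).

Lemma beta_fun_binomial d k : (0 < d)%N ->
  'C(d + k, d)%:R / beta_fun d 1 = (beta_fun d k.+1)^-1 :> R.
Proof.
case: d => // d _; rewrite !beta_funE /= addn1 /= fact0 mulr1 addSn addnS /=.
have := bin_fact (leq_addr k d.+1); rewrite addKn addSn.
move=> /(congr1 (GRing.natmul (1 : R))); rewrite !natrM => <-.
have d0 : d`!%:R != 0 :> R by rewrite pnatr_eq0 -lt0n fact_gt0.
have k0 : k`!%:R != 0 :> R by rewrite pnatr_eq0 -lt0n fact_gt0.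
have C0 : 'C((d + k).+1, d.+1)%:R != 0 :> R.
  by rewrite pnatr_eq0 -lt0n bin_gt0 ltnS leq_addr.
by field; rewrite d0 k0 C0 nat1r pnatr_eq0.
Qed.

(** Multiplying a Beta density by [(1 - x) ^+ k] gives a Beta density up to the
    normalization; this is the same tilt as in [risk_prob]. *)
Lemma beta_prob_tilt d k (B : set R) : (0 < d)%N -> measurable B ->
  ('C(d + k, d)%:R%:E *
   \int[beta_prob d 1]_(x in `[0%R, 1%R]) (\1_B x * (1 - x) ^+ k)%:E =
   beta_prob d k.+1 B)%E.
Proof.
move=> d0 mB.
have mf : measurable_fun [set: R] (fun x : R => \1_B x * (1 - x) ^+ k).
  apply: measurable_funM; first exact: measurable_indic.
  by apply: measurable_funX; exact: measurable_funB.
have f01 (x : R) : x \in `[0, 1] -> 0 <= \1_B x * (1 - x) ^+ k <= 1.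
  rewrite in_itv/= indicE => x01.
  by case: (x \in B); rewrite ?mul1r ?mul0r ?lexx ?ler01// exprn_ge0 ?exprn_ile1//; lra.
rewrite integral_beta_prob//; last 2 first.
- by apply/measurable_EFinP; apply: measurable_funTS.
- have /integrableP[_] := bounded01_integrable (beta_prob d 1) mf f01.
  exact.
rewrite -integral_beta_pdf// -ge0_integralZl//; last 2 first.
- apply: emeasurable_funM; apply/measurable_EFinP; apply: measurable_funTS => //.
  exact: measurable_beta_pdf.
- move=> x x01; rewrite -EFinM lee_fin mulr_ge0 ?beta_pdf_ge0//.
  by have /andP[] := f01 x x01.
rewrite integral_mkcond [RHS]integral_mkcond; apply: eq_integral => x _.
rewrite !patchE indicE mem_setE /beta_pdf !patchE !mem_setE.
case: (x \in `[0, 1]); last by case: ifP => // _; rewrite mul0r.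
case: (x \in B); last by rewrite !mul0r mul0e mule0.
rewrite -!EFinM /XMonemX/= expr0 mulr1 mul1r; congr EFin.
rewrite -(beta_fun_binomial k d0). by rewrite /unstable.onem; ring.
Qed.

Lemma beta_moment d k : (0 < d)%N ->
  (\int[beta_prob d 1]_(x in `[0%R, 1%R]) ((1 - x) ^+ k)%:E =
   ('C(d + k, d)%:R^-1 : R)%:E)%E.
Proof.
move=> d0; have := beta_prob_tilt k d0 (@measurableT _ R).
rewrite probability_setT; under eq_integral do rewrite indicT mul1r.
have C0 : 'C(d + k, d)%:R != 0 :> R.
  by rewrite pnatr_eq0 -lt0n bin_gt0 leq_addr.
set I := (\int[_]_(x in _) _)%E => CI.
have -> : I = (('C(d + k, d)%:R^-1)%:E * ('C(d + k, d)%:R%:E * I))%E.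
  by rewrite muleA -EFinM mulVf// mul1e.
by rewrite CI mule1.
Qed.

End beta_law.

Section risk_law.
Context (R : realType) (X : Type) (J : X -> R).
Context (dG : measure_display) (G : measurableType dG) (ev : G -> X -> R).
Context (P : probability G R) (A : seq G -> X).
Hypothesis A_sol : forall s : seq G, unique (scenario_solution J ev s) (A s).
Context (d : nat) (d_gt0 : (0 < d)%N).
Hypothesis A_meas : scenario_measurable ev P A d.
Hypothesis A_complexity : fixed_complexity P A d.

Local Notation V s := (risk ev P (A s)).

Let risk_mfun_subproof n :
  @isMeasurableFun _ _ (n.-tuple G) (measurableTypeR R) (fun s : n.-tuple G => V s).
Proof. by split; have := measurable_risk A_meas (N := n); exact. Qed.

Let risk_mfun n : {mfun n.-tuple G >-> measurableTypeR R} :=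
  HB.pack (fun s : n.-tuple G => V s) (risk_mfun_subproof n).

Let law := distribution (power_prob P d) (risk_mfun d).

Let integral_law (f : R -> \bar R) : measurable_fun [set: R] f ->
  (forall x, x \in `[0%R, 1%R] -> 0 <= f x)%E ->
  (\int[law]_(x in `[0%R, 1%R]) f x = \int[power_prob P d]_s f (V s))%E.
Proof.
move=> mf f0.
rewrite /law /distribution ge0_integral_pushforward//; last first.
- by move=> x; rewrite inE => /f0.
- exact: measurable_funTS.
congr (integral _ _ _); apply/seteqP; split => // s _ /=.
by rewrite in_itv/= risk_ge0 (risk_le1 A_meas).
Qed.

(** The total mass of the law of a larger sample in [risk_prob] is one, which
    gives every moment of [1 - V] for the base sample. *)
Let base_law (B : set R) : measurable B -> law B = beta_prob d 1 B.
Proof.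
move=> mB; apply: moments_determine => //.
- rewrite /law /distribution /pushforward -[RHS](@probability_setT _ _ _ (power_prob P d)).
  congr (power_prob P d _); apply/seteqP; split => // s _ /=.
  by rewrite in_itv/= risk_ge0 (risk_le1 A_meas).
- exact: beta_prob01.
move=> k; rewrite beta_moment// integral_law; last 2 first.
- apply/measurable_EFinP; apply: measurable_funX; exact: measurable_funB.
- by move=> x; rewrite in_itv/= lee_fin => x01; rewrite exprn_ge0//; lra.
have := risk_prob A_sol A_meas A_complexity k (@measurableT _ R).
rewrite [X in power_prob _ _ X](_ : _ = setT)// probability_setT.
under eq_integral do rewrite indicT mul1r.
have C0 : 'C(d + k, d)%:R != 0 :> R.
  by rewrite pnatr_eq0 -lt0n bin_gt0 leq_addr.
set I := (\int[_]_s _)%E => CI.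
have -> : I = (('C(d + k, d)%:R^-1)%:E * ('C(d + k, d)%:R%:E * I))%E.
  by rewrite muleA -EFinM mulVf// mul1e.
by rewrite -CI mule1.
Qed.

(** Samples of size [d + k] see their law tilted from the base law as Beta laws
    are, and the base law is a Beta law. *)
Lemma risk_beta_law k (B : set R) : measurable B ->
  power_prob P (d + k) [set s | B (V s)] = beta_prob d k.+1 B.
Proof.
move=> mB; rewrite (risk_prob A_sol A_meas A_complexity)// -beta_prob_tilt//.
congr (_ * _)%E.
rewrite -(integral_law (f := fun x => (\1_B x * (1 - x) ^+ k)%:E)).
- by apply: eq_measure_integral => C mC _; exact: base_law.
- apply/measurable_EFinP; apply: measurable_funM; first exact: measurable_indic.
  by apply: measurable_funX; exact: measurable_funB.
- by move=> x; rewrite in_itv/= lee_fin => x01; rewrite mulr_ge0 ?exprn_ge0//; lra.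
Qed.

End risk_law.

(** * Beta kernels and the parametric family *)

Section beta_kernel.
Context (R : realType).
Local Notation mu := (@lebesgue_measure R).
Implicit Types (t v e theta : R) (N : nat).

(** Monotone convergence from compact intervals away from zero, on which the
    fundamental theorem of calculus applies. *)
Lemma powR_integrable t : 0 < t ->
  mu.-integrable `]0, 1[ (EFin \o (fun v => v `^ (t - 1))).
Proof.
move=> t0.
have mf (D : set R) : measurable_fun D (fun v : R => v `^ (t - 1)).
  by apply: measurable_funTS; exact: measurable_powR.
have mEf (D : set R) : measurable_fun D (fun v : R => (v `^ (t - 1))%:E).
  by apply/measurable_EFinP; exact: mf.
apply/integrableP; split; first exact: mEf.
under eq_integral do rewrite /= ger0_norm ?powR_ge0//.
pose F n : set (measurableTypeR R) := `[n.+2%:R^-1, 1 : R]%classic.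
have Fub : (\int[mu]_(v in `]0%R, 1%R[) (v `^ (t - 1))%:E <=
    \int[mu]_(v in \bigcup_n F n) (v `^ (t - 1))%:E)%E.
  apply: ge0_subset_integral => //.
  - by apply: bigcup_measurable => n _; exact: measurable_itv.
  - exact: mEf.
  - by move=> v _; rewrite lee_fin powR_ge0.
  move=> v /=; rewrite in_itv/= => /andP[v0 v1].
  exists (Num.truncn v^-1) => //=.
  rewrite /F /= in_itv/= (ltW v1) andbT invf_ple ?posrE//.
  by apply/ltW; apply: (lt_trans (truncnS_gt _)); rewrite ltr_nat.
apply: le_lt_trans Fub _; apply: (@le_lt_trans _ _ (t^-1)%:E); last exact: ltry.
have cvF := @ge0_nondecreasing_set_cvg_integral _ (measurableTypeR R) R F
  (fun v => (v `^ (t - 1))%:E) mu.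
rewrite -(cvg_lim _ (cvF _ _ _ _))//; last 4 first.
- apply/nondecreasing_seqP => n; apply/subsetPset => v; rewrite /F /= !in_itv/=.
  move=> /andP[nv ->]; rewrite andbT; apply: le_trans nv.
  by rewrite lef_pV2 ?posrE// ler_nat.
- by move=> n; exact: measurable_itv.
- by move=> n; exact: mEf.
- by move=> n v _; rewrite lee_fin powR_ge0.
apply: lime_le.
  apply: ereal_nondecreasing_is_cvgn.
  apply: ge0_nondecreasing_set_nondecreasing_integral.
  - apply/nondecreasing_seqP => n; apply/subsetPset => v; rewrite /F /= !in_itv/=.
    move=> /andP[nv ->]; rewrite andbT; apply: le_trans nv.
    by rewrite lef_pV2 ?posrE// ler_nat.
  - by move=> n; exact: measurable_itv.
  - by move=> n; exact: mEf.
  - by move=> n v _; rewrite lee_fin powR_ge0.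
apply: nearW => n.
have n0 : 0 < n.+2%:R^-1 :> R by rewrite invr_gt0.
have n1 : n.+2%:R^-1 < 1 :> R by rewrite invf_lt1// ltr1n.
have contp s x : 0 < x -> {for x, continuous (fun v : R => v `^ s)}.
  move=> x0; apply: differentiable_continuous; apply/derivable1_diffP.
  by apply: derivable_powR; rewrite in_itv/= x0.
rewrite (@continuous_FTC2 _ _ (fun v => t^-1 * v `^ t)) //.
- rewrite -EFinB lee_fin powR1 mulr1 lerBlDr lerDl.
  by rewrite mulr_ge0 ?powR_ge0// invr_ge0 ltW.
- apply: continuous_in_subspaceT => x; rewrite inE/= in_itv/= => /andP[nx _].
  by apply: contp; exact: lt_le_trans nx.
- split.
  + move=> x; rewrite in_itv/= => /andP[nx _]; apply: derivableM => //.
    by apply: derivable_powR; rewrite in_itv/= andbT (lt_trans n0).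
  + apply: cvg_at_right_filter; apply: cvgM; first exact: cvg_cst.
    exact: contp.
  + apply: cvg_at_left_filter; apply: cvgM; first exact: cvg_cst.
    by apply: contp.
- move=> x; rewrite in_itv/= => /andP[nx _].
  have x0 : 0 < x by exact: lt_trans nx.
  rewrite derive1E deriveZ//=; last by apply: derivable_powR; rewrite in_itv/= x0.
  rewrite -derive1E powR_derive1 ?in_itv/= ?x0//.
  by rewrite /GRing.scale/= mulrA mulVf ?mul1r// gt_eqF.
Qed.

Lemma Rintegral_gt0_off1 (D : set (measurableTypeR R)) (f : R -> R) (v0 : R) :
  measurable D -> mu D != 0%E -> (forall v, D v -> 0 <= f v) ->
  (forall v, D v -> v <> v0 -> 0 < f v) -> mu.-integrable D (EFin \o f) ->
  0 < \int[mu]_(v in D) f v.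
Proof.
move=> mD D0 f0 fp fi; rewrite lt_neqAle Rintegral_ge0 ?andbT//.
apply/eqP => I0; move/eqP: D0; apply.
have : (\int[mu]_(v in D) `|(f v)%:E| = 0)%E.
  transitivity (\int[mu]_(v in D) (EFin \o f) v)%E.
    by apply: eq_integral => v /set_mem Dv; rewrite gee0_abs// lee_fin f0.
  by rewrite -[LHS]fineK ?integrable_fin_num// -[X in X%:E]I0.
have mf : measurable_fun D (EFin \o f) by have /integrableP[] := fi.
move=> /(ae_eq_integral_abs _ mD mf)[N [mN N0 subN]].
apply: (@subset_measure0 _ _ _ mu D (N `|` [set v0])) => //.
- by apply: measurableU => //; exact: measurable_set1.
- move=> v Dv; have [->|vv0] := pselect (v = v0); first by right.
  left; apply: subN => /= /(_ Dv)[fv].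
  by have := fp v Dv vv0; rewrite fv ltxx.
- by rewrite -N0; apply: measureU0 => //; exact: lebesgue_measure_set1.
Qed.

Lemma Rintegral_gt0 (D : set (measurableTypeR R)) (f : R -> R) :
  measurable D -> mu D != 0%E ->
  (forall v, D v -> 0 < f v) -> mu.-integrable D (EFin \o f) ->
  0 < \int[mu]_(v in D) f v.
Proof.
move=> mD D0 f0; apply: (Rintegral_gt0_off1 (v0 := 0)) => // v Dv.
  by apply: ltW; exact: f0.
by move=> _; exact: f0.
Qed.

Definition kern t v N : R := v `^ (t - 1) * (1 - v) `^ (N%:R - t).

(** The incomplete Beta function. On the open interval the values of the power
    function at zero do not matter. *)
Definition inc e t N : R := \int[mu]_(v in `]0, e[) kern t v N.

Lemma kern_expR t v N : 0 < v < 1 ->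
  kern t v N = expR ((t - 1) * ln v + (N%:R - t) * ln (1 - v)).
Proof.
move=> /andP[v0 v1]; rewrite expRD /kern /powR gt_eqF//.
by rewrite subr_eq0 gt_eqF.
Qed.

Lemma kern_gt0 t v N : 0 < v < 1 -> 0 < kern t v N.
Proof. by move=> v01; rewrite kern_expR// expR_gt0. Qed.

Lemma kern_ge0 t v N : 0 <= kern t v N.
Proof. by rewrite mulr_ge0// powR_ge0. Qed.

Lemma kernS t v N : 0 < v < 1 -> kern t v N.+1 = (1 - v) * kern t v N.
Proof.
move=> v01; rewrite !kern_expR// -[in RHS](@lnK _ (1 - v)) ?posrE; last by lra.
by rewrite -expRD expRK; congr expR; rewrite -natr1; ring.
Qed.

Lemma measurable_kern t N (D : set (measurableTypeR R)) :
  measurable_fun D (fun v => kern t v N).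
Proof.
apply: measurable_funTS; apply: measurable_funM; first exact: measurable_powR.
apply: (@measurableT_comp _ _ _ _ _ _ (fun x : R => x `^ (N%:R - t))).
  exact: measurable_powR.
exact: measurable_funB.
Qed.

(** An integrable bound common to all the parameters in an interval, for
    dominated convergence. *)
Lemma kern_le a t v N : 0 < v < 1 -> a <= t -> t <= N%:R ->
  kern t v N <= v `^ (a - 1).
Proof.
move=> v01 at_ tN; rewrite -[leRHS]mulr1 ler_pM ?powR_ge0//.
  by apply: ger_powR; [lra|rewrite lerD2r].
rewrite -[leRHS](powRr0 (1 - v)); apply: ger_powR; lra.
Qed.

Lemma kern_integrable t N (D : set (measurableTypeR R)) : 0 < t <= N%:R ->
  measurable D -> D `<=` `]0, 1[%classic -> mu.-integrable D (EFin \o kern t ^~ N).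
Proof.
move=> /andP[t0 tN] mD D01.
apply: (@integrableS _ _ _ mu `]0, 1[%classic D) => //.
have mk := @measurable_kern t N `]0, 1[%classic.
apply: le_integrable (powR_integrable t0) => //; first exact/measurable_EFinP.
move=> v; rewrite /= in_itv/= => v01; rewrite lee_fin !ger0_norm ?powR_ge0 ?kern_ge0//.
exact: kern_le.
Qed.

Lemma subitv01 e : e <= 1 -> `]0, e[%classic `<=` (`]0, 1[%classic : set R).
Proof. by move=> e1 v /=; rewrite !in_itv/=; lra. Qed.

Lemma inc_gt0 e t N : 0 < e <= 1 -> 0 < t <= N%:R -> 0 < inc e t N.
Proof.
move=> /andP[e0 e1] tN; apply: Rintegral_gt0 => //.
- by rewrite lebesgue_measure_itv/= lte_fin e0 gt_eqF// oppr0 adde0 lte_fin.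
- by move=> v; rewrite /= in_itv/= => v0e; apply: kern_gt0; lra.
- by apply: kern_integrable => //; exact: subitv01.
Qed.

Lemma Beta_inc t N : Beta t (N%:R - t + 1) = inc 1 t N.
Proof.
rewrite /Beta addrK /inc /Rintegral; congr fine.
rewrite integral_itv_bndoo//.
apply/measurable_EFinP; exact: (@measurable_kern t N).
Qed.

Section natural_parameter.
Variables (d N : nat).
Hypotheses (d_gt0 : (0 < d)%N) (dN : (d <= N)%N).

Lemma kern_XMonemX v : 0 < v < 1 -> kern d%:R v N = XMonemX d.-1 (N - d) v.
Proof.
move=> v01; rewrite /kern /XMonemX -natrB// powR_mulrn; last by lra.
by rewrite -[d in d%:R]prednK// -natr1 addrK powR_mulrn//; lra.
Qed.

Lemma inc_beta_fun : inc 1 d%:R N = beta_fun d (N - d).+1.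
Proof.
rewrite /inc /beta_fun -Rintegral_mkcond /Rintegral; congr fine.
rewrite [RHS]integral_itv_bndoo; last first.
  apply/measurable_EFinP; exact: measurable_XMonemX.
by apply: eq_integral => v; rewrite inE/= in_itv/= => v01; rewrite kern_XMonemX.
Qed.

End natural_parameter.

Definition capped theta N : R := Num.min theta N%:R.

Lemma capped_itv theta N : 0 < theta -> (0 < N)%N -> 0 < capped theta N <= N%:R.
Proof. by move=> t0 N0; rewrite lt_min t0 ltr0n N0 ge_min lexx orbT. Qed.

(** The case distinction in the density is a truncation of the parameter at
    [N]: the two formulas agree at [theta = N]. *)
Lemma dens_capped theta v N : 0 < v < 1 -> (0 < N)%N ->
  dens theta v N = kern (capped theta N) v N / inc 1 (capped theta N) N.
Proof.
move=> v01 N0; rewrite /dens gt_eqF/=; last by lra.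
rewrite gtn_eqF// /capped; case: ltP => tN; first by rewrite Beta_inc.
rewrite kern_XMonemX// inc_beta_fun// subnn beta_funE/= eqn0Ngt N0/=.
rewrite fact0 mulr1 addn1/= /XMonemX expr0 mulr1 invf_div mulrC; congr (_ * _).
by rewrite -[in N`!](prednK N0) factS prednK// natrM mulfK// pnatr_eq0 -lt0n fact_gt0.
Qed.

End beta_kernel.

(** * Log-concavity in the parameter *)

Section beta_density.
Context (R : realType).
Local Notation mu := (@lebesgue_measure R).
Implicit Types (a b c t v e theta : R) (N : nat).

Lemma expR_convex c a b : 0 <= c <= 1 ->
  expR (c * a + (1 - c) * b) <= c * expR a + (1 - c) * expR b.
Proof.
move=> /andP[c0 c1]; set z := c * a + (1 - c) * b.
have tangent u : expR z * (1 + (u - z)) <= expR u.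
  have -> : expR u = expR z * expR (u - z) by rewrite -expRD addrC subrK.
  by rewrite ler_wpM2l ?expR_ge0// expR_ge1Dx.
have ca := ler_wpM2l c0 (tangent a).
have c1' : 0 <= 1 - c by rewrite subr_ge0.
have cb := ler_wpM2l c1' (tangent b).
apply: le_trans (lerD ca cb); rewrite le_eqVlt; apply/orP; left; apply/eqP.
by rewrite /z; ring.
Qed.

Lemma inc_kern_integrable e t N : e <= 1 -> 0 < t <= N%:R ->
  mu.-integrable `]0, e[ (EFin \o kern t ^~ N).
Proof. by move=> e1 tN; apply: kern_integrable => //; exact: subitv01. Qed.

Lemma convex_itv c a b (M : R) : 0 <= c <= 1 -> 0 < a <= M -> 0 < b <= M ->
  0 < c * a + (1 - c) * b <= M.
Proof.
move=> /andP[c0 c1] /andP[a0 aM] /andP[b0 bM].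
have c1' : 0 <= 1 - c by rewrite subr_ge0.
apply/andP; split; last first.
  by have := ler_wpM2l c0 aM; have := ler_wpM2l c1' bM; lra.
have [->|cn0] := eqVneq c 0; first by lra.
have cp : 0 < c by rewrite lt0r cn0.
by have := mulr_gt0 cp a0; have := mulr_ge0 c1' (ltW b0); lra.
Qed.

Lemma kern_div t v N (I : R) : 0 < v < 1 -> 0 < I ->
  kern t v N / I = expR ((t - 1) * ln v + (N%:R - t) * ln (1 - v) - ln I).
Proof. by move=> v01 I0; rewrite kern_expR// expRB lnK. Qed.

Lemma kern_normalized k t N : 0 < t <= N%:R ->
  \int[mu]_(v in `]0, 1[) (k / inc 1 t N * kern t v N) = k.
Proof.
move=> tN; rewrite RintegralZl//; last exact: inc_kern_integrable.
by rewrite -/(inc 1 t N) divfK// gt_eqF// inc_gt0// ltr01 lexx.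
Qed.

(** Hoelder's inequality for the kernels, obtained by integrating the convexity
    of the exponential at the normalized kernels. *)
Lemma ln_inc_convex c a b N : 0 <= c <= 1 -> 0 < a <= N%:R -> 0 < b <= N%:R ->
  ln (inc 1 (c * a + (1 - c) * b) N) <=
    c * ln (inc 1 a N) + (1 - c) * ln (inc 1 b N).
Proof.
move=> c01 aN bN; set s := c * a + (1 - c) * b.
have sN : 0 < s <= N%:R by exact: convex_itv.
have A0 : 0 < inc 1 a N by rewrite inc_gt0// ltr01 lexx.
have B0 : 0 < inc 1 b N by rewrite inc_gt0// ltr01 lexx.
have S0 : 0 < inc 1 s N by rewrite inc_gt0// ltr01 lexx.
set K := c * ln (inc 1 a N) + (1 - c) * ln (inc 1 b N).
rewrite -[leRHS]expRK ler_ln ?posrE ?expR_gt0//.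
rewrite -[leRHS]mul1r -ler_pdivrMr ?expR_gt0// mulrC.
rewrite /inc -RintegralZl//; last exact: inc_kern_integrable.
have iZ k t : 0 < t <= N%:R ->
    mu.-integrable `]0, 1[ (EFin \o (fun v => k * kern t v N)).
  move=> tN; rewrite (_ : _ \o _ = (fun v => k%:E * (EFin \o kern t ^~ N) v)%E).
    by apply: integrableZl => //; exact: inc_kern_integrable.
  by apply/funext => v.
have iZD : mu.-integrable `]0, 1[ (EFin \o (fun v =>
    c / inc 1 a N * kern a v N + (1 - c) / inc 1 b N * kern b v N)).
  rewrite (_ : _ \o _ = ((EFin \o (fun v => (c / inc 1 a N * kern a v N)%R)) \+
    (EFin \o (fun v => ((1 - c) / inc 1 b N * kern b v N)%R)))%E).
    by apply: integrableD => //; exact: iZ.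
  by apply/funext => v.
have I1 : \int[mu]_(v in `]0, 1[)
    (c / inc 1 a N * kern a v N + (1 - c) / inc 1 b N * kern b v N) = 1.
  rewrite RintegralD//; [|exact: iZ|exact: iZ].
  by rewrite !kern_normalized//; ring.
rewrite -[leRHS]I1; apply: le_Rintegral => //; first exact: iZ.
move=> v; rewrite /= in_itv/= => v01.
have assoc (x y z : R) : x / y * z = x * (z / y) by rewrite mulrAC -mulrA.
rewrite !assoc [leLHS]mulrC.
rewrite (kern_div a N v01 A0) (kern_div b N v01 B0) (kern_expR s N v01).
rewrite -expRB.
apply: le_trans (expR_convex _ _ c01); rewrite le_eqVlt; apply/orP; left.
apply/eqP; congr expR; rewrite /K /s.
by move: (ln _) (ln _) (ln _) (ln _) (N%:R) => x1 x2 x3 x4 n; ring.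
Qed.

Lemma dens_gt0 theta v N : 0 < theta -> 0 < v < 1 -> (0 < N)%N ->
  0 < dens theta v N.
Proof.
move=> t0 v01 N0; rewrite dens_capped// divr_gt0 ?kern_gt0// inc_gt0 ?ltr01 ?lexx//.
exact: capped_itv.
Qed.

Lemma ln_dens t v N : 0 < v < 1 -> (0 < N)%N -> 0 < t <= N%:R ->
  ln (dens t v N) = (t - 1) * ln v + (N%:R - t) * ln (1 - v) - ln (inc 1 t N).
Proof.
move=> v01 N0 tN; rewrite dens_capped// /capped min_l; last by case/andP: tN.
rewrite ln_div ?posrE ?kern_gt0//; last by rewrite inc_gt0 ?ltr01 ?lexx.
by rewrite kern_expR// expRK.
Qed.

(** The log-density is affine in the parameter up to minus the logarithm of the
    normalization, which is convex. *)
Lemma ln_dens_concave c a b v N : 0 < v < 1 -> (0 < N)%N ->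
  0 <= c <= 1 -> 0 < a <= N%:R -> 0 < b <= N%:R ->
  c * ln (dens a v N) + (1 - c) * ln (dens b v N) <=
    ln (dens (c * a + (1 - c) * b) v N).
Proof.
move=> v01 N0 c01 aN bN.
have sN : 0 < c * a + (1 - c) * b <= N%:R.
  exact: convex_itv.
have affine p q n x y z : x <= c * y + (1 - c) * z ->
    c * ((a - 1) * p + (n - a) * q - y) + (1 - c) * ((b - 1) * p + (n - b) * q - z)
      <= (c * a + (1 - c) * b - 1) * p + (n - (c * a + (1 - c) * b)) * q - x.
  by rewrite -subr_ge0 => xyz; rewrite -subr_ge0; apply: le_trans xyz _; lra.
have subst (x y z x' y' z' : R) : x = x' -> y = y' -> z = z' ->
    c * x' + (1 - c) * y' <= z' -> c * x + (1 - c) * y <= z.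
  by move=> -> -> ->.
apply: (subst _ _ _ _ _ _ (ln_dens v01 N0 aN) (ln_dens v01 N0 bN) (ln_dens v01 N0 sN)).
by apply: affine; exact: ln_inc_convex.
Qed.

End beta_density.

(** * Distribution functions of the family *)

Section beta_cdf.
Context (R : realType).
Local Notation mu := (@lebesgue_measure R).
Implicit Types (a b c t v e theta : R) (N : nat).

Definition dens_cdf theta e N : R :=
  inc e (capped theta N) N / inc 1 (capped theta N) N.

Lemma integral_dens theta e N : 0 < theta -> 0 < e <= 1 -> (0 < N)%N ->
  (\int[mu]_(v in `[0%R, e]) (dens theta v N)%:E = (dens_cdf theta e N)%:E)%E.
Proof.
move=> t0 /andP[e0 e1] N0; have tN := capped_itv t0 N0.
set t := capped theta N in tN *.
have in01 v : v \in (`]0, e[%classic : set R) -> 0 < v < 1.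
  by rewrite inE/= in_itv/=; lra.
have E v : v \in (`]0, e[%classic : set R) ->
    (dens theta v N)%:E = ((inc 1 t N)^-1%:E * (kern t v N)%:E)%E.
  by move=> /in01 v01; rewrite dens_capped// mulrC EFinM.
rewrite integral_itv_bndoo; last first.
  apply: (@eq_measurable_fun _ _ _ _ _
    (fun v => (inc 1 t N)^-1%:E * (kern t v N)%:E)%E).
    by move=> v /E ->.
  by apply: measurable_funeM; apply/measurable_EFinP; exact: measurable_kern.
transitivity (\int[mu]_(v in `]0%R, e[) ((inc 1 t N)^-1%:E * (kern t v N)%:E))%E.
  by apply: eq_integral => v /E.
rewrite integralZl//; last exact: inc_kern_integrable.
rewrite /dens_cdf -/t mulrC EFinM; congr (_ * _)%E.
by rewrite fineK// integrable_fin_num//; exact: inc_kern_integrable.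
Qed.

Lemma integral_dens0 theta e : 0 < e ->
  (\int[mu]_(v in `[0%R, e]) (dens theta v 0)%:E = e%:E)%E.
Proof.
move=> e0; under eq_integral do rewrite /dens orbT.
by rewrite integral_cst//= lebesgue_measure_itv/= lte_fin e0 mul1e oppr0 adde0 //.
Qed.

Lemma inc_top e N : 0 < e <= 1 -> (0 < N)%N -> inc e N%:R N = e ^+ N / N%:R.
Proof.
move=> /andP[e0 e1] N0.
transitivity (fine (\int[mu]_(v in `]0%R, e[) (v ^+ N.-1)%:E)%E).
  congr fine; apply: eq_integral => v; rewrite inE/= in_itv/= => v01.
  by rewrite kern_XMonemX ?subnn /XMonemX ?expr0 ?mulr1//; lra.
rewrite -(@integral_itv_bndoo _ 0 e _ true false); last first.
  by apply/measurable_EFinP; apply: measurable_funTS; exact: exprn_measurable.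
rewrite (@continuous_FTC2 _ _ (fun v => N%:R^-1 * v ^+ N)) //.
- by rewrite /= expr0n eqn0Ngt N0/= mulr0 subr0 mulrC.
- by apply: continuous_subspaceT => x; exact: exprn_continuous.
- split.
  + by move=> x _; apply: derivableM => //; exact: exprn_derivable.
  + apply: cvg_at_right_filter; apply: cvgM; first exact: cvg_cst.
    exact: exprn_continuous.
  + apply: cvg_at_left_filter; apply: cvgM; first exact: cvg_cst.
    exact: exprn_continuous.
- move=> x _; rewrite derive1E deriveZ//=; last exact: exprn_derivable.
  rewrite exp_derive /GRing.scale/= mulr1 mulrA mulVf ?mul1r//.
  by rewrite pnatr_eq0 -lt0n.
Qed.

Lemma cdf_top theta e N : 0 < e <= 1 -> (0 < N)%N -> N%:R <= theta ->
  dens_cdf theta e N = e ^+ N.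
Proof.
move=> e01 N0 Nt; rewrite /dens_cdf /capped min_r// !inc_top ?ltr01 ?lexx//.
by rewrite expr1n mul1r invrK divfK// pnatr_eq0 -lt0n.
Qed.

Lemma inc_split e t N : 0 < e < 1 -> 0 < t <= N%:R ->
  inc 1 t N = inc e t N + \int[mu]_(v in `[e, 1[) kern t v N.
Proof.
move=> e01 tN; rewrite /inc.
have U : `]0, 1[%classic = (`]0, e[ `|` `[e, 1[)%classic :> set R.
  by rewrite -itv_bndbnd_setU ?bnd_simp//; lra.
rewrite U Rintegral_setU//.
  by rewrite -U; exact: inc_kern_integrable.
by apply/disj_setPS => v /=; rewrite !in_itv/=; lra.
Qed.

Section tails.
Variables (e t : R) (N : nat).
Hypotheses (e01 : 0 < e < 1) (tN : 0 < t <= N%:R).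

Let upper_integrable M (NM : (N <= M)%N) :
  mu.-integrable `[e, 1[ (EFin \o kern t ^~ M).
Proof.
apply: kern_integrable => //; last first.
  move=> v/=; by rewrite !in_itv/=; move: e01; lra.
by case/andP: tN => -> /= tN'; rewrite (le_trans tN')// ler_nat.
Qed.

(** Each additional scenario multiplies the kernel by [1 - v], which is at most
    [1 - e] above [e]. *)
Lemma upper_tail_le k :
  \int[mu]_(v in `[e, 1[) kern t v (N + k) <=
    (1 - e) ^+ k * \int[mu]_(v in `[e, 1[) kern t v N.
Proof.
elim: k => [|k IH]; first by rewrite addn0 expr0 mul1r.
rewrite addnS exprS -mulrA; apply: (@le_trans _ _
  ((1 - e) * \int[mu]_(v in `[e, 1[) kern t v (N + k))); last first.
  by rewrite ler_wpM2l//; move: e01; lra.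
rewrite -RintegralZl//; last by apply: upper_integrable; exact: leq_addr.
apply: le_Rintegral => //.
- by apply: upper_integrable; rewrite -addnS leq_addr.
- rewrite (_ : _ \o _ = (fun v => (1 - e)%:E * (EFin \o kern t ^~ (N + k)%N) v)%E).
    by apply: integrableZl => //; apply: upper_integrable; exact: leq_addr.
  by apply/funext => v.
- move=> v; rewrite /= in_itv/= => /andP[ev v1].
  rewrite kernS; last by rewrite v1 andbT; case/andP: e01 => /lt_le_trans ->.
  by rewrite ler_wpM2r ?kern_ge0// lerB.
Qed.

(** Each additional scenario multiplies the kernel by [1 - v], which is at
    least [1 - f] below [f]. *)
Lemma inc_shift_ge k f : 0 < f < 1 -> (1 - f) ^+ k * inc f t N <= inc 1 t (N + k).
Proof.
move=> f01; have f1 : f <= 1 by move/andP: f01 => [_ /ltW].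
have fM M : (N <= M)%N -> mu.-integrable `]0, f[ (EFin \o kern t ^~ M).
  move=> NM; apply: inc_kern_integrable => //.
  by case/andP: tN => -> /= tN'; rewrite (le_trans tN')// ler_nat.
apply: (@le_trans _ _ (inc f t (N + k))); last first.
  rewrite (inc_split (e := f))//; last first.
    by case/andP: tN => -> /= tN'; rewrite (le_trans tN')// ler_nat leq_addr.
  by rewrite lerDl; apply: Rintegral_ge0 => v _; exact: kern_ge0.
elim: k => [|k IH]; first by rewrite addn0 expr0 mul1r.
rewrite addnS exprS -mulrA; apply: (@le_trans _ _
  ((1 - f) * inc f t (N + k))).
  by rewrite ler_wpM2l// subr_ge0.
rewrite /inc -RintegralZl//; last by apply: fM; exact: leq_addr.
apply: le_Rintegral => //.
- rewrite (_ : _ \o _ = (fun v => (1 - f)%:E * (EFin \o kern t ^~ (N + k)%N) v)%E).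
    by apply: integrableZl => //; apply: fM; exact: leq_addr.
  by apply/funext => v.
- by apply: fM; rewrite -addnS leq_addr.
- move=> v; rewrite /= in_itv/= => /andP[v0 vf].
  rewrite kernS; last by rewrite v0 (lt_le_trans vf).
  by rewrite ler_wpM2r ?kern_ge0// lerB// ltW.
Qed.

End tails.

(** As the size grows, the mass of the kernel above [e] becomes negligible with
    respect to its mass below [e / 2]: the former decays at the rate [1 - e],
    the latter at most at the rate [1 - e / 2]. *)
Lemma cdf_large theta e b : 0 < theta -> 0 < e < 1 -> b < 1 ->
  exists2 N, (0 < N)%N & b <= dens_cdf theta e N.
Proof.
move=> t0 e01 b1; pose N := (Num.truncn theta).+1.
have tN : theta < N%:R by exact: truncnS_gt.
have tN' : 0 < theta <= N%:R by rewrite t0 ltW.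
have f01 : 0 < e / 2 < 1 by lra.
have f1 : 0 < 1 - e / 2 by lra.
pose q := (1 - e) / (1 - e / 2).
have q01 : 0 <= q < 1 by rewrite divr_ge0 ?ltr_pdivrMr//=; lra.
have [T T0 tail] : exists2 T : R, 0 <= T & forall k,
    \int[mu]_(v in `[e, 1[) kern theta v (N + k) <= (1 - e) ^+ k * T.
  eexists; last by move=> k; exact: upper_tail_le.
  by apply: Rintegral_ge0 => v _; exact: kern_ge0.
have [I I0 low] : exists2 I : R, 0 < I & forall k,
    (1 - e / 2) ^+ k * I <= inc 1 theta (N + k).
  eexists; last by move=> k; exact: inc_shift_ge.
  by apply: inc_gt0 => //; lra.
pose C := T / I.
have : C * q ^+ k @[k --> \oo] --> (C * 0 : R).
  apply: cvgM; first exact: cvg_cst.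
  by apply: cvg_expr; rewrite ger0_norm; lra.
rewrite mulr0 => /cvgrPdist_le/(_ (1 - b)); rewrite subr_gt0 => /(_ b1)[k _ /(_ k)].
rewrite /= leqnn => /(_ isT) Cq.
have {}Cq : C * q ^+ k <= 1 - b by move: Cq; rewrite sub0r normrN => /ler_normlW.
exists (N + k)%N => //.
have tNk : 0 < theta <= (N + k)%:R.
  by case/andP: tN' => -> /= tN''; rewrite (le_trans tN'')// ler_nat leq_addr.
rewrite /dens_cdf /capped min_l; last by case/andP: tNk.
have D0 : 0 < inc 1 theta (N + k) by rewrite inc_gt0 ?ltr01 ?lexx.
have -> : inc e theta (N + k) = inc 1 theta (N + k) - \int[mu]_(v in `[e, 1[) kern theta v (N + k).
  by rewrite (inc_split e01 tNk) addrK.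
rewrite mulrBl divff ?gt_eqF// lerBrDr -lerBrDl.
apply: le_trans Cq; rewrite ler_pdivrMr//.
apply: le_trans (tail k) _.
have Cqk : 0 <= C * q ^+ k.
  have /andP[q0 _] := q01; have C0 : 0 <= C by rewrite divr_ge0// ltW.
  by rewrite mulr_ge0// exprn_ge0.
apply: le_trans (ler_wpM2l Cqk (low k)).
rewrite /C /q expr_div_n; have f0 : (1 - e / 2) ^+ k != 0 by rewrite expf_neq0 ?gt_eqF.
move: ((1 - e / 2) ^+ k) ((1 - e) ^+ k) f0 => y x y0.
by rewrite le_eqVlt; apply/orP; left; apply/eqP; field; rewrite y0 gt_eqF.
Qed.

End beta_cdf.

(** * The sample size estimate *)

Section sample_size.
Context (R : realType).
Local Notation mu := (@lebesgue_measure R).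
Implicit Types (a b c t v e theta : R) (N : nat).

(** Passing from [N] to [N.+1] multiplies the kernel by the decreasing factor
    [1 - v], which moves mass towards zero. *)
Lemma cdf_ltS t e N : 0 < e < 1 -> 0 < t <= N%:R ->
  dens_cdf t e N < dens_cdf t e N.+1.
Proof.
move=> e01 tN; have /andP[e0 e1] := e01; have /andP[t0 tN1] := tN.
have tNS : 0 < t <= N.+1%:R by rewrite t0 (le_trans tN1)// ler_nat.
have tail := upper_tail_le e01 tN 1; rewrite addn1 expr1 in tail.
have up0 : 0 < \int[mu]_(v in `[e, 1[) kern t v N.
  apply: Rintegral_gt0 => //.
  - by rewrite lebesgue_measure_itv/= lte_fin e1 -EFinB gt_eqF// lte_fin subr_gt0.
  - by move=> v; rewrite /= in_itv/= => /andP[ev v1]; rewrite kern_gt0// v1 (lt_le_trans e0).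
  - apply: kern_integrable => // v; rewrite /= !in_itv/= => /andP[ev ->].
    by rewrite (lt_le_trans e0).
have low : (1 - e) * inc e t N < inc e t N.+1.
  rewrite -subr_gt0 /inc -RintegralZl//; last by apply: inc_kern_integrable => //; exact: ltW.
  rewrite -RintegralB//; last 2 first.
  - by apply: inc_kern_integrable => //; exact: ltW.
  - rewrite (_ : _ \o _ = (fun v => (1 - e)%:E * (EFin \o kern t ^~ N) v)%E).
      by apply: integrableZl => //; apply: inc_kern_integrable => //; exact: ltW.
    by apply/funext => v.
  apply: Rintegral_gt0 => //.
  - by rewrite lebesgue_measure_itv/= lte_fin e0 oppr0 adde0 gt_eqF// lte_fin.
  - move=> v; rewrite /= in_itv/= => /andP[v0 ve].
    have v01 : 0 < v < 1 by rewrite v0 (lt_trans ve).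
    by rewrite kernS// -mulrBl mulr_gt0 ?kern_gt0// subr_gt0 ltrD2l ltrN2.
  - rewrite (_ : _ \o _ = ((EFin \o kern t ^~ N.+1) \-
        (fun v => (1 - e)%:E * (EFin \o kern t ^~ N) v))%E).
      apply: integrableB => //; first by apply: inc_kern_integrable => //; exact: ltW.
      by apply: integrableZl => //; apply: inc_kern_integrable => //; exact: ltW.
    by apply/funext => v.
have a0 : 0 < inc e t N by rewrite inc_gt0// e0 ltW.
have D0 : 0 < inc 1 t N by rewrite inc_gt0// ltr01 lexx.
have DS0 : 0 < inc 1 t N.+1 by rewrite inc_gt0// ltr01 lexx.
rewrite /dens_cdf /capped min_l// min_l; last by case/andP: tNS.
rewrite ltr_pdivrMr// mulrAC ltr_pdivlMr//.
rewrite (inc_split e01 tN) (inc_split e01 tNS).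
move: (inc e t N) (inc e t N.+1) (\int[mu]_(v in _) kern t v N)
  (\int[mu]_(v in _) kern t v N.+1) up0 tail low a0 => x x' y y' y0 yy' xx' x0.
rewrite !mulrDr [x * x']mulrC ltrD2l.
apply: (@le_lt_trans _ _ (x * ((1 - e) * y))); first by rewrite ler_wpM2l// ltW.
by rewrite mulrA [x * _]mulrC ltr_pM2r.
Qed.

Lemma capped_continuous N : continuous (fun theta : R => capped theta N).
Proof.
move=> theta; apply: (@continuous_min R R (fun x => x) (fun=> N%:R)) => //.
exact: cst_continuous.
Qed.

Lemma inc_continuous e N theta : 0 < e <= 1 -> (0 < N)%N -> 0 < theta ->
  {for theta, continuous (fun x => inc e (capped x N) N)}.
Proof.
move=> /andP[e0 e1] N0 t0.
(* Domination is needed near [theta] only: here on [theta / 2, theta + 1]. *)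
pose u := theta / 2; pose a := Num.min u N%:R.
have u0 : 0 < u by rewrite /u; lra.
have a0 : 0 < a by rewrite lt_min u0 ltr0n.
have sub01 : (`]0, e[%classic : set (measurableTypeR R)) `<=` `]0, 1[%classic.
  exact: subitv01.
have := @continuity_under_integral R _ (measurableTypeR R) mu
  (fun x v => kern (capped x N) v N) `]0, e[%classic (measurable_itv _) u (theta + 1)
  _ _ (fun v => v `^ (a - 1)) _ _.
apply.
- move=> x /=; rewrite in_itv/= => /andP[ux _]; apply: inc_kern_integrable => //.
  by apply: capped_itv => //; exact: lt_trans ux.
- apply: aeW => v; rewrite /= in_itv/= => /andP[v0 ve] x _.
  have v01 : 0 < v < 1 by rewrite v0 (lt_le_trans ve).
  pose L y := (capped y N - 1) * ln v + (N%:R - capped y N) * ln (1 - v).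
  have -> : (fun y => kern (capped y N) v N) = expR \o L.
    by apply/funext => y; rewrite /= kern_expR.
  apply: continuous_comp; last exact: continuous_expR.
  apply: cvgD; apply: cvgM; (try exact: cvg_cst).
    apply: cvgB; [exact: capped_continuous|exact: cvg_cst].
  apply: cvgB; [exact: cvg_cst|exact: capped_continuous].
- apply: (@integrableS _ _ _ mu `]0, 1[%classic) => //; exact: powR_integrable.
- move=> x /=; rewrite in_itv/= => /andP[ux _].
  apply: aeW => v; rewrite /= in_itv/= => /andP[v0 ve].
  have v01 : 0 < v < 1 by rewrite v0 (lt_le_trans ve).
  rewrite ger0_norm ?kern_ge0//; apply: kern_le => //.
    by rewrite /a /capped le_min !ge_min (ltW ux) lexx orbT.
  by rewrite ge_min lexx orbT.
- by rewrite inE/= in_itv/= /u; lra.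
Qed.

Lemma cdf_continuous e N theta : 0 < e <= 1 -> (0 < N)%N -> 0 < theta ->
  {for theta, continuous (fun x => dens_cdf x e N)}.
Proof.
move=> e01 N0 t0; apply: cvgM; first exact: inc_continuous.
have i1 : 0 < (1 : R) <= 1 by rewrite ltr01 lexx.
apply: cvgV; last exact: inc_continuous.
by rewrite gt_eqF// inc_gt0//; exact: capped_itv.
Qed.

Lemma nat_minP (P : set nat) : P !=set0 ->
  P (nat_min P) /\ forall m, P m -> (nat_min P <= m)%N.
Proof.
move=> [n Pn]; rewrite /nat_min; case: xgetP => [k _ //|/(_ _)].
have exP : exists n, `[< P n >] by exists n; apply/asboolP.
case: (ex_minnP exP) => m /asboolP Pm mP /(_ m)/=.
by case; split => // k Pk; apply: mP; apply/asboolP.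
Qed.

Section nbar.
Variables (e b : R).
Hypotheses (e0 : 0 < e) (eb : e < b) (b1 : b < 1).

Let e01 : 0 < e < 1. Proof. by rewrite e0 (lt_trans eb). Qed.
Let e01' : 0 < e <= 1. Proof. by have /andP[-> /ltW ->] := e01. Qed.

Definition reliable theta N := (0 < N)%N /\ b <= dens_cdf theta e N.

Lemma nbarE theta : 0 < theta -> nbar theta e b = nat_min (reliable theta).
Proof.
move=> t0; congr nat_min; apply/seteqP; split => -[|N] /=.
- by rewrite integral_dens0// lee_fin leNgt eb.
- by rewrite integral_dens// lee_fin => ?; split.
- by case.
- by case=> _; rewrite integral_dens// lee_fin.
Qed.

Lemma nbarP theta : 0 < theta -> reliable theta (nbar theta e b) /\
  forall m, reliable theta m -> (nbar theta e b <= m)%N.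
Proof.
move=> t0; rewrite nbarE//; apply: nat_minP.
by have [N N0 bN] := cdf_large t0 e01 b1; exists N.
Qed.

(** For [N] at most [theta] the density is that of the maximum of [N] uniform
    variables, so its mass below [e] is [e ^+ N], at most [e]. *)
Lemma reliable_gt theta N : reliable theta N -> theta < N%:R.
Proof.
move=> [N0 bN]; rewrite ltNge; apply/negP => Nt; move: bN; apply/negP.
rewrite cdf_top// -ltNge; apply: le_lt_trans eb.
by apply: ler_iXnr => //; [exact: ltW|case/andP: e01'].
Qed.

Lemma nbar_gt theta : 0 < theta -> theta < (nbar theta e b)%:R.
Proof. by move=> t0; apply: reliable_gt; case: (nbarP t0). Qed.

(** At [d] the criterion may hold with equality, so a small error in the
    parameter can increase the estimate; by strict monotonicity in the size and
    continuity in the parameter, it does so by at most one. *)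
Lemma nbar_near (d : R) : 0 < d ->
  \forall theta \near d, (nbar d e b <= nbar theta e b <= (nbar d e b).+1)%N.
Proof.
move=> d0; have [[M0 bM] minM] := nbarP d0; set M := nbar d e b in M0 bM minM *.
have dM : d <= M%:R by apply/ltW/nbar_gt.
have below n : (n <= M)%N ->
    \forall theta \near d, forall m, (m < n)%N -> ~ reliable theta m.
  elim: n => [|n IH] nM; first by apply: filterE => ? [|m].
  have [->|n0] := posnP n.
    by apply: filterE => ? [_ []|m].
  have cn : dens_cdf d e n < b.
    by rewrite ltNge; apply/negP => bn; have := minM n (conj n0 bn); rewrite leqNgt nM.
  have near_n := cvgr_lt _ (cdf_continuous e01' n0 d0) _ cn.
  have near_m := IH (ltnW nM); near=> theta => m.
  have tn : dens_cdf theta e n < b by near: theta; exact: near_n.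
  have tm : forall m, (m < n)%N -> ~ reliable theta m by near: theta; exact: near_m.
  rewrite ltnS leq_eqVlt => /predU1P[->|/tm//] [_].
  by rewrite leNgt tn.
have MS : b < dens_cdf d e M.+1.
  by apply: le_lt_trans bM _; apply: cdf_ltS => //; rewrite d0.
have near_MS := cvgr_gt _ (cdf_continuous e01' (ltn0Sn M) d0) _ MS.
have near_0 : \forall theta \near d, 0 < theta by exact: lt_nbhsr.
near=> theta.
have t0 : 0 < theta by near: theta.
have [rt mint] := nbarP t0; apply/andP; split.
  rewrite leqNgt; apply/negP => lt.
  have : forall m, (m < M)%N -> ~ reliable theta m by near: theta; exact: below.
  by move=> /(_ _ lt).
apply: mint; split; first exact: ltn0Sn.
have : b < dens_cdf theta e M.+1 by near: theta; exact: near_MS.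
exact: ltW.
Unshelve. all: by end_near. Qed.

Lemma measurable_fun_nat d' (T : measurableType d') (D : set T) (f : T -> nat) :
  (forall n, measurable (D `&` f @^-1` [set n])) -> measurable_fun D f.
Proof.
move=> mf mD Y _; rewrite (_ : _ `&` _ = \bigcup_(n in Y) (D `&` f @^-1` [set n])).
  by apply: bigcup_measurable => n _.
apply/seteqP; split => [x [Dx Yfx]|x [n Yn [Dx fx]]]; first by exists (f x).
by split => //=; rewrite fx.
Qed.

(** The estimate is the first index at which one of countably many continuous
    functions of the parameter reaches a level. *)
Lemma measurable_nbar :
  measurable_fun (`]0, +oo[%classic : set R) (fun theta => nbar theta e b).
Proof.
pose D : set R := `]0, +oo[%classic.
have mr N : measurable (D `&` [set theta | reliable theta N]).
  have [->|N0] := posnP N.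
    by rewrite (_ : _ `&` _ = set0)//; apply/seteqP; split => x // [_ []].
  rewrite (_ : _ `&` _ = D `&` (fun x => dens_cdf x e N) @^-1` `[b, +oo[%classic).
    have mf : measurable_fun D (fun x => dens_cdf x e N).
      apply: open_continuous_measurable_fun; first exact: interval_open.
      by move=> x; rewrite inE /D /= in_itv/= andbT; exact: cdf_continuous.
    by apply: mf; exact: measurable_itv.
  apply/seteqP; split => x [Dx] /=; rewrite in_itv/= andbT; last by split.
  by case.
apply: measurable_fun_nat => n.
rewrite (_ : _ `&` _ = (D `&` [set theta | reliable theta n]) `\`
    \bigcup_(m < n) (D `&` [set theta | reliable theta m])).
  by apply: measurableD => //; exact: bigcup_measurable.
apply/seteqP; split => x [].
  move=> Dx <-; have x0 : 0 < x by move: Dx; rewrite /= in_itv/= andbT.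
  have [rx minx] := nbarP x0; split => // -[m /= mn [_ /minx]].
  by rewrite leqNgt mn.
move=> [Dx rx] nx; split => //=; have x0 : 0 < x by move: Dx; rewrite /D/= in_itv/= andbT.
have [rx' minx] := nbarP x0; apply/eqP; rewrite eqn_leq minx//= leqNgt.
by apply/negP => lt; apply: nx; exists (nbar x e b).
Qed.

End nbar.
End sample_size.

(** * Hellinger affinity *)

Section hellinger.
Context (R : realType).
Local Notation mu := (@lebesgue_measure R).
Implicit Types (a b c t v e theta : R) (N : nat).

(** Half the log-likelihood ratio of [t] against [d] at one observation, by
    [half_llrE]. This closed form is a measurable function on the whole line. *)
Definition half_llr t d N v : R :=
  ((t - d) * (ln v - ln (1 - v)) - (ln (inc 1 t N) - ln (inc 1 d N))) / 2.

Lemma half_llrE t d N v : 0 < v < 1 -> (0 < N)%N ->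
  0 < t <= N%:R -> 0 < d <= N%:R ->
  half_llr t d N v = (ln (dens t v N) - ln (dens d v N)) / 2.
Proof.
move=> v01 N0 tN dN; rewrite /half_llr; congr (_ / 2).
have subst (x y x' y' : R) : x = x' -> y = y' -> x - y = x' - y' by move=> -> ->.
rewrite (subst _ _ _ _ (ln_dens v01 N0 tN) (ln_dens v01 N0 dN)).
move: (ln (inc 1 t N)) (ln (inc 1 d N)) (ln v) (ln (1 - v)) => x y p q; ring.
Qed.

Lemma measurable_half_llr t d N :
  measurable_fun [set: R] (fun v => expR (half_llr t d N v)).
Proof.
apply: measurableT_comp; first exact: measurable_expR.
apply: measurable_funM => //; apply: measurable_funB => //.
apply: measurable_funM => //; apply: measurable_funB; first exact: measurable_ln.
apply: (@measurableT_comp _ _ _ _ _ _ (@ln R)); first exact: measurable_ln.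
exact: measurable_funB.
Qed.

(** The defect in the inequality between the arithmetic and the geometric mean
    of two exponentials. *)
Lemma expR_gap (x y : R) :
  (expR x + expR y) / 2 - expR y * expR ((x - y) / 2) =
    (expR (x / 2) - expR (y / 2)) ^+ 2 / 2.
Proof.
have half (z : R) : expR z = expR (z / 2) * expR (z / 2) by rewrite -expRD -splitr.
rewrite -expRD (_ : y + (x - y) / 2 = x / 2 + y / 2); last by field.
rewrite expRD {1}(half x) {1}(half y).
by move: (expR (x / 2)) (expR (y / 2)) => p q; field.
Qed.

Section affinity.
Variables (t d : R) (N : nat).
Hypotheses (N0 : (0 < N)%N) (tN : 0 < t <= N%:R) (dN : 0 < d <= N%:R) (td : t != d).

Let f v := kern t v N / inc 1 t N.
Let g v := kern d v N / inc 1 d N.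
Let sqrt_fg v := g v * expR (half_llr t d N v).

Let It : 0 < inc 1 t N. Proof. by rewrite inc_gt0// ltr01 lexx. Qed.
Let Id : 0 < inc 1 d N. Proof. by rewrite inc_gt0// ltr01 lexx. Qed.

Let lf v := (t - 1) * ln v + (N%:R - t) * ln (1 - v) - ln (inc 1 t N).
Let lg v := (d - 1) * ln v + (N%:R - d) * ln (1 - v) - ln (inc 1 d N).

Let fE v : 0 < v < 1 -> f v = expR (lf v).
Proof. by move=> v01; rewrite /f kern_div. Qed.

Let gE v : 0 < v < 1 -> g v = expR (lg v).
Proof. by move=> v01; rewrite /g kern_div. Qed.

Let half_llr_lfg v : half_llr t d N v = (lf v - lg v) / 2.
Proof.
rewrite /half_llr /lf /lg; congr (_ / _).
by move: (ln (inc 1 t N)) (ln (inc 1 d N)) (ln v) (ln (1 - v)) => x y p q; ring.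
Qed.

Let gap v : 0 < v < 1 ->
  (f v + g v) / 2 - sqrt_fg v = (expR (lf v / 2) - expR (lg v / 2)) ^+ 2 / 2.
Proof.
by move=> v01; rewrite /sqrt_fg fE// gE// half_llr_lfg; exact: expR_gap.
Qed.

Let If : mu.-integrable `]0, 1[ (EFin \o f).
Proof.
rewrite (_ : _ \o _ = (fun v => (inc 1 t N)^-1%:E * (EFin \o kern t ^~ N) v)%E).
  by apply: integrableZl => //; exact: inc_kern_integrable.
by apply/funext => v; rewrite /= /f mulrC EFinM.
Qed.

Let Ig : mu.-integrable `]0, 1[ (EFin \o g).
Proof.
rewrite (_ : _ \o _ = (fun v => (inc 1 d N)^-1%:E * (EFin \o kern d ^~ N) v)%E).
  by apply: integrableZl => //; exact: inc_kern_integrable.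
by apply/funext => v; rewrite /= /g mulrC EFinM.
Qed.

Let normalized s : 0 < s <= N%:R ->
  \int[mu]_(v in `]0, 1[) (kern s v N / inc 1 s N) = 1.
Proof.
move=> sN; rewrite -[RHS](kern_normalized 1 sN); apply: eq_Rintegral => v _.
by rewrite mulrC mul1r.
Qed.

Let msqrt (D : set (measurableTypeR R)) : measurable_fun D sqrt_fg.
Proof.
apply: measurable_funTS; apply: measurable_funM; last exact: measurable_half_llr.
apply: measurable_funM; last exact: measurable_cst.
exact: measurable_kern.
Qed.

Let mean v := (f v + g v) / 2.

Let Isum : mu.-integrable `]0, 1[ (EFin \o (fun v => f v + g v)).
Proof.
rewrite (_ : _ \o _ = ((EFin \o f) \+ (EFin \o g))%E); last by apply/funext => v.
by apply: integrableD; [exact: measurable_itv|exact: If|exact: Ig].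
Qed.

Let Imean : mu.-integrable `]0, 1[ (EFin \o mean).
Proof.
rewrite (_ : _ \o _ = (fun v => (2^-1)%:E * (EFin \o (fun v => (f v + g v)%R)) v)%E).
  by apply: integrableZl => //; exact: Isum.
by apply/funext => v; rewrite /= /mean mulrC EFinM.
Qed.

Let sqrt_le v : 0 < v < 1 -> 0 <= sqrt_fg v <= mean v.
Proof.
move=> v01; apply/andP; split.
  by rewrite mulr_ge0 ?expR_ge0// gE// expR_ge0.
by rewrite -subr_ge0 gap// divr_ge0// sqr_ge0.
Qed.

Let Isqrt : mu.-integrable `]0, 1[ (EFin \o sqrt_fg).
Proof.
apply: le_integrable Imean => //.
  by apply/measurable_EFinP; exact: msqrt.
move=> v; rewrite /= in_itv/= => /sqrt_le/andP[s0 sm].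
by rewrite lee_fin !ger0_norm// (le_trans s0).
Qed.

Let same_at v : 0 < v < 1 -> sqrt_fg v = mean v ->
  (t - d) * (ln v - ln (1 - v)) = ln (inc 1 t N) - ln (inc 1 d N).
Proof.
move=> v01 E; have : (expR (lf v / 2) - expR (lg v / 2)) ^+ 2 / 2 = 0.
  by rewrite -gap// E subrr.
move/eqP; rewrite mulf_eq0 invr_eq0 pnatr_eq0 orbF sqrf_eq0 subr_eq0 => /eqP/expR_inj.
have half_inj (x y : R) : x / 2 = y / 2 -> x = y by lra.
move/half_inj; rewrite /lf /lg.
by move: (ln (inc 1 t N)) (ln (inc 1 d N)) (ln v) (ln (1 - v)) => x y p q; lra.
Qed.

Let affinity_lt1 : \int[mu]_(v in `]0, 1[) sqrt_fg v < 1.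
Proof.
have I1 : \int[mu]_(v in `]0, 1[) mean v = 1.
  rewrite (_ : mean = fun v => 2^-1 * (f v + g v)); last first.
    by apply/funext => v; rewrite /mean mulrC.
  rewrite (RintegralZl _ _ Isum)// (RintegralD _ If Ig)//.
  by rewrite (normalized tN) (normalized dN); field.
rewrite -[ltRHS]I1.
rewrite -subr_gt0 -(RintegralB _ Imean Isqrt)//.
pose K := (ln (inc 1 t N) - ln (inc 1 d N)) / (t - d).
(* The two densities agree only where the odds take one given value, as their
   log-ratio is affine in the log-odds with slope [t - d]. *)
have [v0 v0P] : exists v0, forall v, 0 < v < 1 -> sqrt_fg v = mean v -> v = v0.
  have [[v0 [v001 v0K]]|nov] := pselect (exists v0, 0 < v0 < 1 /\ ln v0 - ln (1 - v0) = K).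
    exists v0 => v v01 /(same_at v01) E.
    have : ln v - ln (1 - v) = ln v0 - ln (1 - v0).
      by rewrite v0K /K -E mulrAC divff ?mul1r// subr_eq0.
    have incr (x y : R) : 0 < x < 1 -> 0 < y < 1 -> x < y ->
        ln x - ln (1 - x) < ln y - ln (1 - y).
      move=> /andP[x0 x1] /andP[y0 y1] xy; apply: ltrD.
        by rewrite ltr_ln ?posrE.
      by rewrite ltrN2 ltr_ln ?posrE ?subr_gt0// ltrD2l ltrN2.
    case: (ltgtP v v0) => // [/(incr _ _ v01 v001)|/(incr _ _ v001 v01)] + Ev;
      by rewrite Ev ltxx.
  exists 0 => v v01 /(same_at v01) E; exfalso; apply: nov; exists v; split => //.
  by rewrite /K -E mulrAC divff ?mul1r// subr_eq0.
apply: (Rintegral_gt0_off1 (v0 := v0)) => //.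
- by rewrite lebesgue_measure_itv/= lte_fin ltr01 oppr0 adde0 gt_eqF// lte_fin.
- by move=> v; rewrite /= in_itv/= => /sqrt_le/andP[_]; rewrite subr_ge0.
- move=> v; rewrite /= in_itv/= => v01 vv0; have /andP[_ sm] := sqrt_le v01.
  rewrite subr_gt0 lt_neqAle sm andbT; apply/eqP => /(v0P v v01).
  exact: vv0.
- rewrite (_ : _ \o _ = ((EFin \o mean) \- (EFin \o sqrt_fg))%E).
    by apply: integrableB; [exact: measurable_itv|exact: Imean|exact: Isqrt].
  by apply/funext => v.
Qed.

(** The affinity is the integral of the geometric mean of two densities; it is
    less than that of the arithmetic mean, which is one, since the densities
    differ almost everywhere. *)
Lemma hellinger_affinity : exists2 rho : R, rho < 1 &
  (\int[mu]_(v in `]0%R, 1%R[) (kern d v N / inc 1 d N * expR (half_llr t d N v))%:E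
     = rho%:E)%E.
Proof.
exists (\int[mu]_(v in `]0, 1[) sqrt_fg v) => //.
by rewrite fineK// integrable_fin_num.
Qed.

End affinity.
End hellinger.

(** * Beta probabilities as members of the family *)

Section beta_expectation.
Context (R : realType).
Local Notation mu := (@lebesgue_measure R).

(** The change of density holds for bounded functions; monotone convergence
    along truncations extends it, as an inequality, to nonnegative functions
    that are possibly not integrable. *)
Lemma ge0_integral_beta_prob_le a b (h : R -> R) :
  measurable_fun [set: R] h -> (forall v, 0 <= h v) ->
  (\int[beta_prob a b]_v (h v)%:E <=
   \int[mu]_(v in `]0%R, 1%R[) (beta_pdf a b v * h v)%:E)%E.
Proof.
move=> mh h0; set I := (\int[mu]_(_ in _) _)%E.
pose hM (M : nat) v := Num.min (h v) M%:R.
have mhM M : measurable_fun [set: R] (hM M).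
  by apply: measurable_minr => //; exact: measurable_cst.
have hM0 M v : 0 <= hM M v by rewrite le_min h0 ler0n.
have cvh v : (hM M v)%:E @[M --> \oo] --> (h v)%:E.
  apply: cvg_near_cst; exists (Num.truncn (h v)).+1 => // M /= hv.
  congr EFin; apply/min_idPl/ltW/(lt_le_trans (truncnS_gt _)).
  by rewrite ler_nat.
have step M : (\int[beta_prob a b]_v (hM M v)%:E <= I)%E.
  rewrite integral_beta_prob//; last 2 first.
  - by apply/measurable_EFinP; exact: mhM.
  - have /integrableP[_] : (beta_prob a b).-integrable setT (EFin \o hM M).
      apply: measurable_bounded_integrable => //.
      + by rewrite (le_lt_trans (probability_le1 _ _)) ?ltry.
      + exact: mhM.
      + exists M%:R; split; first exact: num_real.
        by move=> x Mx v /= _; rewrite ger0_norm// (le_trans _ (ltW Mx))// ge_min lexx orbT.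
    exact.
  have mF : measurable_fun [set: R] (fun v => hM M v * beta_pdf a b v).
    by apply: measurable_funM; [exact: mhM|exact: measurable_beta_pdf].
  rewrite [leLHS](_ : _ =
      (\int[mu]_(v in `]0%R, 1%R[) (hM M v * beta_pdf a b v)%:E)%E); last first.
    rewrite -(@integral_itv_bndoo _ 0 1 _ true false); last first.
      by apply/measurable_EFinP; exact: measurable_funTS.
    rewrite [RHS]integral_mkcond; apply: eq_integral => v _.
    rewrite patchE mem_setE; case: ifPn => // v01.
    by rewrite /beta_pdf patchE mem_setE (negbTE v01) mul0r mule0.
  apply: ge0_le_integral => //.
  - by move=> v _; rewrite lee_fin mulr_ge0// beta_pdf_ge0.
  - by apply/measurable_EFinP; exact: measurable_funTS.
  - apply/measurable_EFinP; apply: measurable_funTS; apply: measurable_funM => //.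
    exact: measurable_beta_pdf.
  - move=> v _; rewrite lee_fin mulrC ler_wpM2l ?beta_pdf_ge0//.
    by rewrite ge_min lexx.
have -> : (\int[beta_prob a b]_v (h v)%:E =
    limn (fun M => \int[beta_prob a b]_v (hM M v)%:E))%E.
  rewrite -monotone_convergence//.
  - by apply: eq_integral => v _; apply/esym/cvg_lim.
  - by move=> M; apply/measurable_EFinP; exact: mhM.
  - by move=> M v _; rewrite lee_fin.
  - by move=> v _ M M' MM'; rewrite lee_fin le_min ge_min lexx/= ge_min ler_nat MM' orbT.
apply: lime_le; last exact: nearW.
apply: ereal_nondecreasing_is_cvgn => M M' MM'; apply: ge0_le_integral => //.
- by move=> v _; rewrite lee_fin.
- by apply/measurable_EFinP; exact: mhM.
- by apply/measurable_EFinP; exact: mhM.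
- by move=> v _; rewrite lee_fin le_min ge_min lexx/= ge_min ler_nat MM' orbT.
Qed.

Lemma beta_pdf_kern d N (v : R) : (0 < d)%N -> (d <= N)%N -> 0 < v < 1 ->
  beta_pdf d (N - d).+1 v = kern d%:R v N / inc 1 d%:R N.
Proof.
move=> d0 dN v01; rewrite /beta_pdf patchE mem_setE in_itv/=.
have /andP[v0 v1] := v01; rewrite (ltW v0) (ltW v1)/=.
by rewrite kern_XMonemX// inc_beta_fun.
Qed.

Lemma beta_hellinger d N (t : R) : (0 < d)%N -> (d <= N)%N ->
  0 < t <= N%:R -> t != d%:R ->
  exists2 rho : R, 0 <= rho < 1 &
    (\int[beta_prob d (N - d).+1]_v (expR (half_llr t d%:R N v))%:E <= rho%:E)%E.
Proof.
move=> d0 dN tN td.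
have N0 : (0 < N)%N by exact: leq_trans dN.
have dN' : 0 < (d%:R : R) <= N%:R by rewrite ltr0n d0 ler_nat.
have [rho rho1 rhoE] := hellinger_affinity tN dN' td.
have step : (\int[beta_prob d (N - d).+1]_v (expR (half_llr t d%:R N v))%:E <= rho%:E)%E.
  rewrite -rhoE; apply: le_trans (ge0_integral_beta_prob_le _ _ _ _) _.
  - exact: measurable_half_llr.
  - by move=> v; exact: expR_ge0.
  rewrite le_eqVlt; apply/orP; left; apply/eqP; apply: eq_integral => v.
  by rewrite inE/= in_itv/= => v01; rewrite beta_pdf_kern.
exists rho => //; rewrite rho1 andbT -lee_fin; apply: le_trans step.
by apply: integral_ge0 => v _; rewrite lee_fin expR_ge0.
Qed.

Lemma dens_cdf_beta_prob d N (e : R) : (0 < d)%N -> (d <= N)%N -> 0 < e <= 1 ->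
  (beta_prob d (N - d).+1 `[0%R, e]%classic = (dens_cdf d%:R e N)%:E)%E.
Proof.
move=> d0 dN /andP[e0 e1].
have N0 : (0 < N)%N by exact: leq_trans dN.
have d0' : 0 < d%:R :> R by rewrite ltr0n.
have dN' : 0 < (d%:R : R) <= N%:R by rewrite d0' ler_nat.
rewrite -integral_beta_pdf; last exact: measurable_itv.
rewrite integral_itv_bndoo; last first.
  by apply/measurable_EFinP; apply: measurable_funTS; exact: measurable_beta_pdf.
transitivity (\int[mu]_(v in `]0%R, e[)
    ((inc 1 d%:R N)^-1%:E * (kern d%:R v N)%:E))%E.
  apply: eq_integral => v; rewrite inE/= in_itv/= => /andP[v0 ve].
  by rewrite beta_pdf_kern ?v0 ?(lt_le_trans ve)// mulrC EFinM.
rewrite integralZl//; last exact: inc_kern_integrable.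
rewrite /dens_cdf /capped min_l; last by case/andP: dN'.
rewrite mulrC EFinM; congr (_ * _)%E.
by rewrite fineK// integrable_fin_num//; exact: inc_kern_integrable.
Qed.

End beta_expectation.

(** * The data set as a random variable *)

Section process.
Context (R : realType) (X : Type).
Context (dG : measure_display) (G : measurableType dG) (ev : G -> X -> R).
Context (P : probability G R) (A : seq G -> X).
Context (d : nat).
Hypothesis A_meas : scenario_measurable ev P A d.
Context (eps beta : R) (eps_gt0 : 0 < eps) (eps_beta : eps < beta) (beta_lt1 : beta < 1).
Context (thetas : seq (R * nat) -> R) (thetas_mle : mle_selection thetas).
Context (N1 Nmax : nat).

Local Notation V s := (risk ev P (A s)).
Local Notation data run t := (dataset ev P A thetas eps beta N1 Nmax run t).
Local Notation next := (next_size thetas eps beta N1 Nmax).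

Lemma datasetS run t : data run t.+1 =
  rcons (data run t) (V (mkseq (run t.+1) (next (data run t))), next (data run t)).
Proof. by []. Qed.

Lemma dataset_valid run t : valid_data (data run t).
Proof.
elim: t => [//|t IH] p; rewrite datasetS mem_rcons inE => /predU1P[->|/IH//].
by rewrite /= risk_ge0 (risk_le1 A_meas).
Qed.

Lemma size_dataset run t : size (data run t) = t.
Proof. by elim: t => [//|t IH]; rewrite datasetS size_rcons IH. Qed.

Lemma next_size_le D : (next D <= maxn N1 Nmax)%N.
Proof.
case: D => [|p D]; first exact: leq_maxl.
by rewrite (leq_trans (geq_minr _ _))// leq_maxr.
Qed.

(** Sizes are bounded by the larger of [N1] and [Nmax], so finitely many
    scenarios determine the data; this is what makes the data independent of
    later rows. *)
Lemma dataset_ext run1 run2 t :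
  (forall s i, (0 < s <= t)%N -> (i < maxn N1 Nmax)%N -> run1 s i = run2 s i) ->
  data run1 t = data run2 t.
Proof.
elim: t => [//|t IH] E; rewrite !datasetS IH => [|s i /andP[s0 st] iK]; last first.
  by apply: E => //; rewrite s0 ltnW.
congr rcons; congr pair; congr (V _).
apply/eq_in_map => i; rewrite mem_iota add0n => /= it.
by apply: E; [exact: leqnn|exact: leq_trans it (next_size_le _)].
Qed.

Section measurability.
Context dW (W : measurableType dW) (xi : nat -> nat -> W -> G).
Hypothesis mxi : forall t i, measurable_fun [set: W] (xi t i).

Local Notation run w := (fun t i => xi t i w).

Definition scenario_row t n : n.-tuple (nat * nat) := [tuple (t, val i) | i < n].

Lemma mkseq_row t n w :
  mkseq (run w t) n = map_tuple (fun k => xi k.1 k.2 w) (scenario_row t n) :> seq G.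
Proof.
rewrite /= -map_comp /mkseq -val_enum_ord -map_comp.
by apply: eq_map.
Qed.

Lemma measurable_row_risk t n :
  measurable_fun [set: W] (fun w => V (mkseq (run w t) n)).
Proof.
rewrite (_ : (fun w => _) = (fun s : n.-tuple G => V s) \o
    (fun w => map_tuple (fun k => xi k.1 k.2 w) (scenario_row t n))); last first.
  by apply/funext => w; rewrite mkseq_row.
apply: measurableT_comp; first exact: (measurable_risk A_meas).
by apply: (measurable_map_tuple (xi := fun k => xi k.1 k.2)) => k; exact: mxi.
Qed.

Lemma measurable_valid_data M :
  measurable [set D : M.-tuple (R * nat) | valid_data D].
Proof.
rewrite (_ : mkset _ = \bigcap_(i in [set: 'I_M])
    ((fun D : M.-tuple (R * nat) => (tnth D i).1) @^-1` `[0, 1]%classic)).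
  apply: fin_bigcap_measurable => [|i _]; first exact: finite_finset.
  rewrite -[X in measurable X]setTI.
  have m1 : measurable_fun [set: M.-tuple (R * nat)] (fun D => (tnth D i).1).
    by apply: (measurableT_comp measurable_fst); exact: measurable_tnth.
  by apply: m1 => //; exact: measurable_itv.
apply/seteqP; split => D /=.
  by move=> vD i _ /=; rewrite in_itv/=; apply: vD; exact: mem_tnth.
by move=> vD p /tnthP[i ->]; have := vD i I; rewrite /= in_itv/=.
Qed.

Let tuple_of_data t w : t.-tuple (R * nat) := tcast (size_dataset (run w) t) (in_tuple (data (run w) t)).

Let val_tuple_of_data t w : tuple_of_data t w = data (run w) t :> seq _.
Proof. by rewrite val_tcast. Qed.

Lemma measurable_data_step t :
  (forall s, (s < t)%N ->
     measurable_fun [set: W] (fun w => nth (0, 0%N) (data (run w) t) s)) ->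
  measurable_fun [set: W] (fun w => next (data (run w) t)).
Proof.
move=> mD; case: t mD => [|t] mD; first exact: measurable_cst.
have [mle msel] := thetas_mle.
have mT : measurable_fun [set: W] (tuple_of_data t.+1).
  apply/measurable_fun_tnthP => i; rewrite (_ : _ \o _ =
      (fun w => nth (0, 0%N) (data (run w) t.+1) i)); first exact: mD.
  by apply/funext => w /=; rewrite (tnth_nth (0, 0%N)) val_tuple_of_data.
have valid w : valid_data (data (run w) t.+1) by exact: dataset_valid.
have nonnil w : data (run w) t.+1 <> [::].
  by move=> /(congr1 size); rewrite size_dataset.
have mth : measurable_fun [set: W] (fun w => thetas (data (run w) t.+1)).
  rewrite (_ : (fun w => _) = (fun D : t.+1.-tuple _ => thetas D) \o tuple_of_data t.+1).
    apply: (measurable_comp (F := [set D : t.+1.-tuple (R * nat) | valid_data D])) => //.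
    - exact: measurable_valid_data.
    - by move=> _ [w _ <-] /=; rewrite val_tuple_of_data.
  by apply/funext => w /=; rewrite val_tuple_of_data.
have mnb : measurable_fun [set: W] (fun w => nbar (thetas (data (run w) t.+1)) eps beta).
  rewrite (_ : (fun w => _) = (fun theta => nbar theta eps beta) \o
      (fun w => thetas (data (run w) t.+1)))//.
  apply: (measurable_comp (F := (`]0, +oo[%classic : set R))) => //.
  - move=> _ [w _ <-] /=; rewrite in_itv/= andbT.
    by have [] := mle _ (nonnil w) (valid w).
  - exact: measurable_nbar.
rewrite (_ : (fun w => _) = (fun n => minn n Nmax) \o
    (fun w => nbar (thetas (data (run w) t.+1)) eps beta)).
  exact: measurableT_comp.
apply/funext => w /=.
have := nonnil w; rewrite /next_size /=.
by case: rcons.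
Qed.

Lemma measurable_next_risk t :
  measurable_fun [set: W] (fun w => next (data (run w) t)) ->
  measurable_fun [set: W]
    (fun w => V (mkseq (run w t.+1) (next (data (run w) t)))).
Proof.
move=> mN _ B mB; rewrite setTI.
rewrite (_ : _ @^-1` _ = \bigcup_n ((fun w => next (data (run w) t)) @^-1` [set n] `&`
    (fun w => V (mkseq (run w t.+1) n)) @^-1` B)).
  apply: bigcup_measurable => n _; apply: measurableI.
    by rewrite -[X in measurable X]setTI; exact: mN.
  by rewrite -[X in measurable X]setTI; exact: measurable_row_risk.
apply/seteqP; split => w /=; first by move=> BV; eexists.
by move=> [n _ [/= <-]].
Qed.

(** Sizes and data points are measurable by a joint induction: a size is a
    measurable function of the earlier data, and the next risk is measurable on
    each of the countably many events that fix the size. *)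
Lemma measurable_data t s :
  measurable_fun [set: W] (fun w => nth (0, 0%N) (data (run w) t) s).
Proof.
elim: t s => [|t IH] s.
  rewrite (_ : (fun w => _) = cst (0, 0%N)); first exact: measurable_cst.
  by apply/funext => w; rewrite /= nth_nil.
rewrite (_ : (fun w => _) = (fun w => if (s < t)%N then nth (0, 0%N) (data (run w) t) s
    else if s == t then (V (mkseq (run w t.+1) (next (data (run w) t))), next (data (run w) t))
    else (0, 0%N))); last first.
  by apply/funext => w; rewrite datasetS nth_rcons size_dataset.
case: (s < t)%N; first exact: IH.
case: (s == t); last exact: measurable_cst.
have mN := measurable_data_step (t := t) (fun s _ => IH s).
by apply: measurable_fun_pair => //; exact: measurable_next_risk.
Qed.

Lemma measurable_next t : measurable_fun [set: W] (fun w => next (data (run w) t)).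
Proof. by apply: measurable_data_step => s _; exact: measurable_data. Qed.

Lemma measurable_risk_at t :
  measurable_fun [set: W] (fun w => V (mkseq (run w t.+1) (next (data (run w) t)))).
Proof. by apply: measurable_next_risk; exact: measurable_next. Qed.

Variables (n : nat) (Z : R -> R).
Hypothesis mZ : measurable_fun [set: R] Z.

(** With [Z] the square root of a likelihood ratio, this is the square root of
    the likelihood ratio of the data of size [n]. *)
Definition prodZ (D : seq (R * nat)) : R := \prod_(p <- D | p.2 == n) Z p.1.

Lemma prodZ_rcons D p :
  prodZ (rcons D p) = prodZ D * (if p.2 == n then Z p.1 else 1).
Proof. by rewrite /prodZ -cats1 big_cat/= [X in _ * X]big_mkcond/= big_seq1. Qed.

Lemma measurable_eq_size t :
  measurable_fun [set: W] (fun w => next (data (run w) t) == n).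
Proof.
apply: (@measurableT_comp _ _ _ _ _ _ (fun m : nat => m == n)) => //.
exact: measurable_next.
Qed.

Lemma measurable_prodZ t : measurable_fun [set: W] (fun w => prodZ (data (run w) t)).
Proof.
elim: t => [|t IH].
  rewrite (_ : (fun w => _) = cst 1); first exact: measurable_cst.
  by apply/funext => w; rewrite /prodZ /= big_nil.
rewrite (_ : (fun w => _) = (fun w => prodZ (data (run w) t) *
    (if next (data (run w) t) == n
     then Z (V (mkseq (run w t.+1) (next (data (run w) t)))) else 1))); last first.
  by apply/funext => w; rewrite datasetS prodZ_rcons.
apply: measurable_funM => //; apply: measurable_fun_ifT.
- exact: measurable_eq_size.
- by apply: (measurableT_comp mZ); exact: measurable_risk_at.
- exact: measurable_cst.
Qed.

End measurability.
End process.

(** * Independence of the data from the next row *)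

Section energy.
Context (R : realType) (X : Type) (J : X -> R).
Context (dG : measure_display) (G : measurableType dG) (ev : G -> X -> R).
Context (P : probability G R) (A : seq G -> X).
Hypothesis A_sol : forall s : seq G, unique (scenario_solution J ev s) (A s).
Context (d : nat) (d_gt0 : (0 < d)%N).
Hypothesis A_meas : scenario_measurable ev P A d.
Hypothesis A_complexity : fixed_complexity P A d.
Context (eps beta : R) (eps_gt0 : 0 < eps) (eps_beta : eps < beta) (beta_lt1 : beta < 1).
Context (thetas : seq (R * nat) -> R) (thetas_mle : mle_selection thetas).
Context (N1 Nmax : nat).
Context (dW : measure_display) (W : measurableType dW) (Pr : probability W R).
Context (xi : nat -> nat -> W -> G).
Hypothesis xi_iid : iid Pr P (fun k : nat * nat => xi k.1 k.2).

Local Notation V s := (risk ev P (A s)).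
Local Notation data run t := (dataset ev P A thetas eps beta N1 Nmax run t).
Local Notation next := (next_size thetas eps beta N1 Nmax).
Local Notation run w := (fun t i => xi t i w).

Let mxi t i : measurable_fun [set: W] (xi t i).
Proof. by have [+ _ _] := xi_iid => /(_ (t, i)). Qed.

Context (n : nat) (dn : (d <= n)%N) (Z : R -> R) (rho : R).
Hypotheses (mZ : measurable_fun [set: R] Z) (Z0 : forall v, 0 <= Z v).
Hypothesis rho01 : 0 <= rho < 1.
Hypothesis Zrho : (\int[beta_prob d (n - d).+1]_v (Z v)%:E <= rho%:E)%E.

Let row_expectation : (\int[power_prob P n]_s (Z (V s))%:E <= rho%:E)%E.
Proof.
apply: le_trans Zrho.
have mV : measurable_fun [set: n.-tuple G] (fun s => V s) by exact: (measurable_risk A_meas).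
rewrite (eq_measure_integral
  (pushforward (power_prob P n) (fun s : n.-tuple G => V s : measurableTypeR R))); last first.
  move=> B mB _; have := risk_beta_law A_sol d_gt0 A_meas A_complexity (n - d) mB.
  by rewrite subnKC// => <-.
rewrite ge0_integral_pushforward//.
  by apply/measurable_EFinP.
by move=> v _; rewrite lee_fin.
Qed.

Local Notation U w t := (prodZ n Z (data (run w) t)).
Local Notation visit w t := (U w t * (next (data (run w) t) == n)%:R).

Lemma prodZ_ge0 D : 0 <= prodZ n Z D.
Proof. by apply: prodr_ge0 => p _; exact: Z0. Qed.

Let measurable_bool_indicator d' (T : measurableType d') (b : T -> bool) :
  measurable_fun [set: T] b -> measurable_fun [set: T] (fun x => (b x)%:R : R).
Proof.
move=> mb; rewrite (_ : (fun x => _) = (fun x => if b x then 1 else 0)).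
  by apply: measurable_fun_ifT => //; exact: measurable_cst.
by apply/funext => x; case: (b x).
Qed.

(** The scenarios [xi'] are arbitrary as they are taken both on the probability
    space of the algorithm and on a space of tuples. *)
Lemma measurable_visit dT (T : measurableType dT) (xi' : nat -> nat -> T -> G) t :
  (forall s i, measurable_fun [set: T] (xi' s i)) ->
  measurable_fun [set: T] (fun w => let D := data (fun s i => xi' s i w) t in
    prodZ n Z D * (next D == n)%:R).
Proof.
move=> mxi'; apply: measurable_funM; first exact: (measurable_prodZ A_meas).
apply: measurable_bool_indicator; exact: (measurable_eq_size A_meas).
Qed.

Let past t := [seq (s, i) | s <- iota 1 t, i <- iota 0 (maxn N1 Nmax)].

(** The data up to iteration [t] are a function of the scenarios in [past t],
    hence independent of the row [t.+1], whose factor has mean at most [rho]. *)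
Lemma visit_step t :
  (\int[Pr]_w (visit w t * Z (V (mkseq (run w t.+1) n)))%:E <=
   rho%:E * \int[Pr]_w (visit w t)%:E)%E.
Proof.
pose L := past t; pose K := maxn N1 Nmax.
have [g0 _] : exists g : G, True.
  have [//|nog] := pselect (exists g : G, True).
  have : P [set: G] = 0%E.
    rewrite (_ : [set: G] = set0) ?measure0//; apply/seteqP; split => // g _.
    by exfalso; apply: nog; exists g.
  by rewrite probability_setT => /eqP; rewrite onee_eq0.
have uL : uniq (L ++ scenario_row t.+1 n).
  rewrite cat_uniq allpairs_uniq ?iota_uniq//=; last by move=> [? ?] [? ?].
  rewrite map_inj_uniq => [|i j []]; last exact: val_inj.
  rewrite enum_uniq andbT; apply/hasPn => _ /mapP[i _ ->].
  apply/negP => /allpairsP[[s j] /= [st _ [tE _]]].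
  by move: st; rewrite mem_iota -tE add1n ltnn andbF.
pose xi' s i (p : (size L).-tuple G) : G := nth g0 p (index (s, i) L).
have mxi' s i : measurable_fun [set: (size L).-tuple G] (xi' s i).
  have [iL|iL] := ltnP (index (s, i) L) (size L).
    rewrite (_ : xi' s i = (@tnth _ G)^~ (Ordinal iL)); first exact: measurable_tnth.
    by apply/funext => p; rewrite (tnth_nth g0).
  rewrite (_ : xi' s i = cst g0); first exact: measurable_cst.
  by apply/funext => p; rewrite /xi' nth_default// size_tuple.
pose tL w := map_tuple (fun k => xi k.1 k.2 w) (in_tuple L).
pose tR w := map_tuple (fun k => xi k.1 k.2 w) (scenario_row t.+1 n).
have [Phi [mPhi Phi0 PhiE]] : exists Phi : (size L).-tuple G -> R,
    [/\ measurable_fun [set: (size L).-tuple G] Phi, forall p, 0 <= Phi p &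
      forall w, visit w t = Phi (tL w)].
  exists (fun p => let D := data (fun s i => xi' s i p) t in
    prodZ n Z D * (next D == n)%:R); split => [|p|w].
  - exact: measurable_visit.
  - by apply: mulr_ge0; [exact: prodZ_ge0|exact: ler0n].
  suff -> : data (run w) t = data (fun s i => xi' s i (tL w)) t by [].
  apply: dataset_ext => s i /andP[s0 st] iK.
  have siL : (s, i) \in L.
    apply/allpairsP; exists (s, i); rewrite /= !mem_iota add0n iK leq0n add1n ltnS.
    by rewrite s0 st.
  by rewrite /xi' /tL (nth_map (s, i)) ?index_mem// nth_index.
have ZE w : Z (V (mkseq (run w t.+1) n)) = Z (V (tR w)) by rewrite mkseq_row.
have mZV : measurable_fun [set: n.-tuple G] (fun r => Z (V r)).
  by apply: (measurableT_comp mZ); exact: (measurable_risk A_meas).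
pose h1 (x : (size L).-tuple G * n.-tuple G) : \bar R := (Phi x.1 * Z (V x.2))%:E.
pose h2 (x : (size L).-tuple G * n.-tuple G) : \bar R := (rho * Phi x.1)%:E.
have mh1 : measurable_fun [set: (size L).-tuple G * n.-tuple G] h1.
  apply/measurable_EFinP; apply: measurable_funM; first exact: (measurableT_comp mPhi).
  exact: (measurableT_comp mZV).
have mh2 : measurable_fun [set: (size L).-tuple G * n.-tuple G] h2.
  by apply/measurable_EFinP; apply: measurable_funM => //; exact: (measurableT_comp mPhi).
have /andP[rho0 rho1] := rho01.
have -> : (\int[Pr]_w (visit w t * Z (V (mkseq (run w t.+1) n)))%:E =
    \int[Pr]_w h1 (tL w, tR w))%E.
  by apply: eq_integral => w _; rewrite PhiE ZE.
have -> : (\int[Pr]_w (visit w t)%:E = \int[Pr]_w (Phi (tL w))%:E)%E.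
  by apply: eq_integral => w _; rewrite PhiE.
have mtL : measurable_fun [set: W] tL.
  by apply: (measurable_map_tuple (xi := fun k => xi k.1 k.2)) => k; exact: mxi.
have -> : (rho%:E * \int[Pr]_w (Phi (tL w))%:E = \int[Pr]_w h2 (tL w, tR w))%E.
  rewrite -ge0_integralZl_EFin//.
  - by move=> w _; rewrite lee_fin.
  - by apply/measurable_EFinP; exact: (measurableT_comp mPhi).
have h10 x : (0 <= h1 x)%E by rewrite lee_fin; apply: mulr_ge0.
have h20 x : (0 <= h2 x)%E by rewrite lee_fin; apply: mulr_ge0.
rewrite (iid_two_tuples_integral (l1 := in_tuple L) (l2 := scenario_row t.+1 n)
  xi_iid uL mh1 h10).
rewrite (iid_two_tuples_integral (l1 := in_tuple L) (l2 := scenario_row t.+1 n)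
  xi_iid uL mh2 h20).
apply: ge0_le_integral => //.
- by move=> p _; apply: integral_ge0 => r _; rewrite lee_fin; apply: mulr_ge0.
- exact: (@measurable_fun_fubini_tonelli_F _ _ _ _ R (power_prob P n) h1 mh1 h10).
- exact: (@measurable_fun_fubini_tonelli_F _ _ _ _ R (power_prob P n) h2 mh2 h20).
- move=> p _; rewrite /h1 /h2 /=.
  under eq_integral do rewrite EFinM.
  rewrite ge0_integralZl_EFin//; last 2 first.
  - by move=> r _; rewrite lee_fin.
  - exact/measurable_EFinP.
  have -> : (\int[power_prob P n]_r (rho * Phi p)%:E = (rho * Phi p)%:E)%E.
    rewrite integral_cst// -[RHS]mule1; congr (_ * _)%E; exact: probability_setT.
  rewrite mulrC EFinM.
  by apply: lee_wpmul2l; rewrite ?lee_fin.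
Qed.

End energy.

(** * Likelihood products at recurrent sizes *)

Section recurrence.
Context (R : realType).

(** Every value of [u] is also the value at the next index where [b] holds. *)
Lemma recurrent_cvg0 (u : nat -> R) (b : nat -> bool) :
  (forall s, ~~ b s -> u s.+1 = u s) ->
  (forall t, exists2 s, (t <= s)%N & b s) ->
  u s * (b s)%:R @[s --> \oo] --> (0 : R) -> u @ \oo --> (0 : R).
Proof.
move=> ub recb /cvgrPdist_lt ub0; apply/cvgrPdist_lt => e e0.
have [t0 _ ht0] := ub0 e e0; exists t0 => // t /= t0t.
have [s ts bs] := recb t.
have : exists s', [&& (t <= s')%N & b s'] by exists s; rewrite ts bs.
move=> /ex_minnP[m /andP[tm bm] minm].
suff -> : u t = u m.
  by have := ht0 m (leq_trans t0t tm); rewrite /= bm mulr1.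
have : forall k, (t <= k <= m)%N -> u t = u k.
  elim=> [|k IH] /andP[tk km]; first by move: tk; rewrite leqn0 => /eqP ->.
  move: tk; rewrite leq_eqVlt => /predU1P[->//|]; rewrite ltnS => tk.
  rewrite ub; first by apply: IH; rewrite tk ltnW.
  apply/negP => bk; have := minm k; rewrite tk bk => /(_ isT).
  by rewrite leqNgt km.
by apply; rewrite tm leqnn.
Qed.

End recurrence.

Section energy_bound.
Context (R : realType) (X : Type) (J : X -> R).
Context (dG : measure_display) (G : measurableType dG) (ev : G -> X -> R).
Context (P : probability G R) (A : seq G -> X).
Hypothesis A_sol : forall s : seq G, unique (scenario_solution J ev s) (A s).
Context (d : nat) (d_gt0 : (0 < d)%N).
Hypothesis A_meas : scenario_measurable ev P A d.
Hypothesis A_complexity : fixed_complexity P A d.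
Context (eps beta : R) (eps_gt0 : 0 < eps) (eps_beta : eps < beta) (beta_lt1 : beta < 1).
Context (thetas : seq (R * nat) -> R) (thetas_mle : mle_selection thetas).
Context (N1 Nmax : nat).
Context (dW : measure_display) (W : measurableType dW) (Pr : probability W R).
Context (xi : nat -> nat -> W -> G).
Hypothesis xi_iid : iid Pr P (fun k : nat * nat => xi k.1 k.2).

Local Notation V s := (risk ev P (A s)).
Local Notation data run t := (dataset ev P A thetas eps beta N1 Nmax run t).
Local Notation next := (next_size thetas eps beta N1 Nmax).
Local Notation run w := (fun t i => xi t i w).

Let mxi t i : measurable_fun [set: W] (xi t i).
Proof. by have [+ _ _] := xi_iid => /(_ (t, i)). Qed.

Context (n : nat) (dn : (d <= n)%N) (Z : R -> R) (rho : R).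
Hypotheses (mZ : measurable_fun [set: R] Z) (Z0 : forall v, 0 <= Z v).
Hypothesis rho01 : 0 <= rho < 1.
Hypothesis Zrho : (\int[beta_prob d (n - d).+1]_v (Z v)%:E <= rho%:E)%E.

Local Notation U w t := (prodZ n Z (data (run w) t)).
Local Notation visit w t := (U w t * (next (data (run w) t) == n)%:R).

Let mvisitR t : measurable_fun [set: W] (fun w => visit w t).
Proof.
exact: (measurable_visit A_meas eps_gt0 eps_beta beta_lt1 thetas_mle N1 Nmax n mZ t mxi).
Qed.

Let mprod t : measurable_fun [set: W] (fun w => U w t).
Proof.
exact: (measurable_prodZ A_meas eps_gt0 eps_beta beta_lt1 thetas_mle N1 Nmax mxi n mZ t).
Qed.

Let mvisit t : measurable_fun [set: W] (fun w => (visit w t)%:E).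
Proof. by apply/measurable_EFinP; exact: mvisitR. Qed.

Let visit0 w t : (0 <= (visit w t)%:E)%E.
Proof. by rewrite lee_fin mulr_ge0// prodZ_ge0. Qed.

Let skip w t := U w t * (next (data (run w) t) != n)%:R.

Let mskip t : measurable_fun [set: W] (fun w => (skip w t)%:E).
Proof.
apply/measurable_EFinP; rewrite (_ : (fun w => _) = (fun w => U w t - visit w t)).
  apply: measurable_funB; first exact: mprod.
  exact: mvisitR.
apply/funext => w; rewrite /skip; case: (_ == n) => /=.
  by rewrite mulr0 mulr1 subrr.
by rewrite mulr1 mulr0 subr0.
Qed.

Let skip0 w t : (0 <= (skip w t)%:E)%E.
Proof. by rewrite lee_fin mulr_ge0// prodZ_ge0. Qed.

Let U_split w t : (U w t)%:E = ((skip w t)%:E + (visit w t)%:E)%E.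
Proof.
rewrite -EFinD /skip; congr EFin; case: (_ == n) => /=.
  by rewrite mulr0 mulr1 add0r.
by rewrite mulr1 mulr0 addr0.
Qed.

Let US_split w t : (U w t.+1)%:E =
  ((skip w t)%:E + (visit w t * Z (V (mkseq (run w t.+1) n)))%:E)%E.
Proof.
rewrite datasetS prodZ_rcons -EFinD /skip; congr EFin.
case: eqP => [/= ->|_ /=]; first by rewrite mulr1 mulr0 add0r.
by rewrite mulr1 mulr0 mul0r addr0.
Qed.

(** Each visit to [n] costs the process a fixed proportion of its mean. *)
Let energy_step t : (\int[Pr]_w (U w t.+1)%:E +
    (1 - rho)%:E * \int[Pr]_w (visit w t)%:E <= \int[Pr]_w (U w t)%:E)%E.
Proof.
have step := visit_step A_sol d_gt0 A_meas A_complexity eps_gt0 eps_beta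
  beta_lt1 thetas_mle N1 Nmax xi_iid dn mZ Z0 rho01 Zrho t.
have /andP[rho0 rho1] := rho01.
under eq_integral do rewrite US_split.
under [leRHS]eq_integral do rewrite U_split.
have mb : measurable_fun [set: W]
    (fun w => (visit w t * Z (V (mkseq (run w t.+1) n)))%:E).
  apply/measurable_EFinP; apply: measurable_funM; first exact: mvisitR.
  by apply: (measurableT_comp mZ); exact: (measurable_row_risk A_meas mxi).
have b0 w : (0 <= (visit w t * Z (V (mkseq (run w t.+1) n)))%:E)%E.
  by rewrite lee_fin mulr_ge0//; exact: visit0.
rewrite ge0_integralD// ge0_integralD// -addeA leeD2l//.
apply: (@le_trans _ _ (rho%:E * \int[Pr]_w (visit w t)%:E +
   (1 - rho)%:E * \int[Pr]_w (visit w t)%:E)%E); first exact: leeD2r.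
rewrite -ge0_muleDl ?lee_fin ?subr_ge0 ?(ltW rho1)//.
by rewrite -EFinD addrC subrK mul1e.
Qed.

(** [energy_step] telescopes from the empty product. *)
Let energy t : (\int[Pr]_w (U w t)%:E +
  (1 - rho)%:E * \sum_(s < t) \int[Pr]_w (visit w s)%:E <= 1)%E.
Proof.
have int0 s : (0 <= \int[Pr]_w (visit w s)%:E)%E by apply: integral_ge0 => w _; exact: visit0.
elim: t => [|t IH].
  rewrite big_ord0 mule0 adde0.
  have -> : (\int[Pr]_w (U w 0)%:E = \int[Pr]_w 1)%E.
    by apply: eq_integral => w _; rewrite /prodZ /= big_nil.
  by rewrite integral_cst// mul1e probability_le1.
apply: le_trans IH; rewrite big_ord_recr/= ge0_muleDr//; last exact: sume_ge0.
rewrite addeCA [leRHS]addeC; apply: leeD2l; exact: energy_step.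
Qed.

Let energy_sum : (\sum_(s <oo) \int[Pr]_w (visit w s)%:E <= ((1 - rho)^-1)%:E)%E.
Proof.
have /andP[rho0 rho1] := rho01; have r0 : 0 < 1 - rho by rewrite subr_gt0.
have int0 s : (0 <= \int[Pr]_w (visit w s)%:E)%E by apply: integral_ge0 => w _; exact: visit0.
apply: lime_le; first exact: is_cvg_nneseries.
apply: nearW => t; rewrite big_mkord.
have : ((1 - rho)%:E * \sum_(s < t) \int[Pr]_w (visit w s)%:E <= 1)%E.
  apply: le_trans (energy t); rewrite leeDr//.
  by apply: integral_ge0 => w _; rewrite lee_fin; exact: prodZ_ge0.
by rewrite -lee_pdivlMl// mule1.
Qed.

(** The visits to [n] have a finite total weight in expectation, hence almost
    surely, so the product tends to zero along them; between visits it does not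
    change. *)
Lemma recurrent_prodZ_cvg0 : {ae Pr, forall w,
  (forall t, exists2 s, (t <= s)%N & next (data (run w) s) == n) ->
  U w t @[t --> \oo] --> (0 : R)}.
Proof.
pose S w := (\sum_(s <oo) (visit w s)%:E)%E.
have S0 w : (0 <= S w)%E by apply: nneseries_ge0 => s _ _; exact: visit0.
have mS : measurable_fun [set: W] S.
  by apply: ge0_emeasurable_sum => // s w _ _; exact: visit0.
have intS : Pr.-integrable [set: W] S.
  apply/integrableP; split => //.
  under eq_integral do rewrite gee0_abs//.
  rewrite integral_nneseries//.
  by apply: le_lt_trans energy_sum _; rewrite ltry.
have := integrable_ae measurableT intS.
apply: filterS => w /(_ I) Sfin rec.
apply: (recurrent_cvg0 _ rec).
  move=> s /negbTE nn; rewrite datasetS prodZ_rcons /= nn mulr1.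
  by [].
apply: cvg_series_cvg_0; apply: nnseries_is_cvg.
  by move=> s; have := visit0 w s; rewrite lee_fin.
by move: Sfin; rewrite ge0_fin_numE.
Qed.

End energy_bound.

(** * Likelihood ratios at the data *)

Section data_likelihood.
Context (R : realType).

Implicit Types (theta : R) (D : seq (R * nat)).

(** The likelihood at [theta0] is positive, so a vanishing factor at the
    maximizer would contradict maximality. *)
Lemma mle_ge (D : seq (R * nat)) theta theta0 : is_mle D theta -> 0 < theta0 ->
  D <> [::] -> (forall p, p \in D -> 0 < dens theta0 p.1 p.2) ->
  (forall p, p \in D -> 0 < dens theta p.1 p.2) /\
  \sum_(p <- D) ln (dens theta0 p.1 p.2) <= \sum_(p <- D) ln (dens theta p.1 p.2).
Proof.
move=> [_ mle] t0 D0 pos0.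
have s0 : 0 < (size D)%:R^-1 :> R.
  by rewrite invr_gt0 ltr0n lt0n size_eq0; apply/eqP.
have finite t : (forall p, p \in D -> 0 < dens t p.1 p.2) ->
    loglik t D = ((size D)%:R^-1 * \sum_(p <- D) ln (dens t p.1 p.2))%:E.
  move=> pos; rewrite /loglik EFinM; congr (_ * _)%E.
  rewrite -sumEFin; apply: eq_big_seq => p pD; exact: lne_EFin (pos p pD).
have le := mle _ t0; rewrite (finite _ pos0) in le.
have pos p : p \in D -> 0 < dens theta p.1 p.2.
  move=> pD; rewrite ltNge; apply/negP => neg.
  have : loglik theta D = -oo%E.
    have Ny : (\sum_(p <- D) lne (dens theta p.1 p.2)%:E = -oo)%E.
      apply/esum_eqNyP; exists p; split; [exact: pD|by []|].
      by apply: le0_lneNy; rewrite lee_fin.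
    by rewrite /loglik Ny gt0_muleNy// lte_fin.
  by move=> E; move: le; rewrite E leeNy_eq.
split; first exact: pos.
by move: le; rewrite (finite _ pos) lee_fin ler_pM2l.
Qed.

Lemma dens1 theta N : theta < N%:R -> (0 < N)%N -> dens theta 1 N = 0.
Proof.
move=> tN N0; rewrite /dens oner_eq0 gtn_eqF//= tN subrr powR0 ?mulr0 ?mul0r//.
by rewrite gt_eqF// subr_gt0.
Qed.

Lemma dens1_top theta N : N%:R <= theta -> (0 < N)%N -> dens theta 1 N = N%:R.
Proof.
by move=> Nt N0; rewrite /dens oner_eq0 gtn_eqF//= ltNge Nt/= expr1n mulr1.
Qed.

Lemma dens_cap theta v N : 0 < v < 1 -> (0 < N)%N ->
  dens theta v N = dens (capped theta N) v N.
Proof.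
move=> v01 N0; rewrite !(dens_capped _ v01 N0).
by have -> : capped (capped theta N) N = capped theta N by rewrite /capped -minA minxx.
Qed.

Definition llr theta x0 v N := ln (dens theta v N) - ln (dens x0 v N).

(** The log-likelihood ratio is concave in its first parameter and vanishes at
    the second one, so it lies below the line through its values at [x0] and at
    an intermediate point. *)
Lemma llr_beyond theta x0 c v N : 0 < v < 1 -> (0 < N)%N ->
  0 < c <= 1 -> 0 < theta <= N%:R -> 0 < x0 <= N%:R ->
  llr theta x0 v N <= c^-1 * llr (c * theta + (1 - c) * x0) x0 v N.
Proof.
move=> v01 N0 /andP[c0 c1] tN xN; rewrite ler_pdivlMl// /llr.
have c01 : 0 <= c <= 1 by rewrite ltW.
have real a b e : c * a + (1 - c) * b <= e -> c * (a - b) <= e - b by lra.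
exact: real (ln_dens_concave v01 N0 c01 tN xN).
Qed.

Lemma llr_below theta x0 a v N : 0 < v < 1 -> (0 < N)%N ->
  0 < theta <= a -> a < x0 <= N%:R ->
  llr theta x0 v N <= (x0 - theta) / (x0 - a) * llr a x0 v N.
Proof.
move=> v01 N0 /andP[t0 ta] /andP[ax xN].
have xa0 : 0 < x0 - a by lra.
have xt0 : 0 < x0 - theta by lra.
have c0 : 0 < (x0 - a) / (x0 - theta) <= 1.
  by rewrite divr_gt0//= ler_pdivrMr// mul1r; lra.
have tN : 0 < theta <= N%:R by lra.
have xN' : 0 < x0 <= N%:R by lra.
have := llr_beyond v01 N0 c0 tN xN'.
have -> : (x0 - a) / (x0 - theta) * theta + (1 - (x0 - a) / (x0 - theta)) * x0 = a.
  by field; rewrite gt_eqF.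
by rewrite invf_div.
Qed.

(** Only the parameter capped at [N] matters, which makes the factor depend on
    [N]. *)
Lemma llr_above theta x0 b v N : 0 < v < 1 -> (0 < N)%N ->
  0 < x0 < b -> b <= theta -> b <= N%:R ->
  llr theta x0 v N <= (capped theta N - x0) / (b - x0) * llr b x0 v N.
Proof.
move=> v01 N0 /andP[x0' xb] bt bN.
have tb : b <= capped theta N by rewrite /capped le_min bt bN.
have tN' : capped theta N <= N%:R by rewrite /capped ge_min lexx orbT.
have -> : llr theta x0 v N = llr (capped theta N) x0 v N by rewrite /llr dens_cap.
move: tb tN'; set y := capped theta N => tb tN'.
have xb0 : 0 < b - x0 by lra.
have xt0 : 0 < y - x0 by lra.
have c0 : 0 < (b - x0) / (y - x0) <= 1.
  by rewrite divr_gt0//= ler_pdivrMr// mul1r; lra.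
have tN : 0 < y <= N%:R by lra.
have xN' : 0 < x0 <= N%:R by lra.
have := llr_beyond v01 N0 c0 tN xN'.
have -> : (b - x0) / (y - x0) * y + (1 - (b - x0) / (y - x0)) * x0 = b.
  by field; rewrite gt_eqF.
by rewrite invf_div.
Qed.

End data_likelihood.

Section dominating_size.
Context (R : realType).

(** Uniformity over the weights is what a maximizer, which varies with [t],
    requires: they stand for the factors in [llr_below] and [llr_above]. *)
Lemma weighted_sum_lt0 (H : nat -> nat -> R) (K : nat) (S : pred nat) (n0 : nat)
    (M : R) :
  (n0 < K)%N -> S n0 ->
  (forall n, S n -> exists C, \forall t \near \oo, H t n <= C) ->
  (forall C, \forall t \near \oo, H t n0 <= C) ->
  \forall t \near \oo, forall coef : nat -> R,
    (forall n, S n -> 1 <= coef n <= M) ->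
    \sum_(n < K | S n) coef n * H t n < 0.
Proof.
move=> n0K Sn0 bnd div.
have [C hC] : exists C : nat -> R, forall n, S n ->
    0 <= C n /\ \forall t \near \oo, H t n <= C n.
  have /choice[C hC] : forall n, exists C, S n -> 0 <= C /\ \forall t \near \oo, H t n <= C.
    move=> n; case: (boolP (S n)) => [Sn|_]; last by exists 0.
    have [C hC] := bnd n Sn; exists (Num.max 0 C) => _; split; first by rewrite le_max lexx.
    by apply: filterS hC => t /le_trans; apply; rewrite le_max lexx orbT.
  by exists C.
have [M1|M1] := ltP M 1.
  by apply: nearW => t coef /(_ n0 Sn0); lra.
pose B := \sum_(n < K | S n) M * C n.
have B0 : 0 <= B by apply: sumr_ge0 => n /hC[? _]; apply: mulr_ge0 => //; lra.
have all_bnd : \forall t \near \oo, forall n : 'I_K, S n -> H t n <= C n.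
  apply: filter_forall => n; case: (boolP (S n)) => [Sn|_]; last exact: nearW.
  by have [_] := hC n Sn; apply: filterS => t ? _.
near=> t => coef hcoef.
have Hall : forall n : 'I_K, S n -> H t n <= C n by near: t.
have Hn0 : H t n0 <= - B - 1 by near: t; exact: div.
rewrite (bigD1 (Ordinal n0K))//=.
have rest : \sum_(n < K | S n && (n != Ordinal n0K)) coef n * H t n <= B.
  apply: (@le_trans _ _ (\sum_(n < K | S n && (n != Ordinal n0K)) M * C n)).
    apply: ler_sum => n /andP[Sn _].
    have [Cn0 _] := hC n Sn; have /andP[c1 cM] := hcoef n Sn.
    have HC := Hall n Sn.
    apply: (@le_trans _ _ (coef n * C n)); first by rewrite ler_pM2l//; lra.
    exact: ler_wpM2r.
  rewrite /B [leRHS](bigD1 (Ordinal n0K))//= lerDr.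
  by have [? _] := hC n0 Sn0; apply: mulr_ge0 => //; lra.
have /andP[c1 cM] := hcoef n0 Sn0.
have : 0 <= (1 - coef n0) * H t n0 by apply: mulr_le0; lra.
by lra.
Unshelve. all: by end_near.
Qed.

Lemma recurrent_value (N : nat -> nat) (K : nat) (S : pred nat) :
  (forall t, (N t < K)%N) -> (forall t, exists2 s, (t <= s)%N & S (N s)) ->
  exists2 n, (n < K)%N & S n /\ forall t, exists2 s, (t <= s)%N & N s == n.
Proof.
move=> NK rec; apply: contrapT => none.
have /choice[f hf] : forall n, exists t0, (n < K)%N -> S n ->
    forall s, (t0 <= s)%N -> N s != n.
  move=> n; apply: contrapT => nex; apply: none; exists n.
    by rewrite ltnNge; apply/negP => Kn; apply: nex; exists 0%N; rewrite ltnNge Kn.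
  split; first by apply/negPn/negP => /negP Sn; apply: nex; exists 0%N.
  move=> t; apply: contrapT => nos; apply: nex; exists t => _ _ s ts.
  by apply/negP => Nsn; apply: nos; exists s.
have [s fs Ss] := rec (\max_(n < K) f n).
have := hf _ (NK s) Ss s; rewrite eqxx => /(_ _)/negP; apply => //.
by apply: leq_trans fs; rewrite -[N s]/(val (Ordinal (NK s))) leq_bigmax.
Qed.

End dominating_size.

(** * Convergence along one run *)

Section convergence.
Context (R : realType) (d : nat) (d_gt0 : (0 < d)%N).
Context (eps beta : R).
Hypotheses (eps_gt0 : 0 < eps) (eps_beta : eps < beta) (beta_lt1 : beta < 1).
Context (Nmax K : nat) (V : nat -> R) (N : nat -> nat) (th : nat -> R).

Local Notation D t := (mkseq (fun s => (V s, N s)) t).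
Local Notation H x t n := (\sum_(s < t | N s == n) llr x d%:R (V s) n).
Local Notation recurrent n := (forall t, exists2 s, (t <= s)%N & N s == n).

Hypothesis th_mle : forall t, is_mle (D t.+1) (th t.+1).
Hypothesis N_next : forall t, N t.+1 = minn (nbar (th t.+1) eps beta) Nmax.
Hypothesis N_lt : forall t, (N t < K)%N.
Hypothesis V_low : forall t, (N t < d)%N -> V t = 1.
Hypothesis V_high : forall t, (d <= N t)%N -> 0 < V t < 1.
Hypothesis nbar_le : (nbar d%:R eps beta <= Nmax)%N.
Hypothesis H_low : forall n m, (d <= n)%N -> recurrent n ->
  forall C, \forall t \near \oo, H (d%:R - m.+2%:R^-1) t n <= C.
Hypothesis H_high : forall n m, (d < n)%N -> recurrent n ->
  forall C, \forall t \near \oo, H (d%:R + m.+1%:R^-1) t n <= C.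

Let d_gt0R : 0 < d%:R :> R. Proof. by rewrite ltr0n. Qed.

Let th_gt0 t : 0 < th t.+1. Proof. by case: (th_mle t). Qed.

Let dens_d_gt0 s : 0 < dens d%:R (V s) (N s).
Proof.
have [N0|N0] := posnP (N s); first by rewrite N0 /dens orbT.
have [dN|Nd] := leqP d (N s); first exact: dens_gt0 (V_high dN) N0.
by rewrite (V_low Nd) dens1_top ?ler_nat ?(ltnW Nd)// ltr0n.
Qed.

Let sum_data (f : R -> nat -> R) t :
  \sum_(p <- D t) f p.1 p.2 = \sum_(s < t) f (V s) (N s).
Proof. by rewrite big_map -[X in iota 0 X](subn0 t) -/(index_iota 0 t) big_mkord. Qed.

Let mle_facts t : (forall s, (s < t.+1)%N -> 0 < dens (th t.+1) (V s) (N s)) /\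
  0 <= \sum_(s < t.+1) llr (th t.+1) d%:R (V s) (N s).
Proof.
have pos p : p \in D t.+1 -> 0 < dens d%:R p.1 p.2.
  by move=> /mapP[s _ ->]; exact: dens_d_gt0.
have nonnil : D t.+1 <> [::] by [].
have [pos' le] := mle_ge (th_mle t) d_gt0R nonnil pos.
split=> [s st|].
  by apply: (pos' (V s, N s)); apply: (map_f (fun s => (V s, N s))); rewrite mem_iota.
have subst (x y x' y' : R) : x = x' -> y = y' -> x <= y -> x' <= y' by move=> -> ->.
rewrite /llr sumrB subr_ge0.
exact: subst (sum_data (fun v n => ln (dens d%:R v n)) t.+1)
  (sum_data (fun v n => ln (dens (th t.+1) v n)) t.+1) le.
Qed.

(** The sizes smaller than [d] have risk one, and the density at risk one
    vanishes for the parameters below the size. Such sizes only tell that the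
    estimator is at least as large. *)
Let small_size t s : (s < t.+1)%N -> (N s < d)%N ->
  (N s)%:R <= th t.+1 /\ llr (th t.+1) d%:R (V s) (N s) = 0.
Proof.
move=> st Nd; have [pos _] := mle_facts t.
have [N0|N0] := posnP (N s).
  by rewrite N0 ltW// /llr /dens orbT subrr.
have Nth : (N s)%:R <= th t.+1.
  by rewrite leNgt; apply/negP => lt; have := pos s st; rewrite (V_low Nd) dens1 ?ltxx.
by split=> //; rewrite /llr (V_low Nd) !dens1_top ?ler_nat ?(ltnW Nd)// subrr.
Qed.

(** At a size that is not recurrent the sum is eventually constant. *)
Let H_bounded x n : (recurrent n -> forall C, \forall t \near \oo, H x t n <= C) ->
  exists C, \forall t \near \oo, H x t n <= C.
Proof.
have [rec /(_ rec 0) ?|nrec _] := pselect (recurrent n); first by exists 0.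
have [t0 ht0] : exists t0, forall s, (t0 <= s)%N -> N s != n.
  apply: contrapT => nex; apply: nrec => t; apply: contrapT => nos.
  by apply: nex; exists t => s ts; apply/negP => Ns; apply: nos; exists s.
exists (H x t0 n); exists t0 => // t /= t0t.
rewrite -(subnKC t0t); elim: (t - t0)%N => [|k IH]; first by rewrite addn0.
rewrite addnS big_mkcond big_ord_recr /= -big_mkcond /=.
by rewrite (negbTE (ht0 _ _)) ?leq_addr// addr0.
Qed.

Let sum_sizes (S : pred nat) (F : nat -> R -> R) t :
  \sum_(s < t | S (N s)) F (N s) (V s) =
  \sum_(n < K | S n) \sum_(s < t | N s == n) F n (V s).
Proof.
rewrite (partition_big (fun s : 'I_t => Ordinal (N_lt s)) (fun n : 'I_K => S n))//=.
apply: eq_bigr => n Sn; apply: eq_big => s.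
  rewrite -val_eqE /=; case: eqP => [->|_]; [by rewrite Sn|by rewrite andbF].
by case/andP => _ /eqP <-.
Qed.

(** At a maximizer the total log-likelihood ratio against [d] is nonnegative,
    whereas a domination by the ratios at [x] makes it negative by
    [weighted_sum_lt0]. *)
Let excluded (S : pred nat) (x M : R) n0 : (n0 < K)%N -> S n0 -> recurrent n0 ->
  (forall n, S n -> recurrent n -> forall C, \forall t \near \oo, H x t n <= C) ->
  \forall t \near \oo, forall coef : nat -> R,
    (forall n, S n -> 1 <= coef n <= M) ->
    (forall s, (s < t)%N -> S (N s) ->
      llr (th t) d%:R (V s) (N s) <= coef (N s) * llr x d%:R (V s) (N s)) ->
    (forall s, (s < t)%N -> ~~ S (N s) -> llr (th t) d%:R (V s) (N s) <= 0) ->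
    False.
Proof.
move=> n0K Sn0 rec0 HS.
have := @weighted_sum_lt0 R (fun t n => H x t n) K S n0 M n0K Sn0
  (fun n Sn => H_bounded (HS n Sn)) (HS n0 Sn0 rec0).
move=> [t0 _ ht0]; exists t0.+1 => // -[//|t] t0t coef hcoef le1 le2.
have [_] := mle_facts t; rewrite leNgt => /negP; apply.
apply: le_lt_trans (ht0 t.+1 (ltnW t0t) coef hcoef).
rewrite (bigID (fun s : 'I_t.+1 => S (N s)))/=.
rewrite -[leRHS]addr0; apply: lerD; last first.
  by apply: sumr_le0 => s Ss; exact: le2.
have -> : \sum_(n < K | S n) coef n * H x t.+1 n =
    \sum_(n < K | S n) \sum_(s < t.+1 | N s == n) coef n * llr x d%:R (V s) n.
  by apply: eq_bigr => n _; rewrite mulr_sumr.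
rewrite -(sum_sizes S (fun n v => coef n * llr x d%:R v n)).
by apply: ler_sum => s Ss; exact: le1.
Qed.

Let nbar_d : (d < nbar d%:R eps beta)%N.
Proof. by rewrite -(ltr_nat R); exact: nbar_gt. Qed.

(** Otherwise the estimator would eventually dominate the last size, and the
    estimate exceeds the estimator, so that the size would grow at each
    iteration. *)
Let large_sizes t : exists2 s, (t <= s)%N & (d <= N s)%N.
Proof.
apply: contrapT => none.
have small s : (t <= s)%N -> (N s < d)%N.
  by move=> ts; rewrite ltnNge; apply/negP => dN; apply: none; exists s.
suff grow k : (k <= N (t + k))%N by have := small _ (leq_addr d t); rewrite ltnNge grow.
elim: k => [//|k IH]; rewrite addnS.
have [Nth _] := small_size (ltnSn (t + k)) (small _ (leq_addr k t)).
have lt : (N (t + k) < nbar (th (t + k).+1) eps beta)%N.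
  by rewrite -(ltr_nat R); apply: le_lt_trans Nth _; exact: nbar_gt.
have := small (t + k).+1 (leqW (leq_addr k t)).
rewrite N_next !gtn_min; move: (nbar_d) nbar_le => dn nN.
move=> _; rewrite leq_min (leq_ltn_trans IH lt)/=.
have := small _ (leq_addr k t); move: IH; lia.
Qed.

(** Below [d - m.+2%:R^-1] the ratios at all sizes from [d] on are at most
    those at this parameter times a common factor, and one of these sizes is
    recurrent. *)
Let lower m : \forall t \near \oo, d%:R - m.+2%:R^-1 < th t.
Proof.
have [n0 n0K [dn0 rec0]] := recurrent_value N_lt large_sizes.
have m1 : 0 < (m.+2%:R^-1 : R) by rewrite invr_gt0.
have m2 : (m.+2%:R^-1 : R) < 1 by rewrite invf_lt1 ?ltr1n.
have d1 : 1 <= d%:R :> R by rewrite ler1n.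
set i : R := m.+2%:R^-1 in m1 m2 *.
set a := d%:R - i; have ha : 0 < a < d%:R by rewrite /a; lra.
near=> t; rewrite ltNge; apply/negP => tha.
have t0 : (0 < t)%N by near: t; exists 1%N.
have tpos : 0 < th t by move: (t0); case: (t) => // t' _; exact: th_gt0.
have da : 0 < d%:R - a by lra.
have : forall coef : nat -> R,
    (forall n, (d <= n)%N -> 1 <= coef n <= d%:R / (d%:R - a)) ->
    (forall s, (s < t)%N -> (d <= N s)%N ->
      llr (th t) d%:R (V s) (N s) <= coef (N s) * llr a d%:R (V s) (N s)) ->
    (forall s, (s < t)%N -> ~~ (d <= N s)%N -> llr (th t) d%:R (V s) (N s) <= 0) ->
    False.
  near: t; apply: (excluded (S := fun n => (d <= n)%N) _ n0K dn0 rec0).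
  by move=> n dn rec; exact: H_low.
move/(_ (fun=> (d%:R - th t) / (d%:R - a))); apply.
- move=> n _; rewrite ler_pdivlMr// mul1r ler_pM2r ?invr_gt0//.
  by apply/andP; split; lra.
- move=> s _ dN; apply: llr_below; [exact: V_high|exact: leq_trans dN| |].
    by rewrite tpos.
  by rewrite ler_nat dN andbT; case/andP: ha.
- move=> s st; rewrite -ltnNge => Nd; move: st tha tpos.
  by case: (t) => // t' st _ _; have [_ ->] := small_size st Nd.
Unshelve. all: by end_near.
Qed.

Let nbar_close : \forall theta \near (d%:R : R),
  (nbar d%:R eps beta <= nbar theta eps beta <= (nbar d%:R eps beta).+1)%N.
Proof. exact: nbar_near. Qed.

(** When the estimator is at least [d], the estimate exceeds it by [nbar_gt];
    when it is slightly less than [d], the estimate is at least that at [d] by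
    [nbar_near]. *)
Let sizes_gt_d : \forall t \near \oo, (d < N t)%N.
Proof.
have /nbhs_ballP[e /= e0 he] := nbar_close.
pose m := Num.truncn e^-1.
have me : m.+2%:R^-1 < e.
  rewrite invf_plt ?posrE//.
  by apply: lt_trans (truncnS_gt _) _; rewrite ltr_nat.
have [t0 _ ht0] := lower m.
exists t0.+1 => // -[//|t] /= t0t.
have := ht0 t.+1 (leqW t0t); rewrite /= => low.
rewrite N_next leq_min (leq_trans nbar_d nbar_le) andbT.
have [dth|thd] := leP d%:R (th t.+1).
  by rewrite -(ltr_nat R); apply: le_lt_trans dth _; exact: nbar_gt.
have /andP[+ _] : (nbar d%:R eps beta <= nbar (th t.+1) eps beta <= (nbar d%:R eps beta).+1)%N.
  have close (x y i : R) : x - i < y -> i < e -> x - y < e by lra.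
  apply: he; rewrite /= /ball/= ger0_norm; first exact: close low me.
  by rewrite subr_ge0 ltW.
exact: leq_trans.
Qed.

(** At size [d] all the parameters from [d] on have the same density, so that
    the argument of [lower] needs a recurrent size greater than [d]; such a
    size leaves room for the parameter [d + m.+1%:R^-1], at most [d + 1]. *)
Let upper m : \forall t \near \oo, th t < d%:R + m.+1%:R^-1.
Proof.
have large t : exists2 s, (t <= s)%N & (d < N s)%N.
  have [t0 _ ht0] := sizes_gt_d; exists (maxn t t0); first exact: leq_maxl.
  by apply: ht0; exact: leq_maxr.
have [n0 n0K [dn0 rec0]] := recurrent_value N_lt large.
have m1 : 0 < (m.+1%:R^-1 : R) by rewrite invr_gt0.
have m2 : (m.+1%:R^-1 : R) <= 1 by rewrite invf_le1 ?ler1n.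
set i : R := m.+1%:R^-1 in m1 m2 *.
set b := d%:R + i; have hb : d%:R < b <= d%:R + 1 by rewrite /b; lra.
have bn n : (d < n)%N -> b <= n%:R.
  by move=> dn; apply: (@le_trans _ _ (d%:R + 1)); [lra|rewrite natr1 ler_nat].
near=> t; rewrite ltNge; apply/negP => thb.
have t0 : (0 < t)%N by near: t; exists 1%N.
have db : 0 < b - d%:R by lra.
(* The factor in [llr_above] is at most the size divided by [b - d], so [K]
   bounds it uniformly. *)
pose S n := (d < n < K)%N.
have : forall coef : nat -> R,
    (forall n, S n -> 1 <= coef n <= K%:R / (b - d%:R)) ->
    (forall s, (s < t)%N -> S (N s) ->
      llr (th t) d%:R (V s) (N s) <= coef (N s) * llr b d%:R (V s) (N s)) ->
    (forall s, (s < t)%N -> ~~ S (N s) -> llr (th t) d%:R (V s) (N s) <= 0) ->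
    False.
  near: t; apply: (excluded _ n0K _ rec0); first by rewrite /S dn0.
  by move=> n /andP[dn _] rec; exact: H_high.
move/(_ (fun n => (capped (th t) n - d%:R) / (b - d%:R))); apply.
- move=> n /andP[dn nK]; rewrite ler_pdivlMr// mul1r ler_pM2r ?invr_gt0//.
  have cn : capped (th t) n <= n%:R by rewrite /capped ge_min lexx orbT.
  have bc : b <= capped (th t) n by rewrite /capped le_min thb bn.
  have : n%:R <= K%:R :> R by rewrite ler_nat ltnW.
  by move: d_gt0R => d0 nK'; apply/andP; split; lra.
- move=> s _ /andP[dN _]; apply: llr_above => //.
  + by apply: V_high; exact: ltnW.
  + exact: leq_ltn_trans dN.
  + by rewrite d_gt0R; case/andP: hb.
  + exact: bn.
- move=> s st; rewrite /S N_lt andbT -leqNgt leq_eqVlt => /predU1P[Nd|Nd].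
    have dN : (d <= N s)%N by rewrite Nd.
    have N0 : (0 < N s)%N by exact: leq_trans dN.
    rewrite /llr (dens_cap (th t) (V_high dN) N0) (_ : capped _ _ = d%:R) ?subrr//.
    by rewrite /capped Nd min_r//; lra.
  move: st thb; case: (t) => // t' st _.
  by have [_ ->] := small_size st Nd.
Unshelve. all: by end_near.
Qed.

Lemma estimator_cvg : th @ \oo --> (d%:R : R).
Proof.
apply/cvgrPdist_lt => e e0.
pose m := Num.truncn e^-1.
have me : m.+1%:R^-1 < e by rewrite invf_plt ?posrE// truncnS_gt.
have me2 : m.+2%:R^-1 < e.
  by apply: le_lt_trans me; rewrite lef_pV2 ?posrE// ler_nat.
near=> t; have lo : d%:R - m.+2%:R^-1 < th t by near: t; exact: lower.
have up : th t < d%:R + m.+1%:R^-1 by near: t; exact: upper.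
have close (x y i j : R) : x - i < y -> y < x + j -> i < e -> j < e -> - e < x - y < e.
  by move=> *; apply/andP; split; lra.
by rewrite ltr_norml; exact: close lo up me2 me.
Unshelve. all: by end_near.
Qed.

Lemma sizes_near : \forall t \near \oo,
  ((nbar d%:R eps beta) <= N t <= (nbar d%:R eps beta).+1)%N.
Proof.
have [t0 _ ht0] := estimator_cvg nbar_close.
exists t0.+1 => // -[//|t] t0t.
have /andP[lo up] := ht0 t.+1 (leqW t0t).
by rewrite N_next leq_min lo nbar_le/= geq_min up.
Qed.

End convergence.

(** * Almost sure properties of the runs *)

Section almost_sure.
Context (R : realType) (X : Type) (J : X -> R).
Context (dG : measure_display) (G : measurableType dG) (ev : G -> X -> R).
Context (P : probability G R) (A : seq G -> X).
Hypothesis A_sol : forall s : seq G, unique (scenario_solution J ev s) (A s).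
Context (d : nat) (d_gt0 : (0 < d)%N).
Hypothesis A_meas : scenario_measurable ev P A d.
Hypothesis A_complexity : fixed_complexity P A d.

Local Notation V s := (risk ev P (A s)).

(** Beta laws have no atoms. *)
Lemma large_sample_risk n : (d <= n)%N ->
  power_prob P n [set s : n.-tuple G | (V s == 0) || (V s == 1)] = 0%E.
Proof.
move=> dn; pose B : set (measurableTypeR R) := [set v | (v == 0) || (v == 1)].
have mB : measurable B.
  rewrite (_ : B = [set 0] `|` [set 1]); first exact: measurableU.
  apply/seteqP; split => v /=; first by case/orP => /eqP ->; [left|right].
  by case=> ->; rewrite /B/= eqxx ?orbT.
have := risk_beta_law A_sol d_gt0 A_meas A_complexity (n - d) mB.
rewrite subnKC// => E; transitivity (beta_prob d (n - d).+1 B); first exact: E.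
have /null_content_dominatesP := @beta_prob_dom R d (n - d).+1; apply => //.
apply: countable_lebesgue_measure0; rewrite (_ : B = [set` [:: 0; 1]]).
  exact/finite_set_countable/finite_seq.
by apply/seteqP; split => v /=; rewrite !inE.
Qed.

Lemma confidence_low n (eps : R) : (n < d)%N -> eps < 1 ->
  confidence ev P A eps n = 0%E.
Proof.
move=> nd e1; apply: (subset_measure0 _ _ _ (small_sample_risk A_sol d_gt0 A_meas A_complexity nd)).
- rewrite (_ : mkset _ = [set s : n.-tuple G | `]-oo, eps]%classic (V s)]).
    by apply: (measurable_risk_set A_meas); exact: measurable_itv.
  by apply/seteqP; split => s /=; rewrite in_itv.
- rewrite (_ : mkset _ = [set s : n.-tuple G | (~` [set 1]) (V s)]).
    by apply: (measurable_risk_set A_meas); apply: measurableC; exact: measurable_set1.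
  by apply/seteqP; split => s /= /eqP.
- by move=> s /= Ve; rewrite lt_eqF// (le_lt_trans Ve).
Qed.

Lemma confidence_cdf n (eps : R) : (d <= n)%N -> 0 < eps <= 1 ->
  confidence ev P A eps n = (dens_cdf d%:R eps n)%:E.
Proof.
move=> dn e01; rewrite -dens_cdf_beta_prob// /confidence.
have := risk_beta_law A_sol d_gt0 A_meas A_complexity (n - d)
  (measurable_itv `[0%R, eps]).
rewrite subnKC// => <-; congr (power_prob P n _).
apply/seteqP; split => s /=; rewrite in_itv/=; first by rewrite risk_ge0.
by case/andP.
Qed.

(** From [d] on, the confidence is the distribution function of the member of
    parameter [d] of the family; below [d] it vanishes, while the estimate at
    [d] is greater than [d]. *)
Lemma Nstar_nbar (eps beta : R) : 0 < eps -> eps < beta -> beta < 1 ->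
  nat_min [set n | (beta%:E <= confidence ev P A eps n)%E] = nbar d%:R eps beta.
Proof.
move=> e0 eb b1; have d0 : 0 < d%:R :> R by rewrite ltr0n.
have e1 : eps < 1 by exact: lt_trans eb b1.
rewrite nbarE//; congr nat_min; apply/seteqP; split => n /=.
  have [dn|nd] := leqP d n; last first.
    by rewrite confidence_low// lee_fin leNgt (lt_trans e0 eb).
  rewrite confidence_cdf ?e0 ?(ltW e1)// lee_fin => bn; split => //.
  exact: leq_trans d_gt0 dn.
move=> rel; have := reliable_gt e0 eb b1 rel; rewrite ltr_nat => dn.
rewrite confidence_cdf ?(ltnW dn) ?e0 ?(ltW e1)// lee_fin.
by case: rel.
Qed.

Context (eps beta : R).
Hypotheses (eps_gt0 : 0 < eps) (eps_beta : eps < beta) (beta_lt1 : beta < 1).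
Context (thetas : seq (R * nat) -> R) (thetas_mle : mle_selection thetas).
Context (N1 Nmax : nat).
Context (dW : measure_display) (W : measurableType dW) (Pr : probability W R).
Context (xi : nat -> nat -> W -> G).
Hypothesis xi_iid : iid Pr P (fun k : nat * nat => xi k.1 k.2).

Local Notation data run t := (dataset ev P A thetas eps beta N1 Nmax run t).
Local Notation next := (next_size thetas eps beta N1 Nmax).
Local Notation run w := (fun t i => xi t i w).
Local Notation size w t := (next (data (run w) t)).
Local Notation risk_at w t := (V (mkseq (run w t.+1) (size w t))).

(** Null events are transferred to the scenarios of the algorithm for all rows
    and all sizes, since the size of an iteration is random. *)
Let row_null t n (B : set R) : measurable B ->
  power_prob P n [set s : n.-tuple G | B (V s)] = 0%E ->
  {ae Pr, forall w, ~ B (V (mkseq (run w t) n))}.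
Proof.
move=> mB B0; have mBV := measurable_risk_set A_meas (N := n) mB.
have ul : uniq (scenario_row t n).
  rewrite map_inj_uniq => [|i j []]; last exact: val_inj.
  exact: enum_uniq.
have E := iid_tuple_law xi_iid ul mBV.
exists ((fun w => map_tuple (fun k => xi k.1 k.2 w) (scenario_row t n)) @^-1`
  [set s | B (V s)]); split.
- have mrow : measurable_fun [set: W]
      (fun w => map_tuple (fun k => xi k.1 k.2 w) (scenario_row t n)).
    apply: (measurable_map_tuple (xi := fun k => xi k.1 k.2)) => k.
    by have [+ _ _] := xi_iid; apply.
  by rewrite -[X in measurable X]setTI; exact: mrow.
- by rewrite -B0; exact: E.
- by move=> w /= /contrapT; rewrite mkseq_row.
Qed.

Lemma ae_risk : {ae Pr, forall w, forall t,
  ((size w t < d)%N -> risk_at w t = 1) /\ ((d <= size w t)%N -> 0 < risk_at w t < 1)}.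
Proof.
have low t n : {ae Pr, forall w, (n < d)%N -> V (mkseq (run w t) n) = 1}.
  have [nd|dn] := ltnP n d; last by apply: nearW.
  have mB : measurable (~` [set 1] : set R) by apply: measurableC; exact: measurable_set1.
  have B0 : power_prob P n [set s : n.-tuple G | (~` [set 1]) (V s)] = 0%E.
    rewrite -(small_sample_risk A_sol d_gt0 A_meas A_complexity nd).
    by congr (power_prob P n _); apply/seteqP; split => s /=; move/eqP.
  by have := row_null t mB B0; apply: filterS => w /contrapT + _.
have high t n : {ae Pr, forall w, (d <= n)%N -> 0 < V (mkseq (run w t) n) < 1}.
  have [nd|dn] := ltnP n d; first by apply: nearW.
  have mB : measurable ([set 0] `|` [set 1] : set R).
    by apply: measurableU; exact: measurable_set1.
  have B0 : power_prob P n [set s : n.-tuple G | ([set 0] `|` [set 1]) (V s)] = 0%E.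
    rewrite -(large_sample_risk dn); congr (power_prob P n _).
    apply/seteqP; split => s /=; first by case=> ->; rewrite eqxx ?orbT.
    by case/orP => /eqP ->; [left|right].
  have := row_null t mB B0; apply: filterS => w nB _.
  have V0 := risk_ge0 ev P (A (mkseq (run w t) n)).
  have V1 := risk_le1 A_meas (A (mkseq (run w t) n)).
  rewrite !lt_neqAle V0 V1 !andbT; apply/andP; split; apply/eqP => E; apply: nB.
    by left.
  by right.
have low' := ae_foralln (fun t => ae_foralln (low t.+1)).
have high' := ae_foralln (fun t => ae_foralln (high t.+1)).
by apply: filterS2 low' high' => w lo hi t; split; [exact: lo|exact: hi].
Qed.

Lemma data_mkseq w t : data (run w) t = mkseq (fun s => (risk_at w s, size w s)) t.
Proof. by elim: t => [//|t IH]; rewrite datasetS mkseqS {1}IH. Qed.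

Let prodZ_llr (V' : nat -> R) (N : nat -> nat) (x : R) n t :
  (forall s, (d <= N s)%N -> 0 < V' s < 1) -> (d <= n)%N -> 0 < x <= n%:R ->
  prodZ n (fun v => expR (half_llr x d%:R n v)) (mkseq (fun s => (V' s, N s)) t) =
  expR ((\sum_(s < t | N s == n) llr x d%:R (V' s) n) / 2).
Proof.
move=> V01 dn xn; have n0 : (0 < n)%N by exact: leq_trans dn.
have dn' : 0 < (d%:R : R) <= n%:R by rewrite ltr0n d_gt0 ler_nat.
rewrite /prodZ big_map -[X in iota 0 X](subn0 t) -/(index_iota 0 t) big_mkord /=.
rewrite mulr_suml expR_sum; apply: eq_bigr => s /eqP Ns; congr expR.
by apply: half_llrE => //; apply: V01; rewrite Ns.
Qed.

(** The square roots of the likelihood ratios of [x] against [d] at size [n]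
    are the factors in [recurrent_prodZ_cvg0]: their mean is a Hellinger
    affinity. *)
Lemma ae_llr (x : R) n : (d <= n)%N -> 0 < x <= n%:R -> x != d%:R ->
  {ae Pr, forall w, (forall t, exists2 s, (t <= s)%N & size w s == n) ->
    (forall s, (d <= size w s)%N -> 0 < risk_at w s < 1) ->
    forall C, \forall t \near \oo,
      \sum_(s < t | size w s == n) llr x d%:R (risk_at w s) n <= C}.
Proof.
move=> dn xn xd.
have [rho rho01 rhoE] := beta_hellinger d_gt0 dn xn xd.
have Z0 v : 0 <= expR (half_llr x d%:R n v) by exact: expR_ge0.
have := recurrent_prodZ_cvg0 A_sol d_gt0 A_meas A_complexity eps_gt0 eps_beta
  beta_lt1 thetas_mle N1 Nmax xi_iid dn (measurable_half_llr x d%:R n) Z0 rho01 rhoE.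
apply: filterS => w cvg rec V01 C.
have /cvgrPdist_lt/(_ (expR (C / 2)) (expR_gt0 _)) := cvg rec.
move=> [t0 _ ht0]; exists t0 => // t t0t.
have := ht0 t t0t; rewrite /= data_mkseq (prodZ_llr _ V01 dn xn).
rewrite sub0r normrN gtr0_norm ?expR_gt0// ltr_expR ltr_pM2r ?invr_gt0//.
exact: ltW.
Qed.

End almost_sure.

(** * Convergence of the algorithm *)

Theorem theorem1 (R : realType) (X : Type) (J : X -> R)
    (* the set of constraint functions, with its sigma-algebra *)
    (dG : measure_display) (G : measurableType dG) (ev : G -> X -> R)
    (ev_inj : injective ev) (P : probability G R)
    (A : seq G -> X)
    (A_sol : forall s : seq G, unique (scenario_solution J ev s) (A s))
    (d : nat) (d_gt0 : (0 < d)%N)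
    (A_meas : scenario_measurable ev P A d)
    (A_complexity : fixed_complexity P A d)
    (eps beta : R) (eps_gt0 : 0 < eps) (eps_lt_beta : eps < beta)
    (beta_lt1 : beta < 1)
    (Nstar : nat)
    (NstarE : Nstar = nat_min [set N | (beta%:E <= confidence ev P A eps N)%E])
    (thetas : seq (R * nat) -> R) (thetas_mle : mle_selection thetas)
    (N1 Nmax : nat) (Nstar_le : (Nstar <= Nmax)%N)
    (* the i.i.d. scenarios drawn by the algorithm: the one with index (t, i)
       is available at iteration t *)
    (dW : measure_display) (W : measurableType dW) (Pr : probability W R)
    (xi : nat -> nat -> W -> G)
    (xi_iid : iid Pr P (fun k : nat * nat => xi k.1 k.2)) :
  let run w t i := xi t i w in
  let N_ w t := sample_size ev P A thetas eps beta N1 Nmax (run w) t in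
  let theta_ w t := theta_seq ev P A thetas eps beta N1 Nmax (run w) t in
  {ae Pr, forall w : W,
    (theta_ w t @[t --> \oo] --> (d%:R : R)) /\
    (exists2 t0 : nat, (0 < t0)%N &
       forall t, (t0 <= t)%N -> (Nstar.-1 <= N_ w t <= Nstar.+1)%N)}.
Proof.
move=> run N_ theta_; pose data w := dataset ev P A thetas eps beta N1 Nmax (run w).
pose size w t := next_size thetas eps beta N1 Nmax (data w t).
pose risk_at w t := risk ev P (A (mkseq (run w t.+1) (size w t))).
have d1 : 1 <= d%:R :> R by rewrite ler1n.
have m_gt0 m : 0 < (m.+1%:R^-1 : R) by rewrite invr_gt0.
have m_le1 m : (m.+1%:R^-1 : R) <= 1 by rewrite invf_le1 ?ler1n.
have m_lt1 m : (m.+2%:R^-1 : R) < 1 by rewrite invf_lt1 ?ltr1n.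
have below (i : R) : 0 < i -> i < 1 -> 0 < d%:R - i < d%:R.
  by move=> *; apply/andP; split; lra.
have above (i : R) : 0 < i -> i <= 1 -> 0 < d%:R + i <= d%:R + 1 /\ d%:R < d%:R + i.
  by move=> *; split; lra.
have ae_low : {ae Pr, forall w, forall n m, (d <= n)%N ->
    (forall t, exists2 s, (t <= s)%N & size w s == n) ->
    (forall s, (d <= size w s)%N -> 0 < risk_at w s < 1) -> forall C : R,
    \forall t \near \oo,
      \sum_(s < t | size w s == n) llr (d%:R - m.+2%:R^-1) d%:R (risk_at w s) n <= C}.
  apply: ae_foralln => n; apply: ae_foralln => m.
  have [dn|nd] := leqP d n; last by apply: nearW.
  have /andP[x0 xd] := below _ (m_gt0 m.+1) (m_lt1 m).
  have xn : 0 < (d%:R - m.+2%:R^-1 : R) <= n%:R.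
    by rewrite x0/= (le_trans (ltW xd))// ler_nat.
  have := ae_llr A_sol d_gt0 A_meas A_complexity eps_gt0 eps_lt_beta beta_lt1
    thetas_mle N1 Nmax xi_iid dn xn (negbT (lt_eqF xd)).
  by apply: filterS => w + _.
have ae_high : {ae Pr, forall w, forall n m, (d < n)%N ->
    (forall t, exists2 s, (t <= s)%N & size w s == n) ->
    (forall s, (d <= size w s)%N -> 0 < risk_at w s < 1) -> forall C : R,
    \forall t \near \oo,
      \sum_(s < t | size w s == n) llr (d%:R + m.+1%:R^-1) d%:R (risk_at w s) n <= C}.
  apply: ae_foralln => n; apply: ae_foralln => m.
  have [nd|dn] := leqP n d; first by apply: nearW.
  have [/andP[x0 x1] dx] := above _ (m_gt0 m) (m_le1 m).
  have xn : 0 < (d%:R + m.+1%:R^-1 : R) <= n%:R.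
    by rewrite x0/= (le_trans x1)// natr1 ler_nat.
  have := ae_llr A_sol d_gt0 A_meas A_complexity eps_gt0 eps_lt_beta beta_lt1
    thetas_mle N1 Nmax xi_iid (ltnW dn) xn (negbT (gt_eqF dx)).
  by apply: filterS => w + _.
have ae_V := ae_risk A_sol d_gt0 A_meas A_complexity eps beta thetas N1 Nmax xi_iid.
apply: filterS3 ae_low ae_high ae_V => w low high V01.
have nbarN : nbar d%:R eps beta = Nstar.
  by rewrite NstarE (Nstar_nbar A_sol d_gt0 A_meas A_complexity eps_gt0 eps_lt_beta beta_lt1).
pose th t := thetas (data w t).
have dataE t : data w t = mkseq (fun s => (risk_at w s, size w s)) t.
  exact: data_mkseq.
have mle t : is_mle (mkseq (fun s => (risk_at w s, size w s)) t.+1) (th t.+1).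
  have [mleT _] := thetas_mle; rewrite /th -dataE; apply: mleT.
    by rewrite dataE.
  exact: (dataset_valid A_meas).
have next t : size w t.+1 = minn (nbar (th t.+1) eps beta) Nmax.
  by rewrite /size /th; move: (dataE t.+1); case: (data w t.+1).
have size_lt t : (size w t < (maxn N1 Nmax).+1)%N by rewrite ltnS next_size_le.
have V_low t := (V01 t).1; have V_high t := (V01 t).2.
have nbar_le : (nbar d%:R eps beta <= Nmax)%N by rewrite nbarN.
have H_low n m dn rec := low n m dn rec V_high.
have H_high n m dn rec := high n m dn rec V_high.
split.
  exact: (estimator_cvg d_gt0 eps_gt0 eps_lt_beta beta_lt1 mle next size_lt V_low V_high
    nbar_le H_low H_high).
have := sizes_near d_gt0 eps_gt0 eps_lt_beta beta_lt1 mle next size_lt V_low V_high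
    nbar_le H_low H_high.
move=> [t0 _ ht0]; exists t0.+1 => // -[//|t] t0t.
have := ht0 t t0t; rewrite /= nbarN => /andP[lo up].
by rewrite (leq_trans (leq_pred _) lo) up.
Qed.
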